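(* Let $(G,G_0,G_{\mathrm f})$ be a condensing IMG group triplet with hyperfinite abelian ambient group $G$. Then for any internal set $D$ such that $G_0\subseteq D\subseteq G_{\mathrm f}$, $d=1/|D|$ is a normalizing multiplier for $(G,G_0,G_{\mathrm f})$ and $\hat d=|D|/|G|$ is a normalizing multiplier for the dual triplet $(\widehat G,G_{\mathrm f}^{\sim},G_0^{\sim})$. More generally, if $d$ is any normalizing multiplier for $(G,G_0,G_{\mathrm f})$, then $\hat d=(d|G|)^{-1}$ is a normalizing multiplier for $(\widehat G,G_{\mathrm f}^{\sim},G_0^{\sim})$.
   Context: Nonstandard setting: one works in a $\kappa$-saturated nonstandard universe (elementary extension $X\mapsto{}^*X$ of a superstructure), $\kappa$ uncountable. ''Admissible size'' means external cardinality $<\kappa$. A monadic set is the intersection, and a galactic set the union, of a family of admissible size of internal sets. A hyperfinite set is an internal set in internal bijection with $\{1,\dots,n\}$ for some $n\in{}^*\mathbb N$; $|A|=n$ is its internal number of elements. For hypercomplex numbers, $a\approx b$ means that $a-b$ is infinitesimal. $\mathbb T$ is the multiplicative group of complex numbers of modulus 1. Triplets: an IMG group triplet with hyperfinite abelian ambient group is $(G,G_0,G_{\mathrm f})$, where $G$ is an internal hyperfinite abelian group (written additively), $G_0\subseteq G_{\mathrm f}$ are subgroups of $G$, $G_0$ is monadic and $G_{\mathrm f}$ is galactic. It is condensing if for every internal $A\subseteq G_{\mathrm f}$ and every symmetric internal $B$ with $G_0\subseteq B\subseteq G$, $A$ is covered by a (standardly) finite number of translates of $B$; equivalently, $|A|/|B|$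 is finite and noninfinitesimal for any internal sets $A,B$ with $G_0\subseteq A,B\subseteq G_{\mathrm f}$. Dual triplet: $\widehat G$ is the (hyperfinite abelian) group of all internal homomorphisms $G\to{}^*\mathbb T$. For $A\subseteq G$, $A^{\sim}=\{\gamma\in\widehat G:\gamma(a)\approx1\text{ for all }a\in A\}$. The triplet $(\widehat G,G_{\mathrm f}^{\sim},G_0^{\sim})$ is again a condensing IMG group triplet with hyperfinite abelian ambient group. A normalizing multiplier for a condensing triplet $(G,G_0,G_{\mathrm f})$ with hyperfinite ambient group is a positive $d\in{}^*\mathbb R$ such that $d|A|$ is finite and noninfinitesimal for some (equivalently, for each) internal set $A$ with $G_0\subseteq A\subseteq G_{\mathrm f}$. *)

(* Defs.v *)
From HB Require Import structures.
From mathcomp Require Import all_boot all_order all_algebra.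
From mathcomp Require Import boolp classical_sets functions cardinality reals.
From mathcomp Require Import complex.

Set Implicit Arguments.
Unset Strict Implicit.
Unset Printing Implicit Defensive.

Import Order.TTheory GRing.Theory Num.Theory.

Local Open Scope classical_set_scope.
Local Open Scope card_scope.
Local Open Scope ring_scope.
Local Open Scope complex_scope.

(* Both the superstructure and the collection of all internal objects are
   structures for the language of set theory.  Pointedness only serves to make
   the description operator [get] available. *)
Record eps_structure := EpsStructure {
  eps_sort :> pointedType;
  eps : eps_sort -> eps_sort -> Prop }.

Definition elems (M : eps_structure) (A : M) : set M := [set x | eps x A].

(* Kuratowski pairs; [app f a] is the value at a of the function with graph f.
   These are meaningful when the described object exists, which for pairs is
   the case in a superstructure and hence, by transfer, among internal
   objects. *)
Definition upair (M : eps_structure) (a b : M) : M :=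
  get [set c | elems c = [set a; b]].

Definition opair (M : eps_structure) (a b : M) : M :=
  upair (upair a a) (upair a b).

Definition app (M : eps_structure) (f a : M) : M :=
  get [set b | eps (opair a b) f].

(* Formulas with bounded quantifiers only; variables are named by naturals and
   [FAll i j f] is "for all v_i in v_j, f". *)
Inductive bformula :=
| FEq of nat & nat
| FMem of nat & nat
| FNot of bformula
| FAnd of bformula & bformula
| FAll of nat & nat & bformula.

Fixpoint sat (M : eps_structure) (e : nat -> M) (f : bformula) : Prop :=
  match f with
  | FEq i j => e i = e j
  | FMem i j => eps (e i) (e j)
  | FNot g => ~ sat e g
  | FAnd g h => sat e g /\ sat e h
  | FAll i j g =>
      forall x, eps x (e j) -> sat (fun k => if k == i then x else e k) g
  end.

(* The levels V_0 = X and V_(n+1) = V_n `|` P(V_n) over the set X = indiv of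
   individuals. *)
Fixpoint rank_level (M : eps_structure) (indiv : set M) (n : nat) : set M :=
  match n with
  | 0 => indiv
  | m.+1 => rank_level indiv m `|`
            [set a | ~ indiv a /\ elems a `<=` rank_level indiv m]
  end.

(* The superstructure over a set of individuals that includes the complex
   numbers (so that elements of nat and R are individuals as well).  The fields
   determine it up to isomorphism over its individuals: [ss_ext] and
   [ss_power] say that the sets of level n+1 are exactly the subsets of
   level n. *)
Record superstructure (R : realType) := Superstructure {
  ss_eps :> eps_structure;
  indiv : set ss_eps;
  cplx : R[i] -> ss_eps;
  cplx_inj : injective cplx;
  cplx_indiv : range cplx `<=` indiv;
  indiv_elems : forall a, indiv a -> elems a = set0;
  ss_ext : forall a b, ~ indiv a -> ~ indiv b -> elems a = elems b -> a = b;
  ss_power : forall n (P : set ss_eps), P `<=` rank_level indiv n ->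
    exists2 a, ~ indiv a & elems a = P;
  ss_rank : forall a, exists n, rank_level indiv n a }.

Arguments indiv {R} s.
Arguments cplx {R} s.

Section Superstructure.
Variables (R : realType) (V : superstructure R).

(* The set with extension P; it exists when P is bounded in rank. *)
Definition sset (P : set V) : V := get [set a | ~ indiv V a /\ elems a = P].

Definition indiv_set : V := sset (indiv V).
Definition nat_set : V := sset (range (fun n : nat => cplx V n%:R)).
Definition real_set : V := sset (range (fun x : R => cplx V x%:C)).
Definition circle_set : V := sset (cplx V @` [set z | `|z| = 1]).
Definition lt_graph : V :=
  sset [set p | exists x y : R, x < y /\ p = opair (cplx V x%:C) (cplx V y%:C)].
Definition graph1 (f : R[i] -> R[i]) : V :=
  sset [set p | exists x, p = opair (cplx V x) (cplx V (f x))].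
Definition graph2 (f : R[i] -> R[i] -> R[i]) : V :=
  sset [set p | exists x y,
    p = opair (opair (cplx V x) (cplx V y)) (cplx V (f x y))].

End Superstructure.

Definition card_lt (T U : Type) (A : set T) (B : set U) : Prop :=
  A #<= B /\ ~ (B #<= A).

(* A nonstandard universe that is kappa-saturated for kappa = card of K.  Its
   elements are the internal objects; external sets of internal objects are
   Rocq predicates.  [star_internal] says that the internal objects are exactly
   the elements of the sets *A with A standard. *)
Record nonstandard_universe (R : realType) (V : superstructure R) (K : Type) :=
  NonstandardUniverse {
    ns_eps :> eps_structure;
    star : V -> ns_eps;
    star_transfer : forall (f : bformula) (e : nat -> V),
      sat e f <-> sat (fun i => star (e i)) f;
    star_internal : forall w, exists a, eps w (star a);
    ns_saturated : forall F : set ns_eps,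
      card_lt F [set: K] ->
      (forall s : seq ns_eps, (forall A, A \in s -> F A) ->
         exists w, forall A, A \in s -> eps w A) ->
      exists w, forall A, F A -> eps w A }.

Arguments star {R V K} _ _.

Section Nonstandard.
Variables (R : realType) (V : superstructure R) (K : Type).
Variable W : nonstandard_universe V K.
Implicit Types (A B f p a b x y n d : W).

(* Internal objects are either (nonstandard) individuals or internal sets. *)
Definition internal_set A : Prop := ~ eps A (star W (indiv_set V)).

Definition iset (P : set W) : W := get [set A | internal_set A /\ elems A = P].

Definition monadic (S : set W) : Prop :=
  exists F : set W, [/\ card_lt F [set: K], F `<=` internal_set
    & S = \bigcap_(A in F) elems A].

Definition galactic (S : set W) : Prop :=
  exists F : set W, [/\ card_lt F [set: K], F `<=` internal_set
    & S = \bigcup_(A in F) elems A].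

Definition internal_fun f (S T : set W) : Prop :=
  [/\ internal_set f,
      forall p, eps p f -> exists a b, [/\ S a, T b & p = opair a b]
    & forall a, S a -> exists! b, eps (opair a b) f].

(* Standard functions and relations on complex numbers act on hypercomplex
   numbers through the star of their graphs. *)
Definition hstd (z : R[i]) : W := star W (cplx V z).
Definition hnat : set W := elems (star W (nat_set V)).
Definition hreal : set W := elems (star W (real_set V)).
Definition hcircle : set W := elems (star W (circle_set V)).
Definition hlt x y : Prop := eps (opair x y) (star W (lt_graph V)).
Definition hle x y : Prop := hlt x y \/ x = y.
Definition hfun1 (g : R[i] -> R[i]) x : W := app (star W (graph1 V g)) x.
Definition hfun2 (g : R[i] -> R[i] -> R[i]) x y : W :=
  app (star W (graph2 V g)) (opair x y).

Definition hnorm : W -> W := hfun1 (fun z => `|z|).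
Definition hinv : W -> W := hfun1 (fun z => z^-1).
Definition hmul : W -> W -> W := hfun2 (fun u v => u * v).
Definition hdiv : W -> W -> W := hfun2 (fun u v => u / v).
Definition hsub : W -> W -> W := hfun2 (fun u v => u - v).

Definition hfinite x : Prop := exists r : R, hlt (hnorm x) (hstd r%:C).
Definition infinitesimal x : Prop :=
  forall r : R, 0 < r -> hlt (hnorm x) (hstd r%:C).
Definition approx x y : Prop := infinitesimal (hsub x y).

(* Internal bijection of A with {1, ..., n}, n in *nat; [icard A] is |A| when A
   is hyperfinite. *)
Definition has_icard A n : Prop :=
  hnat n /\ exists f,
    let I := [set m | [/\ hnat m, hle (hstd 1) m & hle m n]] in
    internal_fun f (elems A) I /\
    forall m, I m -> exists! a, eps a A /\ eps (opair a m) f.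

Definition hyperfinite A : Prop := internal_set A /\ exists n, has_icard A n.

Definition icard A : W := get [set n | has_icard A n].

(* (G, G_0, G_f), together with the (graph of the) addition of G *)
Record triplet := Triplet {
  amb : W;
  plus : W;
  tri0 : set W;
  trif : set W }.

Section Group.
Variable T : triplet.
Local Notation G := (elems (amb T)).

Definition gadd a b : W := app (plus T) (opair a b).
Definition gzero : W := get [set z | G z /\ forall a, G a -> gadd a z = a].
Definition gopp a : W := get [set b | G b /\ gadd a b = gzero].

Definition abelian_ambient : Prop :=
  [/\ internal_fun (plus T)
        [set p | exists a b, [/\ G a, G b & p = opair a b]] G,
      forall a b c, G a -> G b -> G c -> gadd a (gadd b c) = gadd (gadd a b) c,
      forall a b, G a -> G b -> gadd a b = gadd b a,
      exists2 z, G z & forall a, G a -> gadd a z = a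
    & forall a, G a -> exists2 b, G b & gadd a b = gzero].

Definition subgroup (H : set W) : Prop :=
  [/\ H `<=` G, H gzero, forall a b, H a -> H b -> H (gadd a b)
    & forall a, H a -> H (gopp a)].

Definition img_triplet : Prop :=
  [/\ hyperfinite (amb T), abelian_ambient,
      [/\ subgroup (tri0 T), subgroup (trif T) & tri0 T `<=` trif T],
      monadic (tri0 T) & galactic (trif T)].

Definition symmetric B : Prop := forall b, eps b B -> eps (gopp b) B.

Definition condensing : Prop :=
  forall A B, internal_set A -> internal_set B ->
    elems A `<=` trif T ->
    symmetric B -> tri0 T `<=` elems B -> elems B `<=` G ->
    exists s : seq W, (forall t, t \in s -> G t) /\
      forall a, eps a A -> exists t b, [/\ t \in s, eps b B & a = gadd t b].

Definition between A : Prop :=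
  [/\ internal_set A, tri0 T `<=` elems A & elems A `<=` trif T].

(* For a condensing triplet "some A" is equivalent to "each A" here. *)
Definition normalizing_multiplier d : Prop :=
  [/\ hreal d, hlt (hstd 0) d
    & exists A, [/\ between A, hfinite (hmul d (icard A))
                  & ~ infinitesimal (hmul d (icard A))]].

Definition ihom : set W :=
  [set g | internal_fun g G hcircle /\
     forall a b, G a -> G b -> app g (gadd a b) = hmul (app g a) (app g b)].

(* The pointwise product of two characters, as an internal graph *)
Definition dual_mul (g h : W) : W :=
  iset [set p | exists2 a, G a & p = opair a (hmul (app g a) (app h a))].

Definition dual_set : W := iset ihom.

Definition dual_plus : W :=
  iset [set p | exists g h, [/\ ihom g, ihom h
                              & p = opair (opair g h) (dual_mul g h)]].

Definition annih (S : set W) : set W :=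
  [set g | eps g dual_set /\ forall a, S a -> approx (app g a) (hstd 1)].

(* The first subgroup of the dual is the annihilator of G_f, the second that of
   G_0. *)
Definition dual_triplet : triplet :=
  Triplet dual_set dual_plus (annih (trif T)) (annih (tri0 T)).

End Group.
End Nonstandard.

(* Main.v *)
Require Import Defs.
From HB Require Import structures.
From mathcomp Require Import all_boot all_order all_algebra.
From mathcomp Require Import all_fingroup all_solvable all_field all_character.
From mathcomp Require Import boolp classical_sets functions cardinality reals.
From mathcomp Require Import complex.
From mathcomp Require Import ring lra.

Set Implicit Arguments.
Unset Strict Implicit.
Unset Printing Implicit Defensive.

Import Order.TTheory GRing.Theory Num.Theory FinRing.Theory.
Import complex.ComplexField.Normc.

Local Open Scope ring_scope.
Local Open Scope complex_scope.

(** Write [g], [n] for the sizes of [G] and of an internal [D] with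
    [G_0 <= D <= G_f].  The whole theorem rests on one internal set lying between
    the two subgroups of the dual triplet, the Bohr set
      [Gam] = { c in the dual : |c(a) - 1| < 1/4 for all a in D },
    and on the estimate  g <= C n |Gam|  and  n |Gam| <= 4 g  with [C] standard
    ([bohr_bounds]).  Once [d n] is finite and noninfinitesimal, so is
    |Gam| / (d g), which is what a normalizing multiplier asks for; the multiplier
    1/n is the special case from which |D| / |G| arises.

    [Gam] is between the two annihilators.  A character that is infinitely close
    to 1 on [G_f] is within 1/4 of 1 on [D].  Conversely, if [c] is within 1/4 of
    1 on the subgroup [G_0], then so are its squares, its fourth powers and so
    on, and since squaring a point near 1 almost doubles its distance to 1, [c]
    is infinitely close to 1 on [G_0] ([near_sqr], [near_subgroup]).

    Upper bound.  On [Gam] the transform of the indicator of [D] is at least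
    3n/4 in modulus, and Parseval leaves room for few such characters
    ([few_near_chars]).

    Lower bound ([many_near_chars]).  Suppose that [X] hardly grows when an
    internal neighbourhood [B] of [G_0] is added to it, and that [E], which
    contains [X - D], is at most a standard number of times as large as [D].  A
    trilinear sum shows that many characters have a large transform on [X]
    ([large_spectrum]); by almost invariance they are close to 1 on [B]
    ([spectrum_near]).  Finitely many translates of [B] cover [D], so pigeonholing
    on the values at the translates and dividing ([quotients_near]) gives many
    characters close to 1 on all of [D].  Such an [X] exists because the relative
    sizes q = |A| / |D| of internal neighbourhoods [A] of [D + G_0] are at least
    1: some q cannot be improved by the factor 1 + delta ([last_ratio]).
    Saturation puts [D + B + B] inside the corresponding [A]
    ([small_neighbourhood]), and [X] is [D + B].  Condensation supplies the
    covers.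

    The finite inequalities are proved for ordinary finite abelian groups, then
    for groups coded as elements of the superstructure, and are carried to the
    internal group by transfer.  So that no formula is ever written out, a
    property of assignments is called [definable] when one formula expresses it
    in all structures at once, which a tactic establishes by following the syntax
    of the property. *)

(** * The modulus of complex numbers *)

Section Norm.
Variable R : realType.
Local Notation C := R[i].

Lemma norm_normc (z : C) : `|z| = (normc z)%:C. Proof. by []. Qed.

Lemma normc_ge0 (z : C) : 0 <= normc z.
Proof. by rewrite -lecR -norm_normc normr_ge0. Qed.

Lemma normc_sum (I : Type) (r : seq I) (P : pred I) (F : I -> C) :
  normc (\sum_(i <- r | P i) F i) <= \sum_(i <- r | P i) normc (F i).
Proof.
elim/big_ind2: _ => [|x1 x2 y1 y2 h1 h2|//]; first by rewrite normc0.
by apply: le_trans (le_normcD _ _) _; apply: lerD.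
Qed.

Lemma normc_real (x : R) : normc (x%:C) = `|x|.
Proof. by apply: complexI; rewrite -norm_normc normc_def /= expr0n addr0 sqrtr_sqr. Qed.

Lemma normc_nat n : normc (n%:R : C) = n%:R.
Proof. by rewrite -(rmorph_nat (real_complex R)) normc_real normr_nat. Qed.

Lemma normcB_sym (x y : C) : normc (x - y) = normc (y - x).
Proof. by rewrite -normcN opprB. Qed.

Lemma normcX (x : C) n : normc (x ^+ n) = normc x ^+ n.
Proof. by elim: n => [|n IH]; rewrite ?expr0 ?normc1 // !exprS normcM IH. Qed.

Lemma normc1_inv (z : C) : normc z = 1 -> z^-1 = z^*%C.
Proof.
move=> z1; have z0 : z != 0.
  by apply/negP => /eqP z0; move: z1; rewrite z0 normc0 => /eqP; rewrite eq_sym oner_eq0.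
apply: (mulfI z0); rewrite mulfV //.
by have := add_Re2_Im2 z; rewrite norm_normc z1 expr1n => <-; case: z {z1 z0} => a b; simpc; congr (_ +i* _); ring.
Qed.

Lemma mulc_normc_sqr (z : C) : z * z^*%C = (normc z ^+ 2)%:C.
Proof. by rewrite rmorphXn /= -norm_normc -add_Re2_Im2; case: z => a b; simpc; congr (_ +i* _); ring. Qed.

Lemma normc_i : normc ('i : C) = 1.
Proof. by rewrite /= expr0n expr1n add0r sqrtr1. Qed.

Lemma normc_ge_Im (z : C) : `|complex.Im z| <= normc z.
Proof.
have := normc_ge_Re (z * 'i); rewrite norm_normc lecR normcM normc_i mulr1.
by rewrite ReiNIm normrN.
Qed.

End Norm.

(** * Characters of a finite abelian group *)

Section Characters.
Variables (R : realType) (gT : finZmodType).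
Local Notation C := R[i].
Local Notation n := #|gT|.
Implicit Types (x y : gT) (f g : {ffun gT -> C}).

Definition is_char f := f 0 = 1 /\ forall x y, f (x + y) = f x * f y.

Lemma card_group_gt0 : (0 < n)%N.
Proof. by apply/card_gt0P; exists 0. Qed.

Lemma mulrn_card x : x *+ n = 0.
Proof. by rewrite -cardsT -zmodXgE expg_cardG ?inE. Qed.

Lemma char_mulrn f x k : is_char f -> f (x *+ k) = f x ^+ k.
Proof.
move=> [f0 fD]; elim: k => [|k IH]; first by rewrite mulr0n expr0.
by rewrite mulrS fD IH exprS.
Qed.

Lemma char_unity f x : is_char f -> f x ^+ n = 1.
Proof. by move=> cf; rewrite -char_mulrn // mulrn_card; case: cf. Qed.

Lemma normc_char f x : is_char f -> normc (f x) = 1.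
Proof.
move=> cf; apply: (pexpIrn card_group_gt0); rewrite ?nnegrE ?normc_ge0 ?ler01 //.
by rewrite -normcX char_unity // normc1 expr1n.
Qed.

Lemma char_neq0 f x : is_char f -> f x != 0.
Proof.
move=> cf; apply/eqP => fx; have := normc_char x cf.
by rewrite fx normc0 => /eqP; rewrite eq_sym oner_eq0.
Qed.

Lemma charN f x : is_char f -> f (- x) = (f x)^-1.
Proof.
move=> cf; apply: (mulfI (char_neq0 x cf)); rewrite mulfV ?char_neq0 //.
by case: cf => f0 <-; rewrite subrr.
Qed.

Lemma prim_root_exists k : (0 < k)%N -> exists z : C, k.-primitive_root z.
Proof.
move=> k_gt0; pose p : {poly C} := 'X^k - 1.
have [r Dp] := closed_field_poly_normal p.
rewrite (monicP _) ?monicXnsubC // scale1r in Dp.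
have rn1: all k.-unity_root r by apply/allP=> z; rewrite -root_prod_XsubC -Dp.
have sz_r: (k < (size r).+1)%N.
  by rewrite -(size_prod_XsubC r id) -Dp size_XnsubC.
have [|z _ zP] := hasP (has_prim_root k_gt0 rn1 _ sz_r); last by exists z.
by rewrite -separable_prod_XsubC -Dp separable_Xn_sub_1 // pnatr_eq0 -lt0n.
Qed.

(** The irreducible characters of an abelian group are linear and separate its
    elements.  Their values in [algC] are roots of unity, so replacing a primitive
    root of unity of [algC] by one of [C] turns them into complex characters. *)
Lemma char_separates x : x != 0 -> exists f, is_char f /\ f x != 1.
Proof.
move=> x0; have [w pw] := prim_root_exists card_group_gt0.
have [z pz] := C_prim_root_exists card_group_gt0.
have lin i : 'chi[[set: gT]%G]_i \is a linear_char.
  by apply/char_abelianP; apply: zmod_abelian.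
have [i xi] : exists i, 'chi[[set: gT]%G]_i x != 1.
  apply/existsP; apply: contraNT x0 => /existsPn x1.
  have : x \in [1 gT]%g.
    rewrite -(TI_cfker_irr [set: gT]%G); apply/bigcapP => i _.
    rewrite cfkerEirr inE (lin_char1 (lin i)).
    by have := x1 i; rewrite negbK.
  by rewrite inE.
pose chi := 'chi[[set: gT]%G]_i.
have chiP y : exists k : 'I_n, chi y = z ^+ k.
  have [|k ->] := prim_rootP pz (x := chi y); last by exists k.
  by rewrite -(lin_charX (lin i)) ?inE // zmodXgE mulrn_card (lin_char1 (lin i)).
have /choice [k kP] := chiP.
exists [ffun y => w ^+ k y]; split; first split.
- rewrite ffunE; apply/eqP.
  have := kP 0; rewrite [chi 0](lin_char1 (lin i)) => /esym/eqP.
  by rewrite -(prim_order_dvd pz) (prim_order_dvd pw).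
- move=> a b; rewrite !ffunE -exprD; apply/eqP.
  rewrite (eq_prim_root_expr pw) -(eq_prim_root_expr pz) exprD -!kP.
  by apply/eqP; apply: (lin_charM (lin i)); rewrite inE.
- rewrite ffunE -(prim_order_dvd pw) (prim_order_dvd pz) -kP; exact: xi.
Qed.

Lemma exists_chars : {L : seq {ffun gT -> C} | uniq L /\ forall f, f \in L <-> is_char f}.
Proof.
apply: cid; have [w pw] := prim_root_exists card_group_gt0.
pose A := [seq [ffun x => w ^+ (k x : 'I_n)] | k : {ffun gT -> 'I_n}].
exists (undup [seq f <- A | `[< is_char f >]]); split; first exact: undup_uniq.
move=> f; rewrite mem_undup mem_filter; split; first by move=> /andP[/asboolP].
move=> cf; apply/andP; split; first exact/asboolP.
have fP x : exists k : 'I_n, f x = w ^+ k.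
  by have [|k ->] := prim_rootP pw (x := f x); [exact: char_unity|exists k].
have /choice [k kP] := fP; apply/mapP; exists [ffun x => k x].
  by rewrite mem_enum.
by apply/ffunP => x; rewrite ffunE [in RHS]ffunE kP.
Qed.

Definition chars := sval exists_chars.

Lemma chars_uniq : uniq chars. Proof. by case: (svalP exists_chars). Qed.

Lemma mem_chars f : f \in chars <-> is_char f.
Proof. by case: (svalP exists_chars) => _; apply. Qed.

Lemma is_char_mul f g : is_char f -> is_char g -> is_char [ffun x => f x * g x].
Proof.
move=> [f0 fD] [g0 gD]; split=> [|x y]; rewrite !ffunE ?f0 ?g0 ?mulr1 //.
by rewrite fD gD mulrACA.
Qed.

Lemma is_char_inv f : is_char f -> is_char [ffun x => (f x)^-1].
Proof.
by move=> [f0 fD]; split=> [|x y]; rewrite !ffunE ?f0 ?invr1 // fD invfM.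
Qed.

Lemma is_char_div f g : is_char f -> is_char g -> is_char [ffun x => f x / g x].
Proof.
move=> cf cg; have := is_char_mul cf (is_char_inv cg).
by congr is_char; apply/ffunP => x; rewrite !ffunE.
Qed.

Lemma is_char1 : is_char [ffun=> 1].
Proof. by split=> [|x y]; rewrite !ffunE ?mulr1. Qed.

(** Multiplication by a character [g] with [g x != 1] permutes the characters and
    multiplies the sum by [g x]. *)
Lemma sum_chars_eq0 x : x != 0 -> \sum_(f <- chars) f x = 0.
Proof.
move=> /char_separates[g [cg gx]].
have p : perm_eq chars [seq [ffun x => f x * g x] | f : {ffun gT -> C} <- chars].
  apply: uniq_perm; first exact: chars_uniq.
    rewrite map_inj_in_uniq ?chars_uniq // => f1 f2 _ _ /ffunP e.
    by apply/ffunP => y; have := e y; rewrite !ffunE => /(mulIf (char_neq0 y cg)).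
  move=> f; apply/idP/mapP => [/mem_chars cf|[h /mem_chars ch ->]].
    exists [ffun x => f x / g x]; first by apply/mem_chars; apply: is_char_div.
    by apply/ffunP => y; rewrite !ffunE divfK // char_neq0.
  by apply/mem_chars; apply: is_char_mul.
have e : \sum_(f <- chars) f x = (\sum_(f <- chars) f x) * g x.
  rewrite [LHS](perm_big _ p) big_map mulr_suml.
  by apply: eq_bigr => f _; rewrite ffunE.
apply/eqP; move: e => /eqP; rewrite -subr_eq0 -{1}[\sum_(f <- _) _]mulr1 -mulrBr.
by rewrite mulf_eq0 subr_eq0 [1 == _]eq_sym (negPf gx) orbF.
Qed.

Lemma sum_char_eq0 f : is_char f -> f != [ffun=> 1] -> \sum_x f x = 0.
Proof.
move=> cf f1; have [y fy] : exists y, f y != 1.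
  apply/existsP; apply: contraNT f1 => /existsPn h; apply/eqP/ffunP => y.
  by rewrite ffunE; apply/eqP; have := h y; rewrite negbK.
have e : \sum_x f x = (\sum_x f x) * f y.
  rewrite [LHS](reindex_inj (addIr y)) mulr_suml /=.
  by apply: eq_bigr => x _; rewrite cf.2.
apply/eqP; move: e => /eqP; rewrite -subr_eq0 -{1}[\sum_x _]mulr1 -mulrBr.
by rewrite mulf_eq0 subr_eq0 [1 == _]eq_sym (negPf fy) orbF.
Qed.

(** Both are the sum of all character values, summed in the two orders. *)
Lemma size_chars : size chars = n.
Proof.
have e1 : \sum_x \sum_(f <- chars) f x = (size chars)%:R.
  rewrite (bigD1 (0 : gT)) //= [X in _ + X]big1 ?addr0; last first.
    by move=> x x0; apply: sum_chars_eq0.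
  rewrite -sum1_size natr_sum; apply: eq_big_seq => f /mem_chars[]//.
have e2 : \sum_x \sum_(f <- chars) f x = n%:R.
  rewrite exchange_big /= (bigD1_seq [ffun=> 1]) ?chars_uniq //=; last first.
    by apply/mem_chars/is_char1.
  rewrite [X in _ + X]big1_seq ?addr0; last first.
    by move=> f /andP[f1 /mem_chars cf]; apply: sum_char_eq0.
  under eq_bigr do rewrite ffunE.
  by rewrite sumr_const.
by apply/eqP; rewrite -(eqr_nat C) -e1 e2.
Qed.

Lemma sum_chars x : \sum_(f <- chars) f x = n%:R *+ (x == 0).
Proof.
have [->|/sum_chars_eq0//] := eqVneq x 0.
rewrite -size_chars -sum1_size natr_sum; apply: eq_big_seq => f /mem_chars[]//.
Qed.

End Characters.

(** * Counting characters near 1 *)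

Section Fourier.
Variables (R : realType) (gT : finZmodType).
Local Notation C := R[i].
Local Notation n := #|gT|.
Implicit Types (x y : gT) (f g : {ffun gT -> C}) (A B D E X Y : {set gT}).
Local Notation chars := (chars R gT).

Definition hat A f : C := \sum_(a in A) f a.

Lemma hat_conj A f : is_char f -> (hat A f)^*%C = \sum_(a in A) f (- a).
Proof.
move=> cf; rewrite /hat rmorph_sum /=; apply: eq_bigr => a _.
by rewrite charN // normc1_inv // normc_char.
Qed.

Lemma hat_le A f : is_char f -> normc (hat A f) <= #|A|%:R.
Proof.
move=> cf; apply: le_trans (normc_sum _ _ _) _.
by rewrite (eq_bigr (fun=> 1)) ?sumr_const // => a _; rewrite normc_char.
Qed.

Lemma parseval A : \sum_(f <- chars) normc (hat A f) ^+ 2 = (n * #|A|)%:R :> R.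
Proof.
apply: complexI; rewrite rmorph_sum /= rmorph_nat.
transitivity (\sum_(f <- chars) \sum_(a in A) \sum_(b in A) f (a - b)).
  apply: eq_big_seq => f /mem_chars cf; rewrite -mulc_normc_sqr hat_conj //.
  rewrite /hat mulr_suml; apply: eq_bigr => a _; rewrite mulr_sumr.
  by apply: eq_bigr => b _; rewrite -cf.2.
rewrite exchange_big /=; under eq_bigr => ? _ do rewrite exchange_big /=.
under eq_bigr do under eq_bigr do rewrite sum_chars subr_eq0.
transitivity (\sum_(a in A) (n%:R : C)); last by rewrite sumr_const natrM mulr_natr.
apply: eq_bigr => a aA.
rewrite (bigD1 a) //= eqxx mulr1n big1 ?addr0 // => b /andP[_ ba].
by rewrite eq_sym (negPf ba) mulr0n.
Qed.

(** Every character in [L] has a transform of modulus at least 3/4 of the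
    trivial bound [#|A|]; Parseval leaves room for few of these. *)
Lemma few_near_chars A (L : seq {ffun gT -> C}) :
  uniq L -> (forall f, f \in L -> is_char f) ->
  (forall f a, f \in L -> a \in A -> normc (f a - 1) < 4^-1) ->
  (size L * #|A|)%:R <= 4 * n%:R :> R.
Proof.
move=> uL cL nL; have [->|A0] := eqVneq A finset.set0.
  by rewrite cards0 muln0 mulr_ge0.
have big f : f \in L -> 3 / 4 * #|A|%:R <= normc (hat A f).
  move=> fL; have : normc (#|A|%:R - hat A f) <= #|A|%:R / 4.
    rewrite /hat -sumr_const -sumrB; apply: le_trans (normc_sum _ _ _) _.
    have -> : #|A|%:R / 4 = \sum_(a in A) 4^-1 :> R by rewrite sumr_const mulr_natl.
    by apply: ler_sum => a aA; rewrite normcB_sym ltW // nL.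
  have := le_normcD (#|A|%:R - hat A f) (hat A f).
  by rewrite subrK normc_nat; lra.
have le1 : \sum_(f <- L) normc (hat A f) ^+ 2 <= (n * #|A|)%:R :> R.
  rewrite -parseval.
  have -> : \sum_(f <- L) normc (hat A f) ^+ 2 =
      \sum_(f <- chars | f \in L) normc (hat A f) ^+ 2.
    rewrite -[RHS]big_filter; apply: perm_big; apply: uniq_perm => //.
      by rewrite filter_uniq // chars_uniq.
    move=> f; rewrite mem_filter; case fL: (f \in L) => //=.
    by apply/esym/mem_chars/cL.
  rewrite [leRHS](bigID (fun f => f \in L)) /= lerDl.
  by apply: sumr_ge0 => f _; rewrite exprn_ge0 // normc_ge0.
have le2 : (size L)%:R * (3 / 4 * #|A|%:R) ^+ 2 <= (n * #|A|)%:R :> R.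
  apply: le_trans le1; rewrite mulr_natl -sum1_size -sumrMnr big_seq [leRHS]big_seq.
  apply: ler_sum => f fL; rewrite mulr1n.
  by rewrite ler_sqr ?big ?nnegrE ?normc_ge0 ?mulr_ge0 //; lra.
have A_gt0 : 0 < #|A|%:R :> R by rewrite ltr0n card_gt0.
move: le2; rewrite !natrM => le2.
have n_ge0 : 0 <= n%:R :> R by [].
set a := #|A|%:R in A_gt0 le2 *; set l := (size L)%:R in le2 *.
set m := n%:R in n_ge0 le2 *.
have : (l * a * (9 / 16)) * a <= m * a by lra.
by rewrite ler_pM2r //; lra.
Qed.

(** Up to the factor [n] the sum counts the solutions of [x - d = e], and each
    pair [(x, d)] has exactly one. *)
Lemma trilinear X D E : (forall x d, x \in X -> d \in D -> x - d \in E) ->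
  \sum_(f <- chars) hat X f * (hat D f)^*%C * (hat E f)^*%C = (n * (#|X| * #|D|))%:R.
Proof.
move=> XDE.
transitivity (\sum_(f <- chars) \sum_(x in X) \sum_(d in D) \sum_(e in E) f (x - d - e)).
  apply: eq_big_seq => f /mem_chars cf; rewrite !hat_conj //.
  rewrite /hat !mulr_suml; apply: eq_bigr => x _.
  rewrite -mulrA mulr_suml mulr_sumr; apply: eq_bigr => d _.
  rewrite mulrA mulr_sumr; apply: eq_bigr => e _.
  by rewrite -!cf.2.
rewrite exchange_big /=; under eq_bigr => ? _ do rewrite exchange_big /=.
under eq_bigr do under eq_bigr => ? _ do rewrite exchange_big /=.
under eq_bigr do under eq_bigr do under eq_bigr do rewrite sum_chars subr_eq0.
transitivity (\sum_(x in X) \sum_(d in D) (n%:R : C)).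
  apply: eq_bigr => x xX; apply: eq_bigr => d dD.
  rewrite (bigD1 (x - d)) ?XDE //= eqxx mulr1n big1 ?addr0 // => e /andP[_ ed].
  by rewrite eq_sym (negPf ed) mulr0n.
by rewrite !sumr_const -[_ *+ #|D|]mulr_natr -[_ *+ #|X|]mulr_natr !natrM -mulrA [_ * #|X|%:R]mulrC.
Qed.

(** By Parseval the sum of the products of moduli of [hat D] and [hat E] is at
    most [s n |D|], so the characters whose transform on [X] is small contribute
    at most half of the trilinear sum. *)
Lemma large_spectrum X D E (s : R) : 0 < s -> X != finset.set0 -> D != finset.set0 ->
  (forall x d, x \in X -> d \in D -> x - d \in E) ->
  #|E|%:R <= s ^+ 2 * #|D|%:R ->
  n%:R <= 2 * s ^+ 2 * #|D|%:R *
    (size [seq f <- chars | #|X|%:R / (2 * s) <= normc (hat X f)])%:R.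
Proof.
move=> s_gt0 X0 D0 XDE leE.
set P := fun f => _; pose S := [seq f <- chars | P f].
have X_gt0 : 0 < #|X|%:R :> R by rewrite ltr0n card_gt0.
have D_gt0 : 0 < #|D|%:R :> R by rewrite ltr0n card_gt0.
set x := (#|X|%:R : R) in X_gt0 P S *; set d := (#|D|%:R : R) in D_gt0 leE *.
set e := (#|E|%:R : R) in leE.
have e_ge0 : 0 <= e by [].
pose t f := normc (hat X f) * normc (hat D f) * normc (hat E f).
have tri : n%:R * (x * d) <= \sum_(f <- chars) t f.
  have /(congr1 (@normc R)) := trilinear XDE.
  rewrite normc_nat !natrM => <-; apply: le_trans (normc_sum _ _ _) _.
  apply: ler_sum => f _; rewrite !normcM.
  by have conjE (z : C) : normc z^*%C = normc z; [case: z => a b /=; rewrite sqrrN|rewrite !conjE].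
have in_spec : \sum_(f <- chars | P f) t f <= (size S)%:R * (x * d * e).
  rewrite mulr_natl -sum1_size -sumrMnr big_filter big_seq_cond [leRHS]big_seq_cond.
  apply: ler_sum => f /andP[/mem_chars cf _]; rewrite mulr1n.
  by rewrite /t !ler_pM ?mulr_ge0 ?normc_ge0 ?hat_le.
have off_spec : \sum_(f <- chars | ~~ P f) t f <= n%:R * (x * d) / 2.
  pose u f := x / (4 * s) * (s * normc (hat D f) ^+ 2 + s^-1 * normc (hat E f) ^+ 2).
  have u_ge0 f : 0 <= u f.
    have [x0 s0] := (ltW X_gt0, ltW s_gt0).
    by rewrite /u !(mulr_ge0, addr_ge0, invr_ge0, exprn_ge0, normc_ge0).
  have le_t f : ~~ P f -> t f <= u f.
    rewrite /P -ltNge /t /u => Pf.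
    have [a0 b0] : 0 <= normc (hat D f) /\ 0 <= normc (hat E f) by rewrite !normc_ge0.
    move: (normc_ge0 (hat X f)) Pf a0 b0.
    move: (normc (hat X f)) (normc (hat D f)) (normc (hat E f)) => h a b h0 Pf a0 b0.
    apply: (@le_trans _ _ (x / (2 * s) * (a * b))).
      by rewrite -mulrA ler_wpM2r ?mulr_ge0 // ltW.
    have -> : x / (2 * s) * (a * b) = x / (4 * s) * (2 * a * b) by field; rewrite gt_eqF.
    rewrite ler_wpM2l ?mulr_ge0 ?invr_ge0 ?mulr_ge0 ?(ltW s_gt0) ?(ltW X_gt0) //.
    have -> : s * a ^+ 2 + s^-1 * b ^+ 2 = 2 * a * b + s^-1 * (s * a - b) ^+ 2.
      by field; rewrite gt_eqF.
    by rewrite lerDl mulr_ge0 ?invr_ge0 ?(ltW s_gt0) // sqr_ge0.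
  apply: (@le_trans _ _ (\sum_(f <- chars) u f)).
    rewrite [leRHS](bigID P) /= -[leLHS]add0r lerD ?sumr_ge0 //; exact: ler_sum.
  rewrite /u -mulr_sumr big_split /= -!mulr_sumr !parseval !natrM -/d -/e.
  have le2 : s * (n%:R * d) + s^-1 * (n%:R * e) <= 2 * s * n%:R * d.
    have : n%:R * (s^-1 * e) <= n%:R * (s * d).
      by rewrite ler_wpM2l // ler_pdivrMl // mulrA -expr2.
    by lra.
  apply: le_trans (ler_wpM2l _ le2) _.
    by rewrite ?mulr_ge0 ?invr_ge0 ?mulr_ge0 ?(ltW s_gt0) ?(ltW X_gt0).
  by rewrite le_eqVlt; apply/orP; left; apply/eqP; field; rewrite gt_eqF.
have : n%:R * (x * d) <= (size S)%:R * (x * d * e) + n%:R * (x * d) / 2.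
  by apply: le_trans tri _; rewrite (bigID P) /= lerD.
set m := (size S)%:R => le_all.
have {le_all} : n%:R * (x * d) <= (2 * m * e) * (x * d) by lra.
rewrite ler_pM2r ?mulr_gt0 // => le_n; apply: le_trans le_n _.
have -> : 2 * s ^+ 2 * d * m = 2 * m * (s ^+ 2 * d) by ring.
by rewrite ler_wpM2l // mulr_ge0.
Qed.

(** Translating [X] by [b] multiplies its transform, which is large, by [f b], but
    changes it little, as both [X] and [X + b] nearly fill [Y]. *)
Lemma spectrum_near X Y (b : gT) (s : R) f : 0 < s -> X != finset.set0 ->
  X \subset Y -> (forall x, x \in X -> x + b \in Y) ->
  #|Y|%:R <= (1 + (128 * s)^-1) * #|X|%:R -> is_char f ->
  #|X|%:R / (2 * s) <= normc (hat X f) -> normc (f b - 1) <= 32^-1.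
Proof.
move=> s_gt0 X0 XY XbY leY cf Pf.
have X_gt0 : 0 < #|X|%:R :> R by rewrite ltr0n card_gt0.
have diff A : A \subset Y -> #|A| = #|X| ->
    normc (hat Y f - hat A f) <= #|Y|%:R - #|X|%:R.
  move=> AY cA; have -> : hat Y f - hat A f = \sum_(a in Y :\: A) f a.
    by rewrite /hat (big_setID A) /= (finset.setIidPr AY) addrAC subrr add0r.
  apply: le_trans (normc_sum _ _ _) _.
  rewrite (eq_bigr (fun=> 1)) => [|a _]; last by rewrite normc_char.
  rewrite sumr_const cardsD (finset.setIidPr AY) cA natrB // -cA.
  exact: subset_leq_card.
have e : (f b - 1) * hat X f = hat [set x + b | x in X]%SET f - hat X f.
  rewrite mulrBl mul1r; congr (_ - _); rewrite /hat mulr_sumr big_imset /=; last first.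
    by move=> ? ? _ _; apply: addIr.
  by apply: eq_bigr => a _; rewrite cf.2 mulrC.
have le1 : normc (f b - 1) * normc (hat X f) <= 2 * (#|Y|%:R - #|X|%:R).
  rewrite -normcM e.
  have -> : hat [set x + b | x in X]%SET f - hat X f =
    (hat Y f - hat X f) - (hat Y f - hat [set x + b | x in X]%SET f) by ring.
  apply: le_trans (le_normcD _ _) _; rewrite normcN.
  have d1 := diff X XY erefl.
  have d2 : normc (hat Y f - hat [set x + b | x in X]%SET f) <= #|Y|%:R - #|X|%:R.
    apply: diff; first by apply/fintype.subsetP => _ /imsetP[x xX ->]; apply: XbY.
    by rewrite card_imset //; apply: addIr.
  by lra.
have le2 : normc (f b - 1) * (#|X|%:R / (2 * s)) <= 32^-1 * (#|X|%:R / (2 * s)).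
  apply: le_trans (ler_wpM2l (normc_ge0 _) Pf) _; apply: le_trans le1 _.
  have -> : 32^-1 * (#|X|%:R / (2 * s)) = 2 * ((128 * s)^-1 * #|X|%:R).
    by field; rewrite gt_eqF.
  by lra.
by move: le2; rewrite ler_pM2r // divr_gt0 // mulr_gt0.
Qed.

(** The unit disc is cut into square cells of side 1/16; 33 values per coordinate
    suffice, whence the number [1089 = 33 ^ 2] below. *)
Lemma same_cell (a b : R) : normc (a%:C) <= 1 -> normc b%:C <= 1 ->
  Num.truncn (16 * (a + 1)) = Num.truncn (16 * (b + 1)) -> `|a - b| <= 16^-1.
Proof.
rewrite !normc_real !ler_norml => /andP[a1 a2] /andP[b1 b2] e.
have ha : 0 <= 16 * (a + 1) by lra.
have hb : 0 <= 16 * (b + 1) by lra.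
have := truncn_itv ha; have := truncn_itv hb; rewrite e.
move: (Num.truncn _) => k; rewrite -(natr1 k) => /andP[h1 h2] /andP[h3 h4].
by apply/andP; split; lra.
Qed.

(** Among many characters, two that fall into the same cell at every [t i] have
    a quotient near 1 at every [t i]; pigeonholing and dividing by one member
    of a large cell loses only a factor depending on [k]. *)
Lemma quotients_near (S : seq {ffun gT -> C}) k (t : 'I_k -> gT) :
  uniq S -> (forall f, f \in S -> is_char f) -> S != [::] ->
  exists2 L : seq {ffun gT -> C}, uniq L /\ (size S <= 1089 ^ k * size L)%N &
    forall f, f \in L -> is_char f /\
      exists g h, [/\ g \in S, h \in S, f = [ffun x => g x / h x] &
        forall i, normc (g (t i) - h (t i)) <= 8^-1].
Proof.
move=> uS cS S0.
pose c (a : R) : 'I_33 := inord (Num.truncn (16 * (a + 1))).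
pose key f : {ffun 'I_k -> 'I_33 * 'I_33} :=
  [ffun i => (c (complex.Re (f (t i))), c (complex.Im (f (t i))))].
have cP (a b : R) : `|a| <= 1 -> `|b| <= 1 -> c a = c b -> `|a - b| <= 16^-1.
  move=> a1 b1 /(congr1 val); rewrite /c /= !inordK.
  - by apply: same_cell; rewrite normc_real.
  - by move: b1; rewrite ler_norml => /andP[*]; rewrite ltnS -ltnS truncn_lt_nat; lra.
  - by move: a1; rewrite ler_norml => /andP[*]; rewrite ltnS -ltnS truncn_lt_nat; lra.
have cardK : #|{ffun 'I_k -> 'I_33 * 'I_33}| = (1089 ^ k)%N.
  by rewrite card_ffun card_prod !card_ord.
have [v vP] : exists v, (size S <= 1089 ^ k * size [seq f <- S | key f == v])%N.
  apply/existsP; apply: contraT => /existsPn h.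
  have sum_cells :
      (\sum_(v : {ffun 'I_k -> 'I_33 * 'I_33}) size [seq f <- S | key f == v] = size S)%N.
    transitivity (\sum_(v : {ffun 'I_k -> 'I_33 * 'I_33}) \sum_(f <- S | key f == v) 1)%N.
      by apply: eq_bigr => v _; rewrite -sum1_size big_filter.
    rewrite -sum1_size (exchange_big_dep predT) //=; apply: eq_bigr => f _.
    by rewrite (big_pred1 (key f)) // => w; rewrite eq_sym.
  have : (\sum_(v : {ffun 'I_k -> 'I_33 * 'I_33})
            (1089 ^ k * size [seq f <- S | key f == v]).+1 <=
          \sum_(v : {ffun 'I_k -> 'I_33 * 'I_33}) size S)%N.
    by apply: leq_sum => v _; have := h v; rewrite -ltnNge.
  under eq_bigr do rewrite -addn1.
  rewrite big_split /= -big_distrr /= sum_cells !sum_nat_const cardK muln1.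
  by rewrite -[leqRHS]addn0 leq_add2l leqn0 expn_eq0.
set Sv := [seq f <- S | _] in vP.
case eSv : Sv => [|f0 s0].
  by move: vP; rewrite eSv muln0 leqn0 size_eq0 (negPf S0).
have SvS f : f \in Sv -> f \in S /\ key f = v.
  by rewrite mem_filter => /andP[/eqP].
have f0Sv : f0 \in Sv by rewrite eSv mem_head.
have [f0S kf0] := SvS _ f0Sv.
exists [seq [ffun x => f x / f0 x] | f : {ffun gT -> C} <- Sv].
  split; last by rewrite size_map.
  rewrite map_inj_uniq ?filter_uniq // => f1 f2 /ffunP e.
  apply/ffunP => y; have := e y; rewrite !ffunE; apply: mulIf.
  by rewrite invr_eq0 char_neq0 //; apply: cS.
move=> _ /mapP[f /SvS[fS kf] ->]; split; first by apply: is_char_div; apply: cS.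
exists f, f0; split=> // i.
have : key f i = key f0 i by rewrite kf kf0.
rewrite !ffunE => -[eR eI].
have part1 g : g \in S ->
    `|complex.Re (g (t i))| <= 1 /\ `|complex.Im (g (t i))| <= 1.
  move=> gS; have g1 := normc_char (t i) (cS _ gS).
  have := normc_ge_Re (g (t i)); have := normc_ge_Im (g (t i)).
  by rewrite norm_normc lecR g1.
have [fR fI] := part1 _ fS; have [f0R f0I] := part1 _ f0S.
have hR := cP _ _ fR f0R eR; have hI := cP _ _ fI f0I eI.
rewrite [f (t i) - f0 (t i)]complexE; apply: le_trans (le_normcD _ _) _.
rewrite normcM normc_i !normc_real !raddfB /=.
by lra.
Qed.

(** The large spectrum of [X] consists of characters within 1/32 of 1 on [B].  On
    the translates of [B] that cover [D] they are controlled by their values at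
    the [t i], which pigeonholing makes equal up to 1/8; and
    [1/8 + 1/32 + 1/32 < 1/4]. *)
Lemma many_near_chars X Y D E B (s : R) k (t : 'I_k -> gT) :
  0 < s -> X != finset.set0 -> D != finset.set0 -> X \subset Y ->
  (forall x b, x \in X -> b \in B -> x + b \in Y) ->
  (forall x d, x \in X -> d \in D -> x - d \in E) ->
  #|Y|%:R <= (1 + (128 * s)^-1) * #|X|%:R ->
  #|E|%:R <= s ^+ 2 * #|D|%:R ->
  (forall d, d \in D -> exists i, exists2 b, b \in B & d = t i + b) ->
  exists2 L : seq {ffun gT -> C},
    uniq L /\ n%:R <= 2 * s ^+ 2 * (1089 ^ k)%:R * (#|D|%:R * (size L)%:R) &
    forall f, f \in L -> is_char f /\
      forall d, d \in D -> normc (f d - 1) < 4^-1.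
Proof.
move=> s_gt0 X0 D0 XY XBY XDE leY leE Dt.
have := large_spectrum s_gt0 X0 D0 XDE leE.
set S := [seq f <- _ | _] => leS.
have SP f : f \in S -> is_char f /\ forall b, b \in B -> normc (f b - 1) <= 32^-1.
  rewrite mem_filter => /andP[Pf /mem_chars cf]; split=> // b bB.
  by apply: (spectrum_near s_gt0 X0 XY _ leY cf Pf) => x xX; apply: XBY.
have S0 : S != [::].
  apply: contraTneq leS => ->; rewrite mulr0 -ltNge ltr0n.
  by apply/card_gt0P; exists 0.
have uS : uniq S by rewrite filter_uniq // chars_uniq.
have [L [uL sL] LP] := quotients_near t uS (fun f fS => (SP f fS).1) S0.
exists L; first split=> //.
  apply: le_trans leS _; rewrite -(ler_nat R) natrM in sL.
  have -> : 2 * s ^+ 2 * (1089 ^ k)%:R * (#|D|%:R * (size L)%:R) =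
    2 * s ^+ 2 * #|D|%:R * ((1089 ^ k)%:R * (size L)%:R) :> R by ring.
  by rewrite ler_wpM2l // !mulr_ge0 // ?sqr_ge0 // ltW.
move=> f /LP[cf [g [h [/SP[cg gB] /SP[ch hB] -> near_t]]]]; split.
  exact: is_char_div.
move=> d /Dt[i [b bB ->]]; rewrite ffunE.
have -> : g (t i + b) / h (t i + b) - 1 = (g (t i + b) - h (t i + b)) / h (t i + b).
  by rewrite mulrBl divff // char_neq0.
rewrite normcM normcV normc_char // invr1 mulr1 cg.2 ch.2.
have -> : g (t i) * g b - h (t i) * h b =
  g (t i) * (g b - 1) + (g (t i) - h (t i)) + h (t i) * (1 - h b) by ring.
apply: le_lt_trans (le_normcD _ _) _.
have h1 := le_normcD (g (t i) * (g b - 1)) (g (t i) - h (t i)).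
have h2 := near_t i; have h3 := gB b bB; have h4 := hB b bB.
rewrite !normcM !normc_char // !mul1r [normc (1 - h b)]normcB_sym in h1 *.
by lra.
Qed.

End Fourier.

Local Open Scope classical_set_scope.
Local Open Scope card_scope.
Local Open Scope ring_scope.
Local Open Scope complex_scope.

(** * Definable properties and Kuratowski pairs *)

Definition upd (M : eps_structure) (e : nat -> M) i x := fun k => if k == i then x else e k.

(** A single formula has to serve for all structures, because transfer compares
    the same formula in the superstructure and among internal objects. *)
Definition definable (P : forall M : eps_structure, (nat -> M) -> Prop) :=
  exists f, forall M e, sat e f <-> P M e.

Section Definability.
Implicit Types P Q : forall M : eps_structure, (nat -> M) -> Prop.

Lemma definable_eq i j : definable (fun M e => e i = e j).
Proof. by exists (FEq i j). Qed.

Lemma definable_mem i j : definable (fun M e => eps (e i) (e j)).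
Proof. by exists (FMem i j). Qed.

Lemma definable_not P : definable P -> definable (fun M e => ~ P M e).
Proof. by move=> [f fP]; exists (FNot f) => M e /=; rewrite fP. Qed.

Lemma definable_and P Q : definable P -> definable Q -> definable (fun M e => P M e /\ Q M e).
Proof. by move=> [f fP] [g gP]; exists (FAnd f g) => M e /=; rewrite fP gP. Qed.

Lemma definable_all i j P : definable P ->
  definable (fun M e => forall x, eps x (e j) -> P M (upd e i x)).
Proof.
by move=> [f fP]; exists (FAll i j f) => M e /=; split=> h x /h; rewrite fP.
Qed.

Lemma definable_iff P Q : (forall M e, P M e <-> Q M e) -> definable P -> definable Q.
Proof. by move=> PQ [f fP]; exists f => M e; rewrite fP. Qed.

Lemma definable_or P Q : definable P -> definable Q -> definable (fun M e => P M e \/ Q M e).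
Proof.
move=> dP dQ; apply: definable_iff (definable_not (definable_and (definable_not dP) (definable_not dQ))) => M e.
rewrite not_andE !notK; tauto.
Qed.

Lemma definable_imp P Q : definable P -> definable Q -> definable (fun M e => P M e -> Q M e).
Proof.
move=> dP dQ; apply: definable_iff (definable_or (definable_not dP) dQ) => M e.
by rewrite implyE; split=> -[]; [left|right|left|right].
Qed.

Lemma definable_ex i j P : definable P ->
  definable (fun M e => exists x, eps x (e j) /\ P M (upd e i x)).
Proof.
move=> dP; apply: definable_iff (definable_not (definable_all i j (definable_not dP))) => M e.
split=> [|[x [xj Px]] h]; last exact: h xj Px.
by move=> h; apply: contrapT => h'; apply: h => x xj Px; apply: h'; exists x.
Qed.

Lemma definable_true : definable (fun M e => True).
Proof. by exists (FEq 0 0) => M e. Qed.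

Lemma definable_exn n (P : nat -> forall M : eps_structure, (nat -> M) -> Prop) :
  (forall i, definable (P i)) ->
  definable (fun M e => exists i, (i < n)%N /\ P i M e).
Proof.
move=> dP; elim: n => [|n IH].
  by apply: definable_iff (definable_not definable_true) => M e; split=> // -[i []].
apply: definable_iff (definable_or IH (dP n)) => M e; split.
  by case=> [[i [il Pi]]|Pn]; [exists i; split=> //; apply: ltnW | exists n].
move=> [i []]; rewrite ltnS leq_eqVlt => /orP[/eqP->|il] Pi; first by right.
by left; exists i.
Qed.

End Definability.

Create HintDb coded.

(** Follows the syntax of the property, naming its bound variables from [k] on.
    The quantifier rules hold by conversion only because all indices that occur
    are numerals, or numerals plus a term and at least 40. *)
Ltac definability k :=
  cbv beta;
  lazymatch goal with
  | |- definable (fun M e => forall x, eps x (e ?j) -> @?Q M e x) =>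
    refine (@definable_all k j (fun M e => Q M e (e k)) _); definability (S k)
  | |- definable (fun M e => exists x, eps x (e ?j) /\ @?Q M e x) =>
    refine (@definable_ex k j (fun M e => Q M e (e k)) _); definability (S k)
  | |- definable (fun M e => exists i, is_true (i < ?n)%N /\ @?Q M e i) =>
    refine (@definable_exn n (fun i M e => Q M e i) _); intro; definability k
  | |- definable (fun M e => @?P M e /\ @?Q M e) =>
    refine (@definable_and P Q _ _); definability k
  | |- definable (fun M e => @?P M e \/ @?Q M e) =>
    refine (@definable_or P Q _ _); definability k
  | |- definable (fun M e => ~ @?P M e) =>
    refine (@definable_not P _); definability k
  | |- definable (fun M e => @?P M e -> @?Q M e) =>
    refine (@definable_imp P Q _ _); definability k
  | |- definable (fun M e => e ?i = e ?j) => exact (definable_eq i j)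
  | |- definable (fun M e => eps (e ?i) (e ?j)) => exact (definable_mem i j)
  end.

(** No formula below has more than 22 parameters besides the [t i]. *)
Ltac definable_by := autounfold with coded; definability 22%N.

Fixpoint bound f : nat :=
  match f with
  | FEq i j => maxn i.+1 j.+1
  | FMem i j => maxn i.+1 j.+1
  | FNot g => bound g
  | FAnd g h => maxn (bound g) (bound h)
  | FAll i j g => maxn (maxn i.+1 j.+1) (bound g)
  end.

Lemma sat_ext (M : eps_structure) f (e e' : nat -> M) :
  (forall i, (i < bound f)%N -> e i = e' i) -> sat e f <-> sat e' f.
Proof.
elim: f e e' => [i j|i j|g IH|g IHg h IHh|i j g IH] e e' /= ee'.
- by rewrite !ee' // leq_max leqnn ?orbT.
- by rewrite !ee' // leq_max leqnn ?orbT.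
- by rewrite (IH _ _ ee').
- by rewrite (IHg e e') ?(IHh e e') // => i il; apply: ee'; rewrite leq_max il ?orbT.
- rewrite (ee' j) ?leq_max ?leqnn ?orbT //.
  by split=> h x xj; have := h x xj; apply iffLR;
    [|symmetry]; apply: IH => k kl; case: eqP => // _; apply: ee'; rewrite leq_max kl orbT.
Qed.

Definition allc u (s : seq nat) f := foldr (fun i g => FAll i u g) f s.

Lemma sat_allc (M : eps_structure) u s f (e : nat -> M) : u \notin s ->
  sat e (allc u s f) <->
  forall e', (forall i, i \notin s -> e' i = e i) ->
    (forall i, i \in s -> eps (e' i) (e u)) -> sat e' f.
Proof.
elim: s e => [|i s IH] e us.
  split=> [h e' ee' _|]; last by apply=> //.
  by apply: iffLR h; apply: sat_ext => i _; rewrite ee'.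
move: us; rewrite inE negb_or => /andP[ui us] /=; split.
  move=> h e' e'1 e'2; have := h (e' i) (e'2 i (mem_head _ _)).
  rewrite IH //; apply.
    move=> k ks; case: eqP => [->//|/eqP ki]; apply: e'1.
    by rewrite inE negb_or ki.
  by move=> k ks; rewrite (negPf ui); apply: e'2; rewrite inE ks orbT.
move=> h x xu; rewrite IH // (negPf ui) => e' e'1 e'2; apply: h.
  by move=> k; rewrite inE negb_or => /andP[ki ks]; rewrite e'1 // (negPf ki).
move=> k; rewrite inE => /orP[/eqP->|]; last exact: e'2.
by case: (boolP (i \in s)) => [/e'2//|ks]; rewrite e'1 // eqxx.
Qed.

Section Pairs.
Variable M : eps_structure.
Implicit Types a b c p f u v x y : M.

(** Pairs and application are described relationally, with quantifiers bounded
    by the set at hand, since [opair] and [app] are not formulas. *)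
Definition is_upair c a b := eps a c /\ (eps b c /\ forall x, eps x c -> x = a \/ x = b).

Definition is_opair p a b := exists u, eps u p /\ (is_upair u a a /\
  exists v, eps v p /\ (is_upair v a b /\ is_upair p u v)).

Definition pair_in f a b := exists p, eps p f /\ is_opair p a b.

Definition triple_in f a b c := exists p, eps p f /\
  exists s, eps s p /\ exists u, eps u s /\ (is_opair u a b /\ is_opair p u c).

(** Enough set theory for Kuratowski pairs.  Extensionality is required of
    inhabited sets only, as individuals have no elements. *)
Definition pairing := 
  (forall a b, elems a !=set0 -> elems a = elems b -> a = b) /\
  forall a b, exists c, elems c = [set a; b].

Hypothesis Mp : pairing.

Lemma upairE a b : elems (upair a b) = [set a; b].
Proof.
have [c cP] := Mp.2 a b.
by have := @getI _ [set c | elems c = [set a; b]] c cP.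
Qed.

Lemma is_upairP c a b : is_upair c a b <-> c = upair a b.
Proof.
split=> [[ac [bc cP]]|->].
  apply: Mp.1; first by exists a.
  rewrite upairE; apply/seteqP; split=> x; first exact: cP.
  by case=> ->.
have e x : eps x (upair a b) <-> x = a \/ x = b.
  by have := upairE a b => /seteqP[h1 h2]; split; [apply: h1|apply: h2].
by split; [|split]; [apply/e; left|apply/e; right|move=> x /e].
Qed.

Lemma mem_upair x a b : eps x (upair a b) <-> x = a \/ x = b.
Proof.
have := upairE a b => /seteqP[h1 h2]; split; [apply: h1|apply: h2].
Qed.

Lemma is_opairP p a b : is_opair p a b <-> p = opair a b.
Proof.
split=> [[u [up [/is_upairP-> [v [vp [/is_upairP-> /is_upairP]]]]]]|->] //.
exists (upair a a); split; first by apply/mem_upair; left.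
split; first exact/is_upairP.
exists (upair a b); split; first by apply/mem_upair; right.
by split; apply/is_upairP.
Qed.

Lemma pair_inP f a b : pair_in f a b <-> eps (opair a b) f.
Proof.
split=> [[p [pf /is_opairP<-]]|h] //; exists (opair a b); split=> //; exact/is_opairP.
Qed.

Lemma triple_inP f a b c : triple_in f a b c <-> eps (opair (opair a b) c) f.
Proof.
split=> [[p [pf [s [_ [u [_ [/is_opairP-> /is_opairP<-]]]]]]]|h] //.
exists (opair (opair a b) c); split=> //; exists (upair (opair a b) (opair a b)).
split; first by apply/mem_upair; left.
exists (opair a b); split; first by apply/mem_upair; left.
by split; apply/is_opairP.
Qed.

Lemma upair_inj a b a' b' : upair a b = upair a' b' ->
  (a = a' /\ b = b') \/ (a = b' /\ b = a').
Proof.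
move=> e.
have /mem_upair h1 : eps a (upair a' b') by rewrite -e; apply/mem_upair; left.
have /mem_upair h2 : eps b (upair a' b') by rewrite -e; apply/mem_upair; right.
have /mem_upair h3 : eps a' (upair a b) by rewrite e; apply/mem_upair; left.
have /mem_upair h4 : eps b' (upair a b) by rewrite e; apply/mem_upair; right.
by intuition congruence.
Qed.

Lemma opair_inj a b a' b' : opair a b = opair a' b' -> a = a' /\ b = b'.
Proof.
by move=> /upair_inj[[/upair_inj h1 /upair_inj h2]|[/upair_inj h1 /upair_inj h2]];
  intuition congruence.
Qed.

End Pairs.

#[local] Hint Unfold is_upair is_opair pair_in triple_in : coded.

(** * The superstructure and transfer *)

Section Standard.
Variables (R : realType) (V : superstructure R).
Implicit Types (a b x y : V) (P : set V).

Local Notation level := (rank_level (indiv V)).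

Lemma rank_le m n : (m <= n)%N -> level m `<=` level n.
Proof.
move=> /subnK<-; elim: (n - m)%N => [|k IH] //=.
by apply: subset_trans IH _; left.
Qed.

Lemma rank_elems a n : level n a -> ~ indiv V a -> elems a `<=` level n.-1.
Proof.
elim: n => [|n IH] //= [/IH h|[_ h]] na //; apply: subset_trans (h na) _.
by apply: rank_le; apply: leq_pred.
Qed.

Lemma ssetP P n : P `<=` level n -> ~ indiv V (sset P) /\ elems (sset P) = P.
Proof.
move=> /ss_power[a na ea].
exact: (@getI _ [set a | ~ indiv V a /\ elems a = P] a (conj na ea)).
Qed.

Lemma rank_sset P n : P `<=` level n -> level n.+1 (sset P).
Proof. by move=> Pn; have [na ea] := ssetP Pn; right; split; rewrite ?ea. Qed.

Lemma mem_sset P n x : P `<=` level n -> eps x (sset P) <-> P x.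
Proof. by move=> /ssetP[_ e]; rewrite -[P in _ <-> P x]e. Qed.

Lemma indiv_rank n x : indiv V x -> level n x.
Proof. by move=> ix; apply: (@rank_le 0%N n). Qed.

Lemma inhabited_not_indiv a : elems a !=set0 -> ~ indiv V a.
Proof. by move=> [x xa] /indiv_elems e; have : elems a x by []; rewrite e. Qed.

Lemma pairing_std : pairing V.
Proof.
split=> [a b a0 e|a b].
  apply: ss_ext => //; first exact: inhabited_not_indiv.
  by apply: inhabited_not_indiv; rewrite -e.
have [m am] := ss_rank a; have [n bn] := ss_rank b.
have /ss_power[c _ cP] : [set a; b] `<=` level (maxn m n).
  by move=> _ [->|->]; [apply: rank_le am|apply: rank_le bn]; rewrite ?leq_maxl ?leq_maxr.
by exists c.
Qed.

Lemma not_indiv_upair a b : ~ indiv V (upair a b).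
Proof. by apply: inhabited_not_indiv; exists a; apply/mem_upair; [exact: pairing_std|left]. Qed.

Lemma rank_upair n a b : level n a -> level n b -> level n.+1 (upair a b).
Proof.
move=> an bn; right; split; first exact: not_indiv_upair.
by rewrite (upairE pairing_std) => _ [->|->].
Qed.

Lemma rank_opair n a b : level n a -> level n b -> level n.+2 (opair a b).
Proof. by move=> an bn; do !apply: rank_upair. Qed.

Lemma rank_pairs n P : (forall p, P p -> exists a b, [/\ level n a, level n b & p = opair a b]) ->
  P `<=` level n.+2.
Proof. by move=> h p /h[a [b [an bn ->]]]; apply: rank_opair. Qed.

Lemma rank_cplx n z : level n (cplx V z).
Proof. by apply: indiv_rank; apply: cplx_indiv; exists z. Qed.

Definition lev n : V := sset (level n).

Lemma mem_lev n x : eps x (lev n) <-> level n x.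
Proof. exact: (@mem_sset _ n). Qed.

Lemma mem_indiv_set x : eps x (indiv_set V) <-> indiv V x.
Proof. exact: (@mem_sset _ 0%N). Qed.

Definition cset (P : set R[i]) : V := sset (cplx V @` P).

Lemma mem_cset (P : set R[i]) x : eps x (cset P) <-> exists2 z, P z & cplx V z = x.
Proof. by apply: (@mem_sset _ 0%N) => _ [z _ <-]; apply: rank_cplx. Qed.

Lemma mem_cset_cplx (P : set R[i]) z : eps (cplx V z) (cset P) <-> P z.
Proof. by rewrite mem_cset; split=> [[w Pw /cplx_inj<-]|Pz] //; exists z. Qed.

Lemma mem_circle x : eps x (circle_set V) <-> exists2 z, `|z| = 1 & cplx V z = x.
Proof. exact: mem_cset. Qed.

Lemma mem_nat x : eps x (nat_set V) <-> exists n : nat, x = cplx V n%:R.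
Proof.
rewrite /nat_set (@mem_sset _ 0%N); last by move=> _ [n _ <-]; apply: rank_cplx.
by split=> [[n _ <-]|[n ->]]; exists n.
Qed.

Lemma mem_real x : eps x (real_set V) <-> exists r : R, x = cplx V r%:C.
Proof.
rewrite /real_set (@mem_sset _ 0%N); last by move=> _ [n _ <-]; apply: rank_cplx.
by split=> [[n _ <-]|[n ->]]; exists n.
Qed.

Lemma pair_in_lt x y :
  pair_in (lt_graph V) x y <-> exists a b : R, [/\ a < b, x = cplx V a%:C & y = cplx V b%:C].
Proof.
rewrite (pair_inP pairing_std) (@mem_sset _ 2%N).
  split=> [[a [b [ab /(opair_inj pairing_std)[-> ->]]]]|[a [b [ab -> ->]]]]; exists a, b => //.
by move=> _ [a [b [_ ->]]]; apply: rank_opair; apply: rank_cplx.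
Qed.

Lemma pair_in_graph1 f x y : pair_in (graph1 V f) x y <-> exists z, x = cplx V z /\ y = cplx V (f z).
Proof.
rewrite (pair_inP pairing_std) (@mem_sset _ 2%N).
  split=> [[a /(opair_inj pairing_std)[-> ->]]|[a [-> ->]]]; exists a => //.
by move=> _ [a ->]; apply: rank_opair; apply: rank_cplx.
Qed.

Lemma triple_in_graph2 f x y z : triple_in (graph2 V f) x y z <->
  exists u v, [/\ x = cplx V u, y = cplx V v & z = cplx V (f u v)].
Proof.
have inj := opair_inj pairing_std.
rewrite (triple_inP pairing_std) (@mem_sset _ 4%N).
  split=> [[u [v /inj[/inj[-> ->] ->]]]|[u [v [-> -> ->]]]]; exists u, v => //.
by move=> _ [u [v ->]]; do !apply: rank_opair; apply: rank_cplx.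
Qed.

Definition crel (P : R[i] -> R[i] -> R[i] -> Prop) : V :=
  sset [set p | exists u v w, P u v w /\ p = opair (opair (cplx V u) (cplx V v)) (cplx V w)].

Lemma triple_in_crel (P : R[i] -> R[i] -> R[i] -> Prop) x y z : triple_in (crel P) x y z <->
  exists u v w, [/\ P u v w, x = cplx V u, y = cplx V v & z = cplx V w].
Proof.
have inj := opair_inj pairing_std.
rewrite (triple_inP pairing_std) (@mem_sset _ 4%N).
  split=> [[u [v [w [Puv /inj[/inj[-> ->] ->]]]]]|[u [v [w [Puv -> -> ->]]]]];
    by exists u, v, w.
by move=> _ [u [v [w [_ ->]]]]; do !apply: rank_opair; apply: rank_cplx.
Qed.

End Standard.

Section Transfer.
Variables (R : realType) (V : superstructure R) (K : Type).
Variable W : nonstandard_universe V K.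

Local Notation hlev n := (star W (lev V n)).

Lemma star_sub (a b : V) : elems a `<=` elems b -> elems (star W a) `<=` elems (star W b).
Proof.
move=> ab.
have := @star_transfer _ _ _ W (FAll 0 1 (FMem 0 2)) (nth point [:: a; a; b]).
by move=> [h _] x xa; apply: (h ab x xa).
Qed.

Lemma hlev_le m n : (m <= n)%N -> elems (hlev m) `<=` elems (hlev n).
Proof. by move=> /rank_le h; apply: star_sub => x /mem_lev/h ?; apply/mem_lev. Qed.

(** Every internal object belongs to some *V_n; this is what makes the
    quantifiers over all internal objects in [transfer_param] bounded. *)
Lemma hlev_cover (w : W) : exists n, eps w (hlev n).
Proof.
have [a wa] := star_internal w; have [n an] := ss_rank a.
exists n.-1; apply: star_sub wa; case: (EM (indiv V a)) => [/indiv_elems->//|na].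
by move=> x /(rank_elems an na) ?; apply/mem_lev.
Qed.

Lemma hlev_cover_nat (e : nat -> W) N :
  exists m, forall i, (i < N)%N -> eps (e i) (hlev m).
Proof.
elim: N => [|N [m IH]]; first by exists 0%N.
have [n en] := hlev_cover (e N); exists (maxn m n) => i.
rewrite ltnS leq_eqVlt => /orP[/eqP->|/IH].
  by apply: hlev_le en; apply: leq_maxr.
by apply: hlev_le; apply: leq_maxl.
Qed.

(** Only the finitely many variables of the formula matter; given internal values
    for them, those not fixed by [c] can be quantified over a common *V_m, which
    turns the hypothesis into a bounded sentence with standard parameters. *)
Lemma transfer_param (P : forall M : eps_structure, (nat -> M) -> Prop) (c : nat -> option V) :
  definable P ->
  (forall e : nat -> V, (forall i v, c i = Some v -> e i = v) -> P V e) ->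
  forall e : nat -> W, (forall i v, c i = Some v -> e i = star W v) -> P W e.
Proof.
move=> [f fP] PV e ec; rewrite -fP.
pose N := bound f; have [m em] := hlev_cover_nat e N.
pose s := [seq i <- iota 0 N | ~~ isSome (c i)].
have sN i : i \in s -> (i < N)%N by rewrite mem_filter mem_iota => /and3P[_ _].
have Ns : N \notin s by apply/negP => /sN; rewrite ltnn.
pose e0 i : V := if i == N then lev V m else odflt point (c i).
have /(star_transfer W) : sat e0 (allc N s f).
  apply/sat_allc => // e' e'1 _.
  pose e2 i := if i == N then odflt point (c i) else e' i.
  have /sat_ext e2E : forall i, (i < bound f)%N -> e2 i = e' i.
    by move=> i il; rewrite /e2; case: eqP => // iN; move: il; rewrite iN ltnn.
  apply/e2E/fP/PV => i v iv; rewrite /e2; case: eqP => [_|/eqP iN]; first by rewrite iv.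
  by rewrite e'1 ?/e0 ?(negPf iN) ?iv // mem_filter iv.
rewrite (sat_allc _ _ Ns) => h.
pose e2 i := if i == N then star W (lev V m) else if (i < N)%N then e i else star W (odflt point (c i)).
have /sat_ext e2E : forall i, (i < bound f)%N -> e2 i = e i.
  by move=> i il; rewrite /e2 il; case: eqP => // iN; move: il; rewrite iN ltnn.
apply/e2E/h => i.
  rewrite /e2 /e0; case: eqP => // _; case: (ltnP i N) => // iN.
  rewrite mem_filter mem_iota /= iN andbT; case ci: (c i) => [v|] // _.
  by rewrite (ec _ _ ci).
move=> /sN iN; rewrite /e2 iN /e0 eqxx; case: eqP => [e1|_]; last exact: em.
by move: iN; rewrite e1 ltnn.
Qed.

Lemma transfer (P : forall M : eps_structure, (nat -> M) -> Prop) (cs : seq V) :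
  definable P ->
  (forall e : nat -> V, (forall i, (i < size cs)%N -> e i = nth point cs i) -> P V e) ->
  forall e : nat -> W, (forall i, (i < size cs)%N -> e i = star W (nth point cs i)) -> P W e.
Proof.
move=> dP PV e ec.
pose c i := if (i < size cs)%N then Some (nth point cs i) else None.
apply: (@transfer_param P c dP) => [e' h|i v].
  by apply: PV => i ic; apply: h; rewrite /c ic.
by rewrite /c; case: ifP => // ic [<-]; apply: ec.
Qed.

End Transfer.

(** * Internal comprehension *)

Section Comprehension.
Variables (R : realType) (V : superstructure R) (K : Type).
Variable W : nonstandard_universe V K.

(** The separation axiom for [f], with the bounds [e N], [e N.+1], [e N.+3] meant
    to be *V_(m+1), the individuals and *V_m. *)
Lemma definable_comprehension f N : (bound f <= N)%N -> (2 <= N)%N ->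
  definable (fun M e => eps (e 1%N) (e N.+3) ->
    exists Y, eps Y (e N) /\ (~ eps Y (e N.+1) /\
      ((forall y, eps y Y -> eps y (e 1%N) /\ sat (upd e 0%N y) f) /\
       (forall y, eps y (e 1%N) -> sat (upd e 0%N y) f -> eps y Y)))).
Proof.
move=> fN N2; have neq k : (k < N.+2)%N -> (k == N.+2) = false by move=> h; apply: ltn_eqF.
have df : definable (fun M e => sat e f) by exists f.
have dY := definable_and (definable_mem 0 1) df.
have dX := definable_imp df (definable_mem 0 N.+2).
apply: definable_imp (definable_mem 1 N.+3) _.
apply: definable_iff (definable_ex N.+2 N (definable_and (definable_not (definable_mem N.+2 N.+1))
  (definable_and (definable_all 0%N N.+2 dY) (definable_all 0%N 1%N dX)))) => M e.
have E (Y y : M) : sat (upd (upd e N.+2 Y) 0%N y) f <-> sat (upd e 0%N y) f.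
  apply: sat_ext => i il; rewrite /upd; case: eqP => // _.
  by rewrite neq // ltnS leqW // (leq_trans (ltnW il)).
have h1 : (N.+1 == N.+2) = false by apply: neq.
have h2 : (1%N == N.+2) = false by apply: neq; rewrite !ltnS.
have u1 (Y : M) : upd e N.+2 Y N.+1 = e N.+1 by rewrite /upd h1.
have u2 (Y : M) : upd e N.+2 Y 1%N = e 1%N by rewrite /upd h2.
have u3 (Y : M) : upd e N.+2 Y N.+2 = Y by rewrite /upd eqxx.
have u4 (Y y : M) : upd (upd e N.+2 Y) 0%N y N.+2 = Y by rewrite /upd /= eqxx.
split=> -[Y [YN]].
  rewrite u1 u2 u3 => -[nY [hY hX]]; exists Y; split=> //; split=> //; split=> y.
    by move=> /hY[yX fy]; split; [rewrite -(u2 Y)|apply/(E Y y)].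
  by move=> yX fy; have := hX y yX (iffRL (E Y y) fy); rewrite u4.
move=> [nY [hY hX]]; exists Y; split=> //; rewrite u1 u2 u3; split=> //; split=> y.
  by move=> /hY[yX fy]; split; [rewrite -(u2 Y) in yX|apply/(E Y y)].
by move=> yX /(E Y y) fy; rewrite u4; apply: hX.
Qed.

(** Internal sets are closed under separation by formulas with internal
    parameters: in the superstructure the separated set has rank at most one more
    than its elements, so its existence is a bounded statement. *)
Lemma comprehension (P : forall M : eps_structure, (nat -> M) -> Prop) (e : nat -> W) :
  definable P ->
  exists2 Y, internal_set Y & forall y, eps y Y <-> eps y (e 1%N) /\ P W (upd e 0%N y).
Proof.
move=> [f fP]; pose N := (bound f).+2; have [m em] := hlev_cover (e 1%N).
have fN : (bound f <= N)%N by rewrite leqW.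
have N2 : (2 <= N)%N by [].
pose c i := if i == N then Some (lev V m.+1) else
  if i == N.+1 then Some (indiv_set V) else if i == N.+3 then Some (lev V m) else None.
pose e0 i := if i == N then star W (lev V m.+1) else
  if i == N.+1 then star W (indiv_set V) else if i == N.+3 then star W (lev V m) else e i.
have e0E i : (i < N)%N -> e0 i = e i.
  move=> il; have il1 := leqW il; have il3 := leqW (leqW il1).
  by rewrite /e0 (ltn_eqF il) (ltn_eqF il1) (ltn_eqF il3).
have satE y : sat (upd e0 0%N y) f <-> P W (upd e 0%N y).
  rewrite -fP; apply: sat_ext => i il; rewrite /upd; case: eqP => // _.
  by apply: e0E; rewrite !leqW.
have e0N3 : e0 N.+3 = star W (lev V m).
  by rewrite /e0 eqxx [N.+3 == N]gtn_eqF ?[N.+3 == N.+1]gtn_eqF // !ltnS leqW.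
have e0N1 : e0 N.+1 = star W (indiv_set V) by rewrite /e0 eqxx gtn_eqF.
have := @transfer_param _ _ _ W _ c (definable_comprehension fN N2) _ e0.
have cN : c N = Some (lev V m.+1) by rewrite /c eqxx.
have cN1 : c N.+1 = Some (indiv_set V) by rewrite /c eqxx; case: eqP => // /eqP; rewrite eqn_leq ltnn.
have cN3 : c N.+3 = Some (lev V m).
  by rewrite /c eqxx [N.+3 == N]gtn_eqF ?[N.+3 == N.+1]gtn_eqF // !ltnS leqW.
case.
- move=> e' h; rewrite (h _ _ cN) (h _ _ cN1) (h _ _ cN3) => /mem_lev em'.
  pose Q := [set y | eps y (e' 1%N) /\ sat (upd e' 0%N y) f].
  have Qm : Q `<=` rank_level (indiv V) m.
    move=> y [yX _]; case: (EM (indiv V (e' 1%N))) => [/indiv_elems e1|/(rank_elems em') h1].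
      by have : elems (e' 1%N) y by []; rewrite e1.
    by apply: rank_le (h1 _ yX); apply: leq_pred.
  have memQ := mem_sset _ Qm.
  exists (sset Q); split; first by apply/mem_lev/rank_sset.
  split; first by rewrite mem_indiv_set; case: (ssetP Qm).
  by split=> y; rewrite memQ.
- move=> i v; rewrite /c /e0; case: eqP => [_ [<-]//|_]; case: eqP => [_ [<-]//|_].
  by case: eqP => [_ [<-]|].
- by rewrite e0N3 e0E.
- rewrite (e0E 1%N) // => Y [_ [nY [hY hX]]]; exists Y.
    by rewrite /internal_set -e0N1.
  move=> y; split; first by move=> /hY[yX] /satE.
  by move=> [yX /satE]; apply: hX.
Qed.

End Comprehension.

(** * Internal objects and hypercomplex numbers *)

Section Internal.
Variables (R : realType) (V : superstructure R) (K : Type).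
Variable W : nonstandard_universe V K.

Local Notation hlev n := (star W (lev V n)).

Definition fixenv (M : eps_structure) (cs : seq M) (e : nat -> M) i :=
  if (i < size cs)%N then nth point cs i else e i.

(** Finitely many parameters [ws], and a list [ts] of unspecified length that
    starts at 40, out of reach of the bound variables of the formulas below. *)
Definition env (M : eps_structure) (ws ts : seq M) i :=
  if (i < 40)%N then nth point ws i else nth point ts (i - 40).

Lemma transferE (cs : seq V) (P : forall M : eps_structure, (nat -> M) -> Prop) :
  (size cs < 40)%N -> definable P -> (forall e : nat -> V, P V (fixenv cs e)) ->
  forall ws ts : seq W, P W (env (map (star W) cs ++ ws) ts).
Proof.
move=> cs40 dP PV ws ts; apply: (transfer (cs := cs) dP).
  move=> e he; have -> : e = fixenv cs e; last exact: PV.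
  by apply/funext => i; rewrite /fixenv; case: ifP => // /he.
move=> i ics; rewrite /env (ltn_trans ics cs40) nth_cat size_map ics.
by rewrite (nth_map point).
Qed.

Lemma pairing_int : pairing W.
Proof.
split=> [a b [x xa] e|a b].
  have h : (exists x, eps x a /\ x = x) -> (forall x, eps x a -> eps x b) ->
      (forall x, eps x b -> eps x a) -> a = b.
    apply: (@transferE [::] (fun M (e : nat -> M) => (exists x, eps x (e 0%N) /\ x = x) ->
      (forall x, eps x (e 0%N) -> eps x (e 1%N)) ->
      (forall x, eps x (e 1%N) -> eps x (e 0%N)) -> e 0%N = e 1%N) isT _ _ [:: a; b] [::]).
      by definable_by.
    move=> e' [y [ya _]] ab ba; apply: (pairing_std V).1; first by exists y.
    by apply/seteqP.
  move/seteqP: e => -[ab ba]; apply: h => //; by exists x.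
have [m am] := hlev_cover a; have [n bn] := hlev_cover b.
pose k := maxn m n.
have {}am : eps a (hlev k) by apply: hlev_le am; apply: leq_maxl.
have {}bn : eps b (hlev k) by apply: hlev_le bn; apply: leq_maxr.
have : eps a (hlev k) -> eps b (hlev k) -> exists c, eps c (hlev k.+1) /\ is_upair c a b.
  apply: (@transferE [:: lev V k; lev V k.+1] (fun M e => eps (e 2%N) (e 0%N) ->
    eps (e 3%N) (e 0%N) -> exists c, eps c (e 1%N) /\ is_upair c (e 2%N) (e 3%N)) isT _ _ [:: a; b] [::]).
    by definable_by.
  move=> e /mem_lev ha /mem_lev hb; exists (upair (e 2%N) (e 3%N)); split.
    by apply/mem_lev; apply: rank_upair.
  by apply/is_upairP; first exact: pairing_std.
move=> /(_ am bn)[c [_ [ac [bc cP]]]]; exists c; apply/seteqP; split=> x; first exact: cP.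
by case=> ->.
Qed.

Lemma mem_indiv_int (a x : W) : eps a (star W (indiv_set V)) -> ~ eps x a.
Proof.
apply: (@transferE [:: indiv_set V] (fun M e => eps (e 1%N) (e 0%N) -> ~ eps (e 2%N) (e 1%N))
  isT _ _ [:: a; x] [::]); first by definable_by.
by move=> e /mem_indiv_set/indiv_elems h xa; have : elems (e 1%N) (e 2%N) by []; rewrite h.
Qed.

Lemma inhabited_internal (a x : W) : eps x a -> internal_set a.
Proof. by move=> xa /mem_indiv_int; apply; exact: xa. Qed.

Lemma isetP (P : set W) (A : W) : internal_set A -> (forall x, eps x A <-> P x) ->
  internal_set (iset P) /\ forall x, eps x (iset P) <-> P x.
Proof.
move=> iA AP; have eA : internal_set A /\ elems A = P.
  by split=> //; apply/seteqP; split=> x /AP.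
have [iP eP] := @getI _ [set A | internal_set A /\ elems A = P] A eA.
by split=> // x; rewrite -[P in _ <-> P x]eP.
Qed.

Lemma subset_int (A : W) (P : forall M : eps_structure, (nat -> M) -> Prop) (ws ts : seq W) :
  definable P -> exists2 Y : W, internal_set Y &
    forall y, eps y Y <-> eps y A /\ P W (env (y :: A :: ws) ts).
Proof.
move=> dP; have [Y iY YP] := comprehension (env (point :: A :: ws) ts) dP.
exists Y => // y; rewrite YP.
have -> // : upd (env (point :: A :: ws) ts) 0%N y = env (y :: A :: ws) ts.
by apply/funext => -[|[|i]].
Qed.

Lemma internal_funP (f : W) (S T : set W) : internal_fun f S T ->
  forall a, S a -> T (app f a) /\ forall b, eps (opair a b) f <-> b = app f a.
Proof.
move=> [_ fST fS] a Sa; have [b [ab bU]] := fS a Sa.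
have appP : eps (opair a (app f a)) f by apply: (@getI _ [set b | eps (opair a b) f] b ab).
have e : app f a = b by apply/esym/bU.
split.
  have [a' [b' [_ Tb' /(opair_inj pairing_int)[_ ->]]]] := fST _ appP; exact: Tb'.
by move=> b'; split=> [|->//]; rewrite e => /bU.
Qed.

Definition hcomplex : set W := elems (star W (cset V setT)).

Lemma hreal_hcomplex (x : W) : hreal x -> hcomplex x.
Proof. by apply: star_sub => y /mem_real[r ->]; apply/mem_cset_cplx. Qed.

Lemma hnat_hreal (x : W) : hnat x -> hreal x.
Proof. by apply: star_sub => y /mem_nat[n ->]; apply/mem_real; exists n%:R; rewrite rmorph_nat. Qed.

Lemma hcircle_hcomplex (x : W) : hcircle x -> hcomplex x.
Proof. by apply: star_sub => y /mem_circle[z _ <-]; apply/mem_cset_cplx. Qed.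

Lemma hstd_hcomplex z : hcomplex (hstd W z).
Proof.
have := @star_transfer _ _ _ W (FMem 0 1) (nth point [:: cplx V z; cset V setT]).
by move=> [h _]; apply: h; apply/mem_cset_cplx.
Qed.

Lemma hfun1P g (x : W) : hcomplex x -> hcomplex (hfun1 g x) /\
  forall y, pair_in (star W (graph1 V g)) x y <-> y = hfun1 g x.
Proof.
move=> xC.
have : eps x (star W (cset V setT)) -> exists y, eps y (star W (cset V setT)) /\
    pair_in (star W (graph1 V g)) x y.
  apply: (@transferE [:: cset V setT; graph1 V g] (fun M e => eps (e 2%N) (e 0%N) ->
    exists y, eps y (e 0%N) /\ pair_in (e 1%N) (e 2%N) y) isT _ _ [:: x] [::]).
    by definable_by.
  move=> e /mem_cset[z _ <-]; exists (cplx V (g z)); split; first exact/mem_cset_cplx.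
  by apply/pair_in_graph1; exists z.
move=> /(_ xC)[y [yC xy]].
have U y1 y2 : pair_in (star W (graph1 V g)) x y1 -> pair_in (star W (graph1 V g)) x y2 -> y1 = y2.
  apply: (@transferE [:: graph1 V g] (fun M e => pair_in (e 0%N) (e 1%N) (e 2%N) ->
    pair_in (e 0%N) (e 1%N) (e 3%N) -> e 2%N = e 3%N) isT _ _ [:: x; y1; y2] [::]).
    by definable_by.
  by move=> e /pair_in_graph1[z [-> ->]] /pair_in_graph1[z' [/cplx_inj<- ->]].
have e : hfun1 g x = y.
  apply: U => //; apply/(pair_inP pairing_int).
  apply: (@getI _ [set b | eps (opair x b) (star W (graph1 V g))] y).
  exact/(pair_inP pairing_int).
by rewrite e; split=> // y'; split=> [/U/(_ xy)|->].
Qed.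

Lemma hfun2P g (x y : W) : hcomplex x -> hcomplex y -> hcomplex (hfun2 g x y) /\
  forall z, triple_in (star W (graph2 V g)) x y z <-> z = hfun2 g x y.
Proof.
move=> xC yC.
have : eps x (star W (cset V setT)) -> eps y (star W (cset V setT)) ->
    exists z, eps z (star W (cset V setT)) /\ triple_in (star W (graph2 V g)) x y z.
  apply: (@transferE [:: cset V setT; graph2 V g] (fun M e => eps (e 2%N) (e 0%N) ->
    eps (e 3%N) (e 0%N) ->
    exists z, eps z (e 0%N) /\ triple_in (e 1%N) (e 2%N) (e 3%N) z) isT _ _ [:: x; y] [::]).
    by definable_by.
  move=> e /mem_cset[u _ eu] /mem_cset[v _ ev]; exists (cplx V (g u v)); split.
    exact/mem_cset_cplx.
  by apply/triple_in_graph2; exists u, v.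
move=> /(_ xC yC)[z [zC xyz]].
have U z1 z2 : triple_in (star W (graph2 V g)) x y z1 -> triple_in (star W (graph2 V g)) x y z2 -> z1 = z2.
  apply: (@transferE [:: graph2 V g] (fun M e => triple_in (e 0%N) (e 1%N) (e 2%N) (e 3%N) ->
    triple_in (e 0%N) (e 1%N) (e 2%N) (e 4%N) -> e 3%N = e 4%N) isT _ _ [:: x; y; z1; z2] [::]).
    by definable_by.
  move=> e /triple_in_graph2[u [v [-> -> ->]]] /triple_in_graph2[u' [v' [/cplx_inj<- /cplx_inj<- ->]]] //.
have e : hfun2 g x y = z.
  apply: U => //; apply/(triple_inP pairing_int).
  apply: (@getI _ [set b | eps (opair (opair x y) b) (star W (graph2 V g))] z).
  exact/(triple_inP pairing_int).
by rewrite e; split=> // z'; split=> [/U/(_ xyz)|->].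
Qed.

Lemma hltP (x y : W) : hlt x y <-> pair_in (star W (lt_graph V)) x y.
Proof. by rewrite (pair_inP pairing_int). Qed.

End Internal.

(** * Finite abelian groups coded in the superstructure *)

Section Coded.
Variable M : eps_structure.
Implicit Types f A B G p S N C m g : M.

Definition is_fun f A B :=
  (forall q, eps q f -> exists a, eps a A /\ exists b, eps b B /\ is_opair q a b) /\
  forall a, eps a A -> exists b, eps b B /\ (pair_in f a b /\
    forall b', eps b' B -> pair_in f a b' -> b' = b).

(** [p] is the graph of addition: [triple_in p a b c] reads [a + b = c]. *)
Definition is_abgroup G p :=
  (forall a, eps a G -> forall b, eps b G -> exists c, eps c G /\ (triple_in p a b c /\
     forall c', eps c' G -> triple_in p a b c' -> c' = c)) /\
  ((forall a, eps a G -> forall b, eps b G -> forall c, eps c G ->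
      forall x, eps x G -> forall y, eps y G -> forall z, eps z G -> forall w, eps w G ->
      triple_in p b c x -> triple_in p a x y -> triple_in p a b z -> triple_in p z c w -> y = w) /\
  ((forall a, eps a G -> forall b, eps b G -> forall c, eps c G ->
      triple_in p a b c -> triple_in p b a c) /\
  exists z, eps z G /\ ((forall a, eps a G -> triple_in p a z a) /\
    forall a, eps a G -> exists b, eps b G /\ triple_in p a b z))).

(** [C] is the circle and [m] the graph of complex multiplication. *)
Definition is_hom C m G p g :=
  is_fun g G C /\
  forall a, eps a G -> forall b, eps b G -> forall c, eps c G -> triple_in p a b c ->
  forall x, eps x C -> forall y, eps y C -> forall z, eps z C ->
  pair_in g a x -> pair_in g b y -> pair_in g c z -> triple_in m x y z.

Definition values_in N S g := forall a, eps a S -> exists z, eps z N /\ pair_in g a z.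

End Coded.

#[local] Hint Unfold is_fun is_abgroup is_hom values_in : coded.

Section GroupLaw.

Record group_law (T : Type) := GroupLaw {
  gl_add : T -> T -> T; gl_zero : T; gl_opp : T -> T;
  gl_addA : associative gl_add; gl_addC : commutative gl_add;
  gl_add0 : left_id gl_zero gl_add; gl_addN : left_inverse gl_zero gl_opp gl_add }.

(** An alias, to keep the structure given by [L] apart from any other on [T]. *)
Definition group_of (T : finType) (L : group_law T) : Type := T.

HB.instance Definition _ (T : finType) (L : group_law T) := Finite.on (group_of L).
HB.instance Definition _ (T : finType) (L : group_law T) :=
  GRing.isZmodule.Build (group_of L) (@gl_addA T L) (@gl_addC T L) (@gl_add0 T L) (@gl_addN T L).

End GroupLaw.

Section StandardGroups.
Variables (R : realType) (V : superstructure R).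
Local Notation C := R[i].
Local Notation level := (rank_level (indiv V)).
Implicit Types (x y : V).

Definition hascard (A : set V) n :=
  exists s : seq V, [/\ uniq s, size s = n & forall x, A x <-> x \in s].

Lemma hascard_uniq A n m : hascard A n -> hascard A m -> n = m.
Proof.
move=> [s [us <- As]] [t [ut <- At]]; apply: perm_size; apply: uniq_perm => // x.
by apply/idP/idP => h; [apply/At/As|apply/As/At].
Qed.

Lemma hascard_map (T : finType) (v : T -> V) (A : set V) (D : {set T}) : injective v ->
  (forall x, A x <-> exists2 a, a \in D & v a = x) -> hascard A #|D|.
Proof.
move=> vI AD; exists (map v (enum D)); split.
- by rewrite map_inj_uniq // enum_uniq.
- by rewrite size_map cardE.
- move=> x; rewrite AD; split=> [[a aD <-]|/mapP[a aD ->]]; last by exists a; rewrite // -mem_enum.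
  by apply: map_f; rewrite mem_enum.
Qed.

Lemma hascard_sub (s : seq V) (A : set V) : (forall x, A x -> x \in s) -> exists n, hascard A n.
Proof.
move=> As; exists (size (undup [seq x <- s | `[< A x >]])).
exists (undup [seq x <- s | `[< A x >]]); split=> //; first exact: undup_uniq.
move=> x; rewrite mem_undup mem_filter; split=> [Ax|/andP[/asboolP]//].
by rewrite As // andbT; apply/asboolP.
Qed.

Lemma rank_sub m (A G : V) : level m G -> ~ indiv V G -> ~ indiv V A ->
  elems A `<=` elems G -> level m A.
Proof.
elim: m => [//|m IH] /= [Gm|[_ Gm]] nG nA AG; first by left; apply: IH.
by right; split=> //; apply: subset_trans AG Gm.
Qed.

(** Comparing sizes by constants of the language keeps the counting theorems
    short: their proofs see native finite cardinals, and only [counts_int] has to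
    relate them to internal bijections. *)
Definition card_rel m : V := sset [set p | exists A n,
  [/\ level m A, ~ indiv V A, hascard (elems A) n & p = opair A (cplx V n%:R)]].

Definition card_le m (q : R) : V := sset [set p | exists A B a b,
  [/\ level m A /\ level m B, hascard (elems A) a, hascard (elems B) b,
      a%:R <= q * b%:R & p = opair A B]].

Lemma pair_in_card m A x : pair_in (card_rel m) A x <->
  [/\ level m A, ~ indiv V A & exists2 n, hascard (elems A) n & x = cplx V n%:R].
Proof.
rewrite (pair_inP (pairing_std V)) (@mem_sset _ _ _ m.+2).
  split=> [[A' [n [Am nA An /(opair_inj (pairing_std V))[-> ->]]]]|[Am nA [n An ->]]].
    by split=> //; exists n.
  by exists A, n.
by apply: rank_pairs => p [A' [n [Am _ _ ->]]]; exists A', (cplx V n%:R); split=> //; apply: rank_cplx.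
Qed.

Lemma pair_in_card_le m q A B : pair_in (card_le m q) A B <-> exists a b,
  [/\ level m A /\ level m B, hascard (elems A) a, hascard (elems B) b & a%:R <= q * b%:R].
Proof.
rewrite (pair_inP (pairing_std V)) (@mem_sset _ _ _ m.+2).
  split=> [[A' [B' [a [b [AB Aa Bb ab /(opair_inj (pairing_std V))[-> ->]]]]]]|[a [b [AB Aa Bb ab]]]].
    by exists a, b.
  by exists A, B, a, b.
by apply: rank_pairs => p [A' [B' [a [b [[Am Bm] _ _ _ ->]]]]]; exists A', B'.
Qed.

(** The bridge between a coded group [(G, p)] and the algebraic hierarchy. *)
Record presents (G p : V) (gT : finZmodType) (v : gT -> V) := Presents {
  pres_inj : injective v;
  pres_mem : forall x, eps x G <-> exists a, v a = x;
  pres_add : forall a b x, eps x G -> (triple_in p (v a) (v b) x <-> x = v (a + b)) }.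

Lemma exists_presents (G p : V) n : is_abgroup G p -> hascard (elems G) n ->
  exists (gT : finZmodType) (v : gT -> V), presents G p v /\ n = #|gT|.
Proof.
move=> [op [assoc [comm [z [zG [z0 zN]]]]]] [s [us ns Gs]].
pose T : finType := seq_sub s; pose v (t : T) : V := ssval t.
have vG t : eps (v t) G by apply/Gs; exact: ssvalP.
have vI : injective v by apply: val_inj.
have vP x : eps x G -> exists t, v t = x by move=> /Gs xs; exists (SeqSub xs).
have addP (ab : T * T) : exists c, triple_in p (v ab.1) (v ab.2) (v c).
  have [c [cG [cP _]]] := op _ (vG ab.1) _ (vG ab.2).
  by have [t tc] := vP c cG; exists t; rewrite tc.
have /choice[add0 add0P] := addP; pose add a b := add0 (a, b).
have {}addP a b : triple_in p (v a) (v b) (v (add a b)) := add0P (a, b).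
have addU a b x : eps x G -> triple_in p (v a) (v b) x <-> x = v (add a b).
  move=> xG; split=> [abx|->]; last exact: addP.
  have [c [cG [_ cU]]] := op _ (vG a) _ (vG b).
  by rewrite (cU _ xG abx); apply/esym/cU.
have [o oz] := vP z zG.
have oppP a : exists b, triple_in p (v a) (v b) z.
  by have [b [bG abz]] := zN _ (vG a); have [t tb] := vP b bG; exists t; rewrite tb.
have /choice[opp {}oppP] := oppP.
have addA : associative add.
  move=> a b c; apply: vI.
  exact: (assoc (v a) _ (v b) _ (v c) _ (v (add b c)) _ _ _ (v (add a b)) _ _ _
    (addP _ _) (addP _ _) (addP _ _) (addP _ _)).
have addC : commutative add.
  move=> a b; apply: vI; apply/addU => //; apply: comm => //; exact: addP.
have add0l : left_id o add.
  by move=> a; rewrite addC; apply: vI; apply/esym/addU => //; rewrite oz; apply: z0.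
have addN : left_inverse o opp add.
  by move=> a; rewrite addC; apply: vI; apply/esym/addU => //; rewrite oz.
pose L := GroupLaw addA addC add0l addN.
exists (group_of L : finZmodType), v; split.
  split=> // x; split=> [/vP|[a <-]] //; exact: vG.
by rewrite -ns -(card_seq_sub us).
Qed.

Section Presented.
Variables (G p : V) (gT : finZmodType) (v : gT -> V).
Hypothesis pr : presents G p v.
Implicit Types (f : {ffun gT -> C}).
Local Notation Circ := (circle_set V).
Local Notation mulG := (graph2 V (fun u v => u * v)).

Lemma pres_in a : eps (v a) G. Proof. by apply/(pres_mem pr); exists a. Qed.

Lemma pres_addE a b c : triple_in p (v a) (v b) (v c) <-> c = a + b.
Proof. by rewrite (pres_add pr _ _ (pres_in c)); split=> [/(pres_inj pr)|->]. Qed.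

Definition part (A : V) : {set gT} := [set a | `[< eps (v a) A >]]%SET.

Lemma mem_part A a : a \in part A <-> eps (v a) A.
Proof. by rewrite inE; split=> /asboolP. Qed.

Lemma hascard_part A : elems A `<=` elems G -> hascard (elems A) #|part A|.
Proof.
move=> AG; apply: (hascard_map (pres_inj pr)) => x; split=> [xA|[a /mem_part aA <-]] //.
have /(pres_mem pr)[a ax] : eps x G by apply: AG.
by exists a => //; apply/mem_part; rewrite ax.
Qed.

Definition codes (g : V) f := forall a x, pair_in g (v a) x <-> x = cplx V (f a).

Lemma hom_codes g : is_hom Circ mulG G p g -> exists2 f, is_char f & codes g f.
Proof.
move=> [[gE gF] gM].
have gP a : exists z : C, forall x, pair_in g (v a) x <-> x = cplx V z.
  have [b [/mem_circle[z _ zb] [ab bU]]] := gF _ (pres_in a); exists z => x.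
  split=> [ax|->]; last by rewrite zb.
  rewrite zb; apply: bU => //.
  have [q [qg /(is_opairP (pairing_std V)) qE]] := ax.
  have [a' [_ [x' [x'C /(is_opairP (pairing_std V))]]]] := gE _ qg.
  by rewrite qE => /(opair_inj (pairing_std V))[_ ->].
have /choice[h hP] := gP; exists [ffun a => h a]; last by move=> a x; rewrite hP ffunE.
have hcomplex a : eps (cplx V (h a)) Circ.
  have [b [bC [ab _]]] := gF _ (pres_in a).
  by move/hP: ab => <-.
have hM a b : h (a + b) = h a * h b.
  have : triple_in mulG (cplx V (h a)) (cplx V (h b)) (cplx V (h (a + b))).
    apply: (gM (v a) _ (v b) _ (v (a + b))) => //; try exact: pres_in; try exact/hP.
    exact/pres_addE.
  by move=> /triple_in_graph2[u [w [/cplx_inj<- /cplx_inj<- /cplx_inj]]].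
split=> [|a b]; rewrite !ffunE //.
have /mem_circle[z z1 /cplx_inj zh] := hcomplex 0.
have h0 : h 0 != 0 by rewrite -zh -normr_gt0 z1 ltr01.
by apply: (mulfI h0); rewrite -hM addr0 mulr1.
Qed.

(** The code of a character is a graph over [G], hence determined by its values;
    so counting codes is counting characters. *)
Lemma codes_inj g g' f : is_hom Circ mulG G p g -> is_hom Circ mulG G p g' ->
  codes g f -> codes g' f -> g = g'.
Proof.
move=> hg hg' cg cg'.
have sub h h' : is_hom Circ mulG G p h -> codes h f -> codes h' f -> elems h `<=` elems h'.
  move=> [[hE _] _] ch ch' q qh.
  have [a [/(pres_mem pr)[a0 <-] [b [_ qab]]]] := hE q qh.
  have : pair_in h (v a0) b by exists q.
  move=> /ch/ch'/(pair_inP (pairing_std V)).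
  by move/(is_opairP (pairing_std V)): qab => ->.
apply: (pairing_std V).1; last by apply/seteqP; split; apply: sub.
by exists (opair (v 0) (cplx V (f 0))); apply/(pair_inP (pairing_std V))/cg.
Qed.

Lemma char_coded m f : level m G -> is_char f ->
  exists g, [/\ level m.+3 g, is_hom Circ mulG G p g & codes g f].
Proof.
move=> Gm cf; have inj := opair_inj (pairing_std V).
have nG : ~ indiv V G by apply: inhabited_not_indiv; exists (v 0); apply: pres_in.
pose P := [set q | exists a, q = opair (v a) (cplx V (f a))].
have Pm : P `<=` level m.+2.
  apply: rank_pairs => q [a ->]; exists (v a), (cplx V (f a)); split=> //.
    by apply: rank_le (rank_elems Gm nG (pres_in a)); apply: leq_pred.
  exact: rank_cplx.
have cP : codes (sset P) f.
  move=> a x; rewrite (pair_inP (pairing_std V)) (mem_sset _ Pm).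
  split=> [[a' /inj[/(pres_inj pr)-> ->]]|->] //; by exists a.
have fC a : eps (cplx V (f a)) Circ.
  by apply/mem_circle; exists (f a) => //; rewrite norm_normc normc_char.
exists (sset P); split=> //; first exact: rank_sset.
split; first split.
- move=> q /(mem_sset _ Pm)[a ->]; exists (v a); split; first exact: pres_in.
  by exists (cplx V (f a)); split=> //; apply/(is_opairP (pairing_std V)).
- move=> x /(pres_mem pr)[a <-]; exists (cplx V (f a)); split=> //.
  by split; [apply/cP|move=> b _ /cP].
move=> _ /(pres_mem pr)[a <-] _ /(pres_mem pr)[b <-] _ /(pres_mem pr)[c <-] /pres_addE->.
move=> x _ y _ z _ /cP-> /cP-> /cP->; apply/triple_in_graph2; exists (f a), (f b).
by rewrite cf.2.
Qed.

Lemma codes_values g f (N : set C) S : codes g f -> elems S `<=` elems G ->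
  values_in (cset V N) S g <-> forall a, a \in part S -> N (f a).
Proof.
move=> cg SG; split=> [h a /mem_part/h[z [/mem_cset[w Nw <-]]]|h x xS].
  by move=> /cg/cplx_inj<-.
have /(pres_mem pr)[a ax] : eps x G by apply: SG.
exists (cplx V (f a)); split; last by rewrite -ax; apply/cg.
by apply/mem_cset_cplx/h/mem_part; rewrite ax.
Qed.

Lemma hom_rank m g : level m G -> is_hom Circ mulG G p g -> level m.+3 g.
Proof.
move=> Gm hg; have [f cf cg] := hom_codes hg.
by have [h [hm hh ch]] := char_coded Gm cf; rewrite (codes_inj hg hh cg ch).
Qed.

End Presented.
End StandardGroups.

(** * The counting theorems for coded groups *)

Section Statements.
Variable M : eps_structure.
Implicit Types G p A B D E X Y : M.

(** The three counting theorems, stated in any structure so that they can be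
    transferred.  The capitalized arguments before [G] are constants of the
    language. *)
Definition bohr_upper_stmt (Circ mulG Near CR Rel G p D Gam n N g : M) :=
  is_abgroup G p -> pair_in CR G g -> pair_in CR D n -> pair_in CR Gam N ->
  (forall x, eps x D -> eps x G) ->
  (forall c, eps c Gam -> is_hom Circ mulG G p c /\ values_in Near D c) ->
  triple_in Rel n N g.

Definition bohr_lower_stmt k (Circ mulG Near CR Rel U L CLa CLb CLc G p D B X Y E Gam n N g : M)
    (t : nat -> M) :=
  is_abgroup G p -> pair_in CR G g -> pair_in CR D n -> pair_in CR Gam N -> eps G L ->
  (forall x, eps x B -> eps x G) -> (forall x, eps x Y -> eps x G) ->
  (forall x, eps x E -> eps x G) ->
  (exists x, eps x D /\ eps x X) -> (forall x, eps x D -> eps x Y) ->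
  (forall x, eps x X -> eps x Y) ->
  (forall x, eps x X -> forall b, eps b B -> exists y, eps y Y /\ triple_in p x b y) ->
  (forall x, eps x X -> forall d, eps d D -> exists e, eps e E /\ triple_in p e d x) ->
  pair_in CLa Y D -> ~ pair_in CLb X D -> pair_in CLc E D ->
  (forall d, eps d D -> exists i, (i < k)%N /\
     (eps (t i) G /\ exists b, eps b B /\ triple_in p (t i) b d)) ->
  (forall c, eps c U -> is_hom Circ mulG G p c -> values_in Near D c -> eps c Gam) ->
  triple_in Rel n N g.

Definition cover_stmt k (CR CL G p A D g : M) (t : nat -> M) :=
  is_abgroup G p -> pair_in CR G g ->
  (forall x, eps x A -> eps x G) -> (forall x, eps x D -> eps x G) ->
  (exists x, eps x A /\ eps x G) -> (exists x, eps x D /\ eps x G) ->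
  (forall a, eps a A -> exists i, (i < k)%N /\
     (eps (t i) G /\ exists b, eps b D /\ triple_in p (t i) b a)) ->
  pair_in CL A D.

End Statements.

#[local] Hint Unfold bohr_upper_stmt bohr_lower_stmt cover_stmt : coded.

Section StandardTheorems.
Variables (R : realType) (V : superstructure R).
Local Notation C := R[i].
Local Notation level := (rank_level (indiv V)).
Local Notation Circ := (circle_set V).
Local Notation mulG := (graph2 V (fun u v => u * v)).

(** The circle condition is included so that the Bohr set is described by values
    in a single standard set. *)
Definition near (r : R) : set C := [set z | `|z| = 1 /\ `|z - 1| < r%:C].

Lemma nearP r z : near r z <-> normc z = 1 /\ normc (z - 1) < r.
Proof.
rewrite /near /= !norm_normc ltcR; split=> -[h1 h2]; split=> //; last by rewrite h1.
exact: complexI h1.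
Qed.

Definition le_nat3 (P : R -> R -> R -> Prop) (x y z : C) :=
  exists a b c : nat, [/\ P a%:R b%:R c%:R, x = a%:R, y = b%:R & z = c%:R].

(** Sizes [n], [N], [g] of a set, a set of characters, and the group; [1 <= g]
    records that a group is not empty. *)
Definition dual_le : C -> C -> C -> Prop := le_nat3 (fun n N g => N * n <= 4 * g /\ 1 <= g).
Definition dual_ge c : C -> C -> C -> Prop := le_nat3 (fun n N g => g <= c * (n * N) /\ 1 <= g).

Lemma list_of_homs (G p : V) (gT : finZmodType) (v : gT -> V) (Gam : V) N :
  presents G p v -> (forall c, eps c Gam -> is_hom Circ mulG G p c) ->
  hascard (elems Gam) N ->
  exists2 L : seq {ffun gT -> C}, uniq L /\ size L = N &
    forall f, f \in L -> is_char f /\ exists2 c, eps c Gam & codes v c f.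
Proof.
move=> pr hom [s [us <- Gs]].
have dec c : exists f, eps c Gam -> is_char f /\ codes v c f.
  case: (EM (eps c Gam)) => [/hom/(hom_codes pr)[f cf fc]|nc]; first by exists f.
  by exists [ffun=> 0] => /nc.
have /choice[f fP] := dec.
have inS c : c \in s -> eps c Gam by move=> cs; apply/Gs.
exists (map f s); first split.
- rewrite map_inj_in_uniq // => c c' /inS cG /inS cG' e.
  apply: (codes_inj pr (hom _ cG) (hom _ cG') (f := f c)); first by case: (fP c cG).
  by rewrite e; case: (fP c' cG').
- by rewrite size_map.
- by move=> _ /mapP[c /inS cG ->]; have [cf cc] := fP c cG; split=> //; exists c.
Qed.

(** Distinct characters have distinct codes. *)
Lemma size_le_hascard (G p : V) (gT : finZmodType) (v : gT -> V) (Gam : V) N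
    (L : seq {ffun gT -> C}) : presents G p v -> hascard (elems Gam) N -> uniq L ->
  (forall f, f \in L -> exists2 c, eps c Gam & codes v c f) -> (size L <= N)%N.
Proof.
move=> pr [s [us <- Gs]] uL LG.
have dec f : exists c, f \in L -> eps c Gam /\ codes v c f.
  case: (boolP (f \in L)) => [/LG[c cG cc]|_]; first by exists c.
  by exists point.
have /choice[c cP] := dec.
rewrite -(size_map c); apply: uniq_leq_size.
  rewrite map_inj_in_uniq // => f f' fL fL' e; apply/ffunP => a.
  have [_ h] := cP f fL; have [_ h'] := cP f' fL'.
  have /h' : pair_in (c f') (v a) (cplx V (f a)) by rewrite -e; apply/h.
  exact: cplx_inj.
by move=> _ /mapP[f fL ->]; apply/Gs; case: (cP f fL).
Qed.

Lemma bohr_upper_std m G p D Gam n N g :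
  bohr_upper_stmt Circ mulG (cset V (near 4^-1)) (card_rel V m) (crel V dual_le) G p D Gam n N g.
Proof.
move=> grp /pair_in_card[Gm nG [g0 Gg ->]] /pair_in_card[Dm nD [n0 Dn ->]].
move=> /pair_in_card[Gamm nGam [N0 GN ->]] DG hom.
have [gT [v [pr g0E]]] := exists_presents grp Gg.
have [L [uL sL] LP] := list_of_homs pr (fun c h => (hom c h).1) GN.
apply/triple_in_crel; exists n0%:R, N0%:R, g0%:R; split=> //.
exists n0, N0, g0; split=> //; split; last by rewrite g0E ler1n card_group_gt0.
rewrite -natrM -sL g0E (hascard_uniq Dn (hascard_part pr DG)).
apply: few_near_chars => // f; first by move=> /LP[].
move=> a /LP[_ [c cG cc]] aD.
have [_ /(codes_values pr _ cc DG)/(_ a aD)] := hom c cG.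
by case/nearP.
Qed.

Lemma bohr_lower_std k m s q G p D B X Y E Gam n N g t : 0 < s -> 0 < q ->
  bohr_lower_stmt k Circ mulG (cset V (near 4^-1)) (card_rel V m.+4)
    (crel V (dual_ge (2 * s ^+ 2 * (1089 ^ k)%:R))) (lev V m.+3) (lev V m)
    (card_le V m.+4 q) (card_le V m.+4 (q / (1 + (128 * s)^-1))) (card_le V m.+4 (s ^+ 2))
    G p D B X Y E Gam n N g t.
Proof.
move=> s_gt0 q_gt0 grp /pair_in_card[Gm4 nG [g0 Gg ->]] /pair_in_card[Dm nD [n0 Dn ->]].
move=> /pair_in_card[Gamm nGam [N0 GN ->]] /mem_lev Gm BG YG EG [d0 [d0D d0X]] DY XY XBY XDE.
move=> /pair_in_card_le[y [d [_ Yy Dd leY]]] leX /pair_in_card_le[e' [d' [_ Ee Dd' leE]]] Dt homs.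
have [gT [v [pr g0E]]] := exists_presents grp Gg.
have XG : elems X `<=` elems G by move=> x /XY/YG.
have DG : elems D `<=` elems G by move=> x /DY/YG.
have cX := hascard_part pr XG; have cD := hascard_part pr DG.
have cY := hascard_part pr YG; have cE := hascard_part pr EG.
move: leY; rewrite (hascard_uniq Yy cY) (hascard_uniq Dd cD) => leY.
move: leE; rewrite (hascard_uniq Ee cE) (hascard_uniq Dd' cD) => leE.
have Xm : level m.+4 X.
  by apply: (rank_sub Gm4 nG) => //; apply: inhabited_not_indiv; exists d0.
have {}leX : q / (1 + (128 * s)^-1) * #|part v D|%:R < #|part v X|%:R.
  rewrite ltNge; apply/negP => h; apply: leX; apply/pair_in_card_le.
  by exists #|part v X|, #|part v D|.
have [a0 a0E] : exists a, v a = d0 by apply/(pres_mem pr)/DG.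
have X0 : part v X != finset.set0.
  by apply/set0Pn; exists a0; apply/mem_part; rewrite a0E.
have D0 : part v D != finset.set0.
  by apply/set0Pn; exists a0; apply/mem_part; rewrite a0E.
have t0P (i : 'I_k) : exists a, eps (t i) G -> v a = t i.
  case: (EM (eps (t i) G)) => [/(pres_mem pr)[a ?]|?]; last by exists 0.
  by exists a.
have /choice[t0 {}t0P] := t0P.
have vG := pres_in pr; have addE := pres_addE pr.
have [L [uL sL] LP] : exists2 L : seq {ffun gT -> C},
    uniq L /\ #|gT|%:R <= 2 * s ^+ 2 * (1089 ^ k)%:R * (#|part v D|%:R * (size L)%:R) &
    forall f, f \in L -> is_char f /\
      forall d, d \in part v D -> normc (f d - 1) < 4^-1.
  apply: (many_near_chars (X := part v X) (Y := part v Y) (E := part v E) (B := part v B)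
    (t := t0) s_gt0 X0 D0).
  - by apply/fintype.subsetP => a /mem_part/XY ?; apply/mem_part.
  - move=> x b /mem_part xX /mem_part bB; apply/mem_part.
    by have [z [zY /(pres_add pr _ _ (YG _ zY)) <-]] := XBY _ xX _ bB.
  - move=> x a /mem_part xX /mem_part aD; apply/mem_part.
    have [z [zE]] := XDE _ xX _ aD; have /(pres_mem pr)[b bz] := EG _ zE.
    by rewrite -bz in zE * => /addE->; rewrite addrK.
  - have u_gt0 : 0 < 1 + (128 * s)^-1 by rewrite addr_gt0 // invr_gt0 mulr_gt0.
    apply: le_trans leY _; move: leX; rewrite mulrAC ltr_pdivrMr // mulrC.
    by rewrite [#|part v X|%:R * _]mulrC mulrC => /ltW.
  - by [].
  - move=> a /mem_part/Dt[i [ik [tG [b [bB tbd]]]]]; exists (Ordinal ik).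
    have /(pres_mem pr)[b0 b0E] := BG _ bB; exists b0; first by apply/mem_part; rewrite b0E.
    by apply/addE; rewrite t0P // b0E.
apply/triple_in_crel; exists n0%:R, N0%:R, g0%:R; split=> //.
exists n0, N0, g0; split=> //; split; last by rewrite g0E ler1n card_group_gt0.
rewrite g0E (hascard_uniq Dn cD); apply: le_trans sL _.
apply: ler_wpM2l; first by have s_ge0 := ltW s_gt0; rewrite !mulr_ge0.
apply: ler_wpM2l => //; rewrite ler_nat.
apply: (size_le_hascard pr GN uL) => f /LP[cf fD].
have [c [cm hc cc]] := char_coded pr Gm cf; exists c => //.
apply: homs => //; first exact/mem_lev.
apply/(codes_values pr _ cc DG) => a /fD ?; apply/nearP; split=> //; exact: normc_char.
Qed.

Lemma cover_std k m G p A D g t :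
  cover_stmt k (card_rel V m) (card_le V m k%:R) G p A D g t.
Proof.
move=> grp /pair_in_card[Gm nG [g0 Gg _]] AG DG [a0 [a0A _]] [d0 [d0D _]] At.
have [gT [v [pr g0E]]] := exists_presents grp Gg.
have vG := pres_in pr; have addE := pres_addE pr.
apply/pair_in_card_le; exists #|part v A|, #|part v D|; split.
- by split; apply: (rank_sub Gm nG) => //; apply: inhabited_not_indiv; [exists a0|exists d0].
- exact: (hascard_part pr AG).
- exact: (hascard_part pr DG).
have t0P (i : 'I_k) : exists a, eps (t i) G -> v a = t i.
  case: (EM (eps (t i) G)) => [/(pres_mem pr)[a ?]|?]; last by exists 0.
  by exists a.
have /choice[t0 {}t0P] := t0P.
pose F (i : 'I_k) := [set t0 i + b | b in part v D]%SET.
have sub : part v A \subset (\bigcup_(i < k) F i)%SET.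
  apply/fintype.subsetP => a /mem_part/At[i [ik [tG [b [bD tba]]]]].
  have /(pres_mem pr)[b0 b0E] := DG _ bD.
  apply/finset.bigcupP; exists (Ordinal ik) => //; apply/imsetP; exists b0.
    by apply/mem_part; rewrite b0E.
  by apply/addE; rewrite t0P // b0E.
rewrite -natrM ler_nat; apply: leq_trans (subset_leq_card sub) _.
have le_sum : (#|(\bigcup_(i < k) F i)%SET| <=
    \sum_(i < k) #|F i|)%N.
  elim/big_rec2: _ => [|i a b _ h]; first by rewrite cards0.
  by apply: leq_trans (leq_card_setU _ _) _; rewrite leq_add2l.
apply: leq_trans le_sum _; rewrite -[X in (_ <= X * _)%N]card_ord -sum_nat_const.
by apply: leq_sum => i _; apply: leq_imset_card.
Qed.

Lemma card_le_ge1 m q A D x : q < 1 -> eps x D -> elems D `<=` elems A ->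
  ~ pair_in (card_le V m q) A D.
Proof.
move=> q1 xD DA /pair_in_card_le[a [d [_ [s [us <- As]] [u [uu <- Du]] le_ad]]].
have sub : (size u <= size s)%N.
  by apply: uniq_leq_size => // y yu; apply/As/DA/Du.
have u_gt0 : (0 < size u)%N by case: (u) (iffLR (Du x) xD).
have : (size u)%:R <= q * (size u)%:R :> R by apply: le_trans le_ad; rewrite ler_nat.
by apply/negP; rewrite -ltNge gtr_pMl // ltr0n.
Qed.

Lemma card_exists m (G g A : V) : pair_in (card_rel V m) G g -> elems A `<=` elems G ->
  ~ indiv V A -> exists n, eps n (nat_set V) /\ pair_in (card_rel V m) A n.
Proof.
move=> /pair_in_card[Gm nG [_ [s [us _ Gs]] _]] AG nA.
have [n An] : exists n, hascard (elems A) n.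
  by apply: (@hascard_sub _ _ s) => x /AG/Gs.
exists (cplx V n%:R); split; first by apply/mem_nat; exists n.
by apply/pair_in_card; split; [exact: rank_sub AG| |exists n].
Qed.

Lemma card_homs_exists m G p g Gam : is_abgroup G p -> pair_in (card_rel V m) G g -> level m G ->
  (forall c, eps c Gam -> is_hom Circ mulG G p c) -> ~ indiv V Gam ->
  exists n, eps n (nat_set V) /\ pair_in (card_rel V m.+4) Gam n.
Proof.
move=> grp /pair_in_card[_ nG [g0 Gg _]] Gm hom nGam.
have [gT [v [pr g0E]]] := exists_presents grp Gg.
have codeP (f : {ffun gT -> C}) : exists c, is_char f -> is_hom Circ mulG G p c /\ codes v c f.
  case: (EM (is_char f)) => [cf|nf]; last by exists point.
  by have [c [_ hc cc]] := char_coded pr Gm cf; exists c.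
have /choice[code {}codeP] := codeP.
have [n An] : exists n, hascard (elems Gam) n.
  apply: (@hascard_sub _ _ (map code (chars R gT))) => c /hom hc.
  have [f cf cc] := hom_codes pr hc; have [hf cf'] := codeP f cf.
  by apply/mapP; exists f; [apply/mem_chars|apply: (codes_inj pr hc hf cc cf')].
exists (cplx V n%:R); split; first by apply/mem_nat; exists n.
apply/pair_in_card; split=> //; last by exists n.
by right; split=> // c /hom/(hom_rank pr Gm).
Qed.

End StandardTheorems.

(** * Internal cardinality *)

Section CountingBijections.
Variable M : eps_structure.
Implicit Types Nat Lt One A n m f : M.

(** Mirrors the definition of [has_icard], with [f] a parameter so that all
    quantifiers are bounded. *)
Definition in_segment Lt One n m :=
  (pair_in Lt One m \/ One = m) /\ (pair_in Lt m n \/ m = n).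

Definition counts Nat Lt One A n f :=
  (forall q, eps q f -> exists a, eps a A /\ exists m, eps m Nat /\
     (in_segment Lt One n m /\ is_opair q a m)) /\
  ((forall a, eps a A -> exists m, eps m Nat /\ (in_segment Lt One n m /\
     (pair_in f a m /\ forall m', eps m' Nat -> pair_in f a m' -> m' = m))) /\
   forall m, eps m Nat -> in_segment Lt One n m -> exists a, eps a A /\
     (pair_in f a m /\ forall a', eps a' A -> pair_in f a' m -> a' = a)).

End CountingBijections.

#[local] Hint Unfold in_segment counts : coded.

Section StandardCounting.
Variables (R : realType) (V : superstructure R).
Local Notation level := (rank_level (indiv V)).
Local Notation counts := (counts (nat_set V) (lt_graph V) (cplx V 1)).

Lemma cplx_nat_inj (k l : nat) : cplx V k%:R = cplx V l%:R -> k = l.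
Proof. by move=> /cplx_inj/eqP; rewrite eqr_nat => /eqP. Qed.

Lemma pair_in_lt_nat (k l : nat) : pair_in (lt_graph V) (cplx V k%:R) (cplx V l%:R) <-> (k < l)%N.
Proof.
rewrite pair_in_lt; split=> [[a [b [ab /cplx_inj ka /cplx_inj lb]]]|kl].
  rewrite -!(rmorph_nat (real_complex R)) in ka lb.
  by move: ab; rewrite -(complexI ka) -(complexI lb) ltr_nat.
by exists k%:R, l%:R; split; rewrite ?ltr_nat // rmorph_nat.
Qed.

Lemma in_segment_nat (k n : nat) :
  in_segment (lt_graph V) (cplx V 1) (cplx V n%:R) (cplx V k%:R) <-> (0 < k <= n)%N.
Proof.
have -> : cplx V 1 = cplx V 1%N%:R by [].
rewrite /in_segment !pair_in_lt_nat; split.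
  move=> [h1 h2]; apply/andP; split.
    by case: h1 => [/ltnW//|/cplx_nat_inj<-].
  by case: h2 => [/ltnW//|/cplx_nat_inj->].
move=> /andP[k0 kn]; split.
  by move: k0; rewrite leq_eqVlt => /orP[/eqP->|->]; [right|left].
by move: kn; rewrite leq_eqVlt => /orP[/eqP->|->]; [right|left].
Qed.

Lemma counts_hascard (A x f : V) : eps x (nat_set V) -> counts A x f ->
  exists2 n, hascard (elems A) n & x = cplx V n%:R.
Proof.
move=> /mem_nat[n ->] [fE [fF fB]]; exists n => //.
have segP k : exists a, (k < n)%N -> [/\ eps a A, pair_in f a (cplx V k.+1%:R) &
    forall a', eps a' A -> pair_in f a' (cplx V k.+1%:R) -> a' = a].
  case: (ltnP k n) => kn; last by exists point.
  have [|a [aA [ak aU]]] := fB (cplx V k.+1%:R) _ (iffRL (in_segment_nat k.+1 n) kn).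
    by apply/mem_nat; exists k.+1.
  by exists a.
have /choice[a aP] := segP.
exists (map a (iota 0 n)); split; last 1 first.
- move=> x0; split=> [x0A|/mapP[k]]; last first.
    by rewrite mem_iota /= => /aP[kA _ _] ->.
  have [_ [/mem_nat[[|k] ->] [/in_segment_nat //= kn [x0k _]]]] := fF x0 x0A.
  apply/mapP; exists k; first by rewrite mem_iota.
  by have [_ _ aU] := aP k kn; apply: aU.
- rewrite map_inj_in_uniq ?iota_uniq // => k l; rewrite !mem_iota /= => kn ln akl.
  have [kA ak _] := aP k kn; have [_ al _] := aP l ln.
  have [y [_ [_ [_ yU]]]] := fF _ kA; rewrite akl in ak yU.
  have memn (i : nat) : eps (cplx V i%:R) (nat_set V) by apply/mem_nat; exists i.
  have := yU _ (memn k.+1) ak; rewrite -(yU _ (memn l.+1) al) => /cplx_nat_inj[].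
  by [].
- by rewrite size_map size_iota.
Qed.

Lemma hascard_counts m (A : V) n : level m A -> ~ indiv V A -> hascard (elems A) n ->
  exists f, [/\ level m.+3 f, ~ indiv V f & counts A (cplx V n%:R) f].
Proof.
move=> Am nA [s [us sn As]]; have inj := opair_inj (pairing_std V).
pose P := [set q | exists2 a, eps a A & q = opair a (cplx V (index a s).+1%:R)].
have Pm : P `<=` level m.+2.
  apply: rank_pairs => q [a aA ->]; exists a, (cplx V (index a s).+1%:R); split=> //.
    by apply: rank_le (rank_elems Am nA aA); apply: leq_pred.
  exact: rank_cplx.
have fP a x : pair_in (sset P) a x <-> eps a A /\ x = cplx V (index a s).+1%:R.
  rewrite (pair_inP (pairing_std V)) (mem_sset _ Pm); split=> [[b bA /inj[-> ->]]|[aA ->]] //.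
  by exists a.
have memn (i : nat) : eps (cplx V i%:R) (nat_set V) by apply/mem_nat; exists i.
have seg a : eps a A -> in_segment (lt_graph V) (cplx V 1) (cplx V n%:R) (cplx V (index a s).+1%:R).
  by move=> /As aS; apply/in_segment_nat; rewrite -sn index_mem.
exists (sset P); split; [exact: rank_sset|by case: (ssetP Pm)|split; [|split]].
- move=> q /(mem_sset _ Pm)[a aA ->]; exists a; split=> //.
  exists (cplx V (index a s).+1%:R); split=> //; split; first exact: seg.
  exact/(is_opairP (pairing_std V)).
- move=> a aA; exists (cplx V (index a s).+1%:R); split=> //; split; first exact: seg.
  by split; [apply/fP|move=> y _ /fP[_ ->]].
move=> _ /mem_nat[[|k] ->] /in_segment_nat //= kn.
have ks : (k < size s)%N by rewrite sn.
exists (nth point s k); split; first by apply/As/mem_nth.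
split; first by apply/fP; rewrite index_uniq //; split=> //; apply/As/mem_nth.
by move=> a' a'A /fP[_ /cplx_nat_inj[->]]; rewrite nth_index //; apply/As.
Qed.

End StandardCounting.

Section InternalCardinality.
Variables (R : realType) (V : superstructure R) (K : Type).
Variable W : nonstandard_universe V K.

Local Notation hlev n := (star W (lev V n)).
Local Notation hcard m := (pair_in (star W (card_rel V m))).

Lemma counts_int (A n f : W) : internal_set f -> hnat n ->
  counts (star W (nat_set V)) (star W (lt_graph V)) (hstd W 1) A n f <->
  let I := [set m | [/\ hnat m, hle (hstd W 1) m & hle m n]] in
    internal_fun f (elems A) I /\
    forall m, I m -> exists! a, eps a A /\ eps (opair a m) f.
Proof.
move=> intf nN /=; have seg m : in_segment (star W (lt_graph V)) (hstd W 1) n m <->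
    hle (hstd W 1) m /\ hle m n by rewrite /in_segment /hle !hltP.
have r1 := pair_inP (pairing_int W); have op := is_opairP (pairing_int W).
have inj := opair_inj (pairing_int W).
split.
  move=> [fE [fF fB]].
  have img a m : eps (opair a m) f -> [/\ hnat m, hle (hstd W 1) m & hle m n].
    by move=> /fE[a' [_ [m' [m'N [/seg[h1 h2] /op/inj[_ ->]]]]]].
  split; first split=> //.
  - move=> q /fE[a [aA [m [mN [/seg[h1 h2] /op->]]]]]; exists a, m; split=> //.
  - move=> a /fF[m [mN [/seg[h1 h2] [/r1 am mU]]]]; exists m; split=> // m' am'.
    by apply/esym/mU; [case: (img _ _ am')|apply/r1].
  move=> m [mN h1 h2]; have [a [aA [/r1 am aU]]] := fB m mN (iffRL (seg m) (conj h1 h2)).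
  by exists a; split=> // a' [a'A a'm]; apply/esym/aU => //; apply/r1.
move=> [[_ fE fF] fB]; split; [|split].
- move=> q /fE[a [m [aA [mN h1 h2] ->]]]; exists a; split=> //; exists m; split=> //.
  by split; [apply/seg|apply/op].
- move=> a /fF[m [am mU]]; have [a' [m' [_ [mN h1 h2] /inj[_ mm']]]] := fE _ am.
  rewrite -mm' in mN h1 h2; exists m; split=> //; split; first exact/seg.
  by split; [apply/r1|move=> m1 _ /r1/mU].
move=> m mN /seg[h1 h2]; have [|a [[aA am] aU]] := fB m; first by [].
by exists a; split=> //; split; [apply/r1|move=> a' a'A /r1 a'm; apply/esym/aU].
Qed.

Lemma has_icard_hcard m (A n : W) : eps A (hlev m) -> internal_set A -> has_icard A n -> hcard m A n.
Proof.
move=> Am iA [nN [f fP]]; have intf : internal_set f by case: fP => -[].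
have cf := iffRL (counts_int A intf nN) fP.
have : eps A (hlev m) -> ~ eps A (star W (indiv_set V)) -> eps n (star W (nat_set V)) ->
    counts (star W (nat_set V)) (star W (lt_graph V)) (star W (cplx V 1)) A n f -> hcard m A n.
  apply: (@transferE _ _ _ W [:: lev V m; indiv_set V; nat_set V; lt_graph V; cplx V 1; card_rel V m]
    (fun M e => eps (e 6%N) (e 0%N) -> ~ eps (e 6%N) (e 1%N) -> eps (e 7%N) (e 2%N) ->
      counts (e 2%N) (e 3%N) (e 4%N) (e 6%N) (e 7%N) (e 8%N) -> pair_in (e 5%N) (e 6%N) (e 7%N))
    isT _ _ [:: A; n; f] [::]); first by definable_by.
  move=> e /mem_lev Am' /mem_indiv_set nA nN' /(counts_hascard nN')[k Ak ->].
  by apply/pair_in_card; split=> //; exists k.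
exact.
Qed.

Lemma hcard_has_icard m (A n : W) : hcard m A n -> has_icard A n.
Proof.
move=> An.
have : hcard m A n -> eps n (star W (nat_set V)) /\ exists f, eps f (hlev m.+3) /\
    (~ eps f (star W (indiv_set V)) /\
    counts (star W (nat_set V)) (star W (lt_graph V)) (star W (cplx V 1)) A n f).
  apply: (@transferE _ _ _ W [:: lev V m.+3; indiv_set V; nat_set V; lt_graph V; cplx V 1; card_rel V m]
    (fun M e => pair_in (e 5%N) (e 6%N) (e 7%N) -> eps (e 7%N) (e 2%N) /\
      exists f, eps f (e 0%N) /\ (~ eps f (e 1%N) /\
      counts (e 2%N) (e 3%N) (e 4%N) (e 6%N) (e 7%N) f))
    isT _ _ [:: A; n] [::]); first by definable_by.
  move=> e /pair_in_card[Am nA [k Ak ->]]; split; first by apply/mem_nat; exists k.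
  have [f [fm nf fP]] := hascard_counts Am nA Ak.
  by exists f; split; [apply/mem_lev|split=> //; rewrite mem_indiv_set].
move=> /(_ An)[nN [f [_ [intf cf]]]]; split=> //; exists f.
exact/(counts_int A intf nN).
Qed.

Lemma hcard_inj m (A n n' : W) : hcard m A n -> hcard m A n' -> n = n'.
Proof.
apply: (@transferE _ _ _ W [:: card_rel V m] (fun M e => pair_in (e 0%N) (e 1%N) (e 2%N) ->
  pair_in (e 0%N) (e 1%N) (e 3%N) -> e 2%N = e 3%N) isT _ _ [:: A; n; n'] [::]).
  by definable_by.
move=> e /pair_in_card[_ _ [k Ak ->]] /pair_in_card[_ _ [l Al ->]].
by rewrite (hascard_uniq Ak Al).
Qed.

Lemma hcard_level m (A n : W) : hcard m A n ->
  eps A (hlev m) /\ (internal_set A /\ hnat n).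
Proof.
apply: (@transferE _ _ _ W [:: card_rel V m; lev V m; indiv_set V; nat_set V]
  (fun M e => pair_in (e 0%N) (e 4%N) (e 5%N) ->
  eps (e 4%N) (e 1%N) /\ (~ eps (e 4%N) (e 2%N) /\ eps (e 5%N) (e 3%N))) isT _ _ [:: A; n] [::]).
  by definable_by.
move=> e /pair_in_card[Am nA [k Ak ->]]; rewrite mem_indiv_set mem_lev mem_nat.
by split=> //; split=> //; exists k.
Qed.

Lemma icardE m (A n : W) : hcard m A n -> icard A = n.
Proof.
move=> An; have [Am [iA _]] := hcard_level An.
have h : has_icard A (icard A) := @getI _ [set n | has_icard A n] n (hcard_has_icard An).
exact: hcard_inj (has_icard_hcard Am iA h) An.
Qed.

End InternalCardinality.

(** * Saturation and the internal group *)

Section Saturation.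
Variables (R : realType) (V : superstructure R) (K : Type).
Variable W : nonstandard_universe V K.

Lemma card_lt_image (P : W -> W) (F : set W) : card_lt F [set: K] -> card_lt (P @` F) [set: K].
Proof.
move=> [FK nKF]; have PF := card_image_le P F.
split; first exact: card_le_trans PF FK.
by move=> KP; apply: nKF; apply: card_le_trans KP PF.
Qed.

(** An internal [X] disjoint from [S * S] is already disjoint from [B * B] for a
    finite intersection [B] of the internal sets defining [S].  Products are what
    sums of two elements of a subgroup require. *)
Lemma monadic_pairs (S : set W) (X : W) : monadic S ->
  (forall a b, S a -> S b -> ~ eps (opair a b) X) ->
  exists s : seq W, (forall A, A \in s -> S `<=` elems A) /\
    forall a b, (forall A, A \in s -> eps a A /\ eps b A) -> ~ eps (opair a b) X.
Proof.
move=> [F [FK iF SF]] SX.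
have SA A : F A -> S `<=` elems A by move=> FA x; rewrite SF; apply.
have op := is_opairP (pairing_int W); have inj := opair_inj (pairing_int W).
apply: contrapT => noS.
have [F0|[A0 FA0]] : F = set0 \/ F !=set0.
  by case: (EM (F !=set0)) => [|/set0P/negP]; [right|rewrite negbK => /eqP; left].
  apply: noS; exists [::]; split=> // a b _; apply: SX; by rewrite SF F0 bigcap_set0.
have PP A : exists Y, forall q, eps q Y <-> eps q X /\
    exists a, eps a A /\ exists b, eps b A /\ is_opair q a b.
  have [Y _ YP] := subset_int X (P := fun M e => exists a, eps a (e 2%N) /\
    exists b, eps b (e 2%N) /\ is_opair (e 0%N) a b) [:: A] [::]
    ltac:(definable_by).
  by exists Y.
have /choice[P {}PP] := PP.
have [|w wP] := @ns_saturated _ _ _ W (P @` F) (card_lt_image P FK).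
  move=> s sP.
  have pre A : exists B, A \in s -> F B /\ P B = A.
    case: (boolP (A \in s)) => [/sP[B FB BA]|_]; first by exists B.
    by exists point.
  have /choice[r rP] := pre.
  have [[a b] abP] : exists ab : W * W, (forall A, A \in map r s -> eps ab.1 A /\ eps ab.2 A) /\
      eps (opair ab.1 ab.2) X.
    apply: contrapT => noab; apply: noS; exists (map r s); split.
      by move=> _ /mapP[A /rP[FrA _] ->]; apply: SA.
    by move=> a b abA abX; apply: noab; exists (a, b).
  case: abP => /= abA abX; exists (opair a b) => A As; have [_ <-] := rP A As.
  have [aA bA] := abA (r A) (map_f r As).
  by apply/PP; split=> //; exists a; split=> //; exists b; split=> //; apply/op.
have wA A : F A -> eps w (P A) by move=> FA; apply: wP; exists A.
have /PP[wX [a [_ [b [_ /op wE]]]]] := wA _ FA0.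
apply: (SX a b); last by rewrite -wE.
- rewrite SF => A /wA/PP[_ [a' [a'A [b' [_ /op]]]]].
  by rewrite wE => /inj[-> _].
- rewrite SF => A /wA/PP[_ [a' [_ [b' [b'A /op]]]]].
  by rewrite wE => /inj[_ ->].
Qed.

Lemma internal_meet (D : W) (s : seq W) : exists2 B : W, internal_set B \/ B = D &
  forall x, eps x B <-> eps x D /\ forall A, A \in s -> eps x A.
Proof.
elim: s => [|A s [B _ BP]]; first by exists D; [right|move=> x; split=> // -[]].
have [Y iY YP] := subset_int B (P := fun M e => eps (e 0%N) (e 2%N)) [:: A] [::] (definable_mem 0 2).
exists Y; [by left|move=> x; rewrite YP BP; split].
  move=> [[xD xs] xA]; split=> // A'; rewrite inE => /orP[/eqP->//|]; exact: xs.
move=> [xD xs]; split; last exact: (xs A (mem_head _ _)).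
by split=> // A' A's; apply: xs; rewrite inE A's orbT.
Qed.

End Saturation.

Lemma unbounded_pow (R : realType) (r y : R) : 1 < r -> exists n, y < r ^+ n.
Proof.
move=> r1; have bern n : 1 + n%:R * (r - 1) <= r ^+ n.
  elim: n => [|n IH]; first by rewrite mul0r addr0 expr0.
  rewrite exprS -natr1; have := ler_wpM2l (ltW (lt_trans ltr01 r1)) IH.
  have : 0 <= n%:R * ((r - 1) * (r - 1)) by rewrite mulr_ge0 // -expr2 sqr_ge0.
  by nra.
have d0 : 0 < r - 1 by rewrite subr_gt0.
exists (Num.bound `|y / (r - 1)|); apply: lt_le_trans (bern _).
have := le_lt_trans (ler_norm _) (archi_boundP (normr_ge0 (y / (r - 1)))).
by rewrite ltr_pdivrMr // => h; apply: lt_trans h _; rewrite ltrDr.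
Qed.

(** Otherwise [Q] would hold at [q0 / r ^ n] for all [n], and these tend to 0. *)
Lemma last_ratio (R : realType) (Q : R -> Prop) (q0 r : R) : 1 < r -> 0 < q0 -> Q q0 ->
  (forall q, Q q -> 1 <= q) -> exists q, [/\ 0 < q, Q q & ~ Q (q / r)].
Proof.
move=> r1 q0_gt0 Qq0 Q1; apply: contrapT => no.
have r_gt0 : 0 < r by apply: lt_trans r1.
have Qn n : Q (q0 / r ^+ n).
  elim: n => [|n IH]; first by rewrite expr0 divr1.
  apply: contrapT => nQ; apply: no; exists (q0 / r ^+ n); split=> //.
    by rewrite divr_gt0 // exprn_gt0.
  by rewrite -mulrA -invfM -exprSr.
have [n qn] := unbounded_pow q0 r1.
have := Q1 _ (Qn n); apply/negP; rewrite -ltNge ltr_pdivrMr ?exprn_gt0 //.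
by rewrite mul1r.
Qed.

Section InternalGroup.
Variables (R : realType) (V : superstructure R) (K : Type).
Variable W : nonstandard_universe V K.
Variable T : triplet W.
Hypothesis T_img : img_triplet T.

Local Notation hlev n := (star W (lev V n)).
Local Notation hcard m := (pair_in (star W (card_rel V m))).
Local Notation G := (amb T).
Local Notation p := (plus T).
Local Notation Circ := (star W (circle_set V)).
Local Notation mulG := (star W (graph2 V (fun u v => u * v))).
Local Notation "a +: b" := (gadd T a b) (at level 50, left associativity).

Lemma abelian_T : abelian_ambient T. Proof. by case: T_img. Qed.

Lemma gaddP a b : eps a G -> eps b G ->
  eps (a +: b) G /\ forall c, triple_in p a b c <-> c = a +: b.
Proof.
move=> aG bG; have [opP _ _ _ _] := abelian_T.
have [] := internal_funP opP (a := opair a b); first by exists a, b.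
by move=> cG cP; split=> // c; rewrite (triple_inP (pairing_int W)) cP.
Qed.

Lemma gadd_in a b : eps a G -> eps b G -> eps (a +: b) G.
Proof. by move=> aG bG; case: (gaddP aG bG). Qed.

Lemma triple_in_gadd a b c : eps a G -> eps b G -> triple_in p a b c <-> c = a +: b.
Proof. by move=> aG bG; case: (gaddP aG bG). Qed.

Lemma gaddA a b c : eps a G -> eps b G -> eps c G -> a +: (b +: c) = a +: b +: c.
Proof. by have [_ h _ _ _] := abelian_T; apply: h. Qed.

Lemma gaddC a b : eps a G -> eps b G -> a +: b = b +: a.
Proof. by have [_ _ h _ _] := abelian_T; apply: h. Qed.

Lemma gzeroP : eps (gzero T) G /\ forall a, eps a G -> a +: gzero T = a.
Proof.
have [_ _ _ [z zG zP] _] := abelian_T.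
exact: (@getI _ [set z | eps z G /\ forall a, eps a G -> a +: z = a] z (conj zG zP)).
Qed.

Lemma gzero_in : eps (gzero T) G. Proof. by case: gzeroP. Qed.

Lemma gadd0 a : eps a G -> a +: gzero T = a. Proof. by case: gzeroP => _; apply. Qed.

Lemma goppP a : eps a G -> eps (gopp T a) G /\ a +: gopp T a = gzero T.
Proof.
have [_ _ _ _ h] := abelian_T; move=> /h[b bG ab].
exact: (@getI _ [set b | eps b G /\ a +: b = gzero T] b (conj bG ab)).
Qed.

Lemma gopp_in a : eps a G -> eps (gopp T a) G. Proof. by move=> /goppP[]. Qed.

Lemma gaddN a : eps a G -> a +: gopp T a = gzero T. Proof. by move=> /goppP[]. Qed.

Lemma gaddK a b : eps a G -> eps b G -> a +: b +: gopp T b = a.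
Proof. by move=> aG bG; have bG' := gopp_in bG; rewrite -gaddA // gaddN // gadd0. Qed.

Lemma gsubK a b : eps a G -> eps b G -> a +: gopp T b +: b = a.
Proof.
move=> aG bG; have bG' := gopp_in bG.
by rewrite -gaddA // [gopp T b +: b]gaddC // gaddN // gadd0.
Qed.

Lemma gopp_uniq a b : eps a G -> eps b G -> a +: b = gzero T -> b = gopp T a.
Proof.
move=> aG bG ab; rewrite -[LHS](gaddK bG aG) [b +: a]gaddC // ab.
have [zG aG'] := (gzero_in, gopp_in aG).
by rewrite gaddC // gadd0.
Qed.

Lemma goppK a : eps a G -> gopp T (gopp T a) = a.
Proof.
move=> aG; have aG' := gopp_in aG; apply/esym/gopp_uniq => //.
by rewrite gaddC // gaddN.
Qed.

Lemma is_abgroup_T : is_abgroup G p.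
Proof.
split; [|split; [|split]].
- move=> a aG b bG; have [cG cP] := gaddP aG bG.
  by exists (a +: b); split=> //; split=> [|c _ /cP]; [apply/cP|].
- move=> a aG b bG c cG x xG y yG z zG w wG.
  rewrite !triple_in_gadd // => -> -> -> ->; exact: gaddA.
- by move=> a aG b bG c cG; rewrite !triple_in_gadd // => ->; apply: gaddC.
exists (gzero T); split; first exact: gzero_in; split.
  by move=> a aG; apply/triple_in_gadd => //; [exact: gzero_in|rewrite gadd0].
move=> a aG; exists (gopp T a); split; first exact: gopp_in.
by apply/triple_in_gadd => //; [exact: gopp_in|rewrite gaddN].
Qed.

Lemma is_fun_int f (A B : W) : internal_set f ->
  is_fun f A B <-> internal_fun f (elems A) (elems B).
Proof.
move=> intf; have r1 := pair_inP (pairing_int W); have op := is_opairP (pairing_int W).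
have inj := opair_inj (pairing_int W); split.
  move=> [fE fF]; split=> //.
    by move=> q /fE[a [aA [b [bB /op->]]]]; exists a, b.
  move=> a aA; have [b [bB [/r1 ab bU]]] := fF a aA; exists b; split=> // b' ab'.
  have [_ [_ [b1 [b1B /op/inj[_ e]]]]] := fE _ ab'.
  by apply/esym/bU; [rewrite e|apply/r1].
move=> [_ fE fF]; split.
  move=> q /fE[a [b [aA bB ->]]]; exists a; split=> //; exists b; split=> //; exact/op.
move=> a aA; have [b [ab bU]] := fF a aA; have [a' [b' [_ b'B /inj[_ e]]]] := fE _ ab.
exists b; split; first by rewrite e.
by split; [apply/r1|move=> b1 _ /r1/bU].
Qed.

Lemma ihomP g : ihom T g <-> is_hom Circ mulG G p g.
Proof.
have r1 := pair_inP (pairing_int W).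
split.
  move=> [gF gM]; split; first by apply/is_fun_int => //; case: gF.
  move=> a aG b bG c cG /(triple_in_gadd _ aG bG) -> x xC y yC z zC.
  have val u w : eps u G -> pair_in g u w -> w = app g u.
    by move=> uG /r1; have [_ h] := internal_funP gF uG; move/h.
  move=> /val-> // /val-> // /val-> //; last exact: gadd_in.
  have uC u : eps u G -> hcomplex (app g u).
    by move=> uG; apply: hcircle_hcomplex; case: (internal_funP gF uG).
  by apply/(hfun2P _ (uC a aG) (uC b bG)).2; rewrite gM.
move=> [gF gM].
have intg : internal_set g.
  have [_ h] := gF; have [b [_ [[q [qg _]] _]]] := h _ gzero_in.
  exact: inhabited_internal qg.
have {}gF : internal_fun g (elems G) (elems Circ) by apply/is_fun_int.
split=> // a b aG bG.
have val u : eps u G -> eps (app g u) Circ /\ pair_in g u (app g u).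
  by move=> uG; have [uC h] := internal_funP gF uG; split=> //; apply/r1/h.
have [aC ga] := val _ aG; have [bC gb] := val _ bG.
have abG := gadd_in aG bG; have [abC gab] := val _ abG.
have := gM _ aG _ bG _ abG (iffRL (triple_in_gadd _ aG bG) erefl) _ aC _ bC _ abC ga gb gab.
by move/((hfun2P _ (hcircle_hcomplex aC) (hcircle_hcomplex bC)).2).
Qed.

Lemma values_in_int N S g : elems S `<=` elems G -> ihom T g ->
  values_in N S g <-> forall a, eps a S -> eps (app g a) N.
Proof.
move=> SG [gF _]; have r1 := pair_inP (pairing_int W).
split=> h a aS; have [aC aP] := internal_funP gF (SG _ aS).
  by have [z [zN /r1/aP <-]] := h a aS.
by exists (app g a); split; [apply: h|apply/r1/aP].
Qed.

End InternalGroup.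

(** * The Bohr set and the upper bound *)

Section StandardDoubling.
Variables (R : realType) (V : superstructure R).

(** No small subgroups of the circle, quantitatively: squaring a point near 1
    almost doubles its distance to 1. *)
Lemma near_sqr (r : R) z : near 4^-1 z -> near r (z * z) -> near (4 / 7 * r) z.
Proof.
move=> /nearP[z1 zn] /nearP[_]; rewrite (_ : z * z - 1 = (z - 1) * (z + 1)); last by ring.
rewrite normcM => zz; apply/nearP; split=> //.
have : 2 <= normc (z + 1) + normc (z - 1).
  rewrite [normc (z - 1)]normcB_sym; apply: le_trans (le_normcD _ _).
  by rewrite (_ : z + 1 + (1 - z) = 2%:R) ?normc_nat //; ring.
move: (normc_ge0 (z - 1)) zn zz; move: (normc _) (normc _) => a b a0 a4 ab s2.
by nra.
Qed.

End StandardDoubling.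

Section Bohr.
Variables (R : realType) (V : superstructure R) (K : Type).
Variable W : nonstandard_universe V K.
Variable T : triplet W.
Hypothesis T_img : img_triplet T.

Local Notation hlev n := (star W (lev V n)).
Local Notation hcard m := (pair_in (star W (card_rel V m))).
Local Notation hcard_le m q := (pair_in (star W (card_le V m q))).
Local Notation G := (amb T).
Local Notation p := (plus T).
Local Notation Circ := (star W (circle_set V)).
Local Notation mulG := (star W (graph2 V (fun u v => u * v))).
Local Notation hnear r := (star W (cset V (near r))).
Local Notation "a +: b" := (gadd T a b) (at level 50, left associativity).

Variable m : nat.
Hypothesis Gm : eps G (hlev m).

Let grp := is_abgroup_T T_img.
Let homE := ihomP T_img.

(** The dual group is internal because its members, which are sets of pairs, are
    all in one *V_k. *)
Lemma hom_level g : ihom T g -> eps g (hlev m.+3).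
Proof.
move=> /homE hg; suff : is_abgroup G p -> eps G (hlev m) -> (exists n, eps n (star W (nat_set V)) /\
    hcard m G n) -> is_hom Circ mulG G p g -> eps g (hlev m.+3).
  apply=> //; have [[iG [n Gn]] _ _ _ _] := T_img; exists n.
  by split; [case: Gn|apply: has_icard_hcard].
apply: (@transferE _ _ _ W [:: circle_set V; graph2 V (fun u v => u * v); lev V m; lev V m.+3;
    nat_set V; card_rel V m]
  (fun M e => is_abgroup (e 6%N) (e 7%N) -> eps (e 6%N) (e 2%N) ->
   (exists n, eps n (e 4%N) /\ pair_in (e 5%N) (e 6%N) n) ->
   is_hom (e 0%N) (e 1%N) (e 6%N) (e 7%N) (e 8%N) -> eps (e 8%N) (e 3%N))
  isT _ _ [:: G; p; g] [::]); first by definable_by.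
move=> e gr /mem_lev Gl [_ [_ /pair_in_card[_ _ [n Gn _]]]] hom; apply/mem_lev.
have [gT [v [pr _]]] := exists_presents gr Gn.
exact: (hom_rank pr Gl hom).
Qed.

Lemma dual_setP : internal_set (dual_set T) /\ forall g, eps g (dual_set T) <-> ihom T g.
Proof.
have [A iA AP] := subset_int (hlev m.+3) (P := fun M e =>
  is_hom (e 2%N) (e 3%N) (e 4%N) (e 5%N) (e 0%N)) [:: Circ; mulG; G; p] [::]
  ltac:(definable_by).
apply: isetP iA _ => g; rewrite AP; split=> [[_ /homE]//|hg].
by split; [apply: hom_level|apply/homE].
Qed.

Lemma hcard_amb : exists g, hcard m.+4 G g.
Proof.
have [[iG [n Gn]] _ _ _ _] := T_img; exists n; apply: has_icard_hcard => //.
by apply: hlev_le Gm; rewrite -addn4 leq_addr.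
Qed.

Lemma hcard_sub (A : W) : internal_set A -> elems A `<=` elems G -> exists n, hcard m.+4 A n.
Proof.
move=> iA AG; have [g Gg] := hcard_amb.
have [] // : exists n, eps n (star W (nat_set V)) /\ hcard m.+4 A n; last by move=> n []; exists n.
have : hcard m.+4 G g -> (forall x, eps x A -> eps x G) -> ~ eps A (star W (indiv_set V)) ->
    exists n, eps n (star W (nat_set V)) /\ hcard m.+4 A n.
  apply: (@transferE _ _ _ W [:: card_rel V m.+4; indiv_set V; nat_set V]
    (fun M e => pair_in (e 0%N) (e 3%N) (e 4%N) -> (forall x, eps x (e 5%N) -> eps x (e 3%N)) ->
      ~ eps (e 5%N) (e 1%N) -> exists n, eps n (e 2%N) /\ pair_in (e 0%N) (e 5%N) n)
    isT _ _ [:: G; g; A] [::]); first by definable_by.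
  by move=> e Gc sub /mem_indiv_set nA; apply: card_exists Gc sub nA.
exact.
Qed.

Lemma hcard_homs (Gam : W) : internal_set Gam -> (forall c, eps c Gam -> ihom T c) ->
  exists n, hcard m.+4 Gam n.
Proof.
move=> iGam hom; have [g Gg] := hcard_amb; have [[iG [n Gn]] _ _ _ _] := T_img.
have Gn' : hcard m G n by apply: has_icard_hcard.
have : is_abgroup G p -> hcard m G n -> eps G (hlev m) ->
    (forall c, eps c Gam -> is_hom Circ mulG G p c) -> ~ eps Gam (star W (indiv_set V)) ->
    exists n, eps n (star W (nat_set V)) /\ hcard m.+4 Gam n.
  apply: (@transferE _ _ _ W [:: circle_set V; graph2 V (fun u v => u * v); card_rel V m;
    card_rel V m.+4; indiv_set V; nat_set V; lev V m]
    (fun M e => is_abgroup (e 7%N) (e 8%N) -> pair_in (e 2%N) (e 7%N) (e 9%N) -> eps (e 7%N) (e 6%N) ->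
      (forall c, eps c (e 10%N) -> is_hom (e 0%N) (e 1%N) (e 7%N) (e 8%N) c) ->
      ~ eps (e 10%N) (e 4%N) -> exists n, eps n (e 5%N) /\ pair_in (e 3%N) (e 10%N) n)
    isT _ _ [:: G; p; n; Gam] [::]); first by definable_by.
  by move=> e gr Gc /mem_lev Gl h /mem_indiv_set nGam; apply: card_homs_exists gr Gc Gl h nGam.
by move=> /(_ grp Gn' Gm (fun c cG => iffLR (homE c) (hom c cG)) iGam)[k [_ Gk]]; exists k.
Qed.

Lemma approx_near g a r : ihom T g -> eps a G ->
  hlt (hnorm (hsub (app g a) (hstd W 1))) (hstd W r%:C) <-> eps (app g a) (hnear r).
Proof.
move=> [gF _] aG; have [aC _] := internal_funP gF aG.
have [uC uP] := hfun2P (fun u v => u - v) (hcircle_hcomplex aC) (hstd_hcomplex W 1).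
have [wC wP] := hfun1P (fun z => `|z|) uC.
set z := app g a in aC *; set u := hsub _ _ in uC uP *; set w := hnorm u.
have : eps z Circ -> triple_in (star W (graph2 V (fun u v => u - v))) z (star W (cplx V 1)) u ->
    pair_in (star W (graph1 V (fun z => `|z|))) u w ->
    (pair_in (star W (lt_graph V)) w (star W (cplx V r%:C)) -> eps z (hnear r)) /\
    (eps z (hnear r) -> pair_in (star W (lt_graph V)) w (star W (cplx V r%:C))).
  apply: (@transferE _ _ _ W [:: circle_set V; graph2 V (fun u v => u - v); cplx V 1;
    graph1 V (fun z => `|z|); lt_graph V; cplx V r%:C; cset V (near r)]
    (fun M e => eps (e 7%N) (e 0%N) -> triple_in (e 1%N) (e 7%N) (e 2%N) (e 8%N) ->
      pair_in (e 3%N) (e 8%N) (e 9%N) ->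
      (pair_in (e 4%N) (e 9%N) (e 5%N) -> eps (e 7%N) (e 6%N)) /\
      (eps (e 7%N) (e 6%N) -> pair_in (e 4%N) (e 9%N) (e 5%N)))
    isT _ _ [:: z; u; w] [::]); first by definable_by.
  move=> e /mem_circle[c c1 /= <-] /= /triple_in_graph2[c' [o [/cplx_inj<- /cplx_inj<- ->]]].
  move=> /pair_in_graph1[d [/cplx_inj<- ->]]; rewrite mem_cset_cplx pair_in_lt; split.
    move=> [x [y [xy /cplx_inj cx /cplx_inj/complexI->]]]; apply/nearP.
    split; first by apply: complexI; rewrite -norm_normc.
    by rewrite -ltcR -norm_normc cx ltcR.
  move=> /nearP[_ cr]; exists (normc (c - 1)), r; split=> //.
move=> /(_ aC (iffRL (uP _) erefl) (iffRL (wP _) erefl))[h1 h2].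
by rewrite hltP; split.
Qed.

Lemma hnear_sqr (r : R) (z w : W) : eps z (hnear 4^-1) -> eps w (hnear r) -> triple_in mulG z z w ->
  eps z (hnear (4 / 7 * r)).
Proof.
apply: (@transferE _ _ _ W [:: cset V (near 4^-1); cset V (near r); graph2 V (fun u v => u * v);
    cset V (near (4 / 7 * r))]
  (fun M e => eps (e 4%N) (e 0%N) -> eps (e 5%N) (e 1%N) -> triple_in (e 2%N) (e 4%N) (e 4%N) (e 5%N) ->
    eps (e 4%N) (e 3%N)) isT _ _ [:: z; w] [::]); first by definable_by.
move=> e /mem_cset[c cn /= <-] /mem_cset[d dn /= <-] /triple_in_graph2[x [y [/cplx_inj<- /cplx_inj<- /cplx_inj h]]].
by apply/mem_cset_cplx/near_sqr => //; rewrite -h.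
Qed.

Lemma hnear_le (r r' : R) (z : W) : r <= r' -> eps z (hnear r) -> eps z (hnear r').
Proof.
move=> rr'; apply: star_sub => x /mem_cset[c /nearP[c1 cr] <-].
by apply/mem_cset_cplx/nearP; split=> //; apply: lt_le_trans rr'.
Qed.

Lemma app_gadd g a b : ihom T g -> eps a G -> eps b G ->
  triple_in mulG (app g a) (app g b) (app g (a +: b)).
Proof.
move=> [gF gM] aG bG.
have uC u : eps u G -> hcomplex (app g u).
  by move=> uG; apply: hcircle_hcomplex; case: (internal_funP gF uG).
by apply/(hfun2P _ (uC a aG) (uC b bG)).2; rewrite gM.
Qed.

(** Iterating [hnear_sqr] along [a], [2 a], [4 a], and so on, all of them in [H]. *)
Lemma near_subgroup g (H : set W) : ihom T g -> subgroup T H ->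
  (forall a, H a -> eps (app g a) (hnear 4^-1)) ->
  forall a, H a -> approx (app g a) (hstd W 1).
Proof.
move=> hg [HG _ HD _] Hn a Ha r r0; apply/approx_near => //; first exact: HG.
have Hj j b : H b -> eps (app g b) (hnear ((4 / 7) ^+ j * 4^-1)).
  elim: j b => [|j IH] b Hb; first by rewrite expr0 mul1r; apply: Hn.
  rewrite exprS -mulrA; apply: hnear_sqr (Hn b Hb) (IH _ (HD b b Hb Hb)) _.
  by apply: app_gadd => //; apply: HG.
have [j jr] := @unbounded_pow R (7 / 4) (4^-1 / r) ltac:(lra).
apply: hnear_le (Hj j a Ha).
have -> : (4 / 7) ^+ j = ((7 / 4) ^+ j)^-1 :> R by rewrite -exprVn; congr (_ ^+ _); field.
have h0 : 0 < (7 / 4) ^+ j :> R by rewrite exprn_gt0 //; lra.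
by move: jr; rewrite ltr_pdivrMr // => jr; rewrite mulrC ler_pdivrMr // mulrC ltW.
Qed.

Variable D : W.
Hypothesis D_between : between T D.

Let DG : elems D `<=` elems G.
Proof. by case: D_between => _ _ Df; case: T_img => _ _ [_ [fG _ _ _] _] _ _ x /Df/fG. Qed.

Lemma exists_bohr : exists2 Gam : W, internal_set Gam &
  forall g, eps g Gam <-> ihom T g /\ values_in (hnear 4^-1) D g.
Proof.
have [A iA AP] := subset_int (hlev m.+3) (P := fun M e =>
  is_hom (e 2%N) (e 3%N) (e 4%N) (e 5%N) (e 0%N) /\ values_in (e 6%N) (e 7%N) (e 0%N))
  [:: Circ; mulG; G; p; hnear 4^-1; D] [::] ltac:(definable_by).
exists A => // g; rewrite AP; split=> [[_ [/homE]]//|[hg vg]].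
by split; [apply: hom_level|split=> //; apply/homE].
Qed.

Lemma bohr_between Gam : internal_set Gam ->
  (forall g, eps g Gam <-> ihom T g /\ values_in (hnear 4^-1) D g) ->
  between (dual_triplet T) Gam.
Proof.
move=> iGam GamP; have [_ dP] := dual_setP; have [_ G0D Df] := D_between.
have [_ _ [sub0 _ _] _ _] := T_img; split=> // g /=.
  move=> [/dP hg gf]; apply/GamP; split=> //; apply/(values_in_int _ DG hg) => a aD.
  apply/approx_near => //; first exact: DG.
  by apply: (gf a (Df a aD)); rewrite invr_gt0.
move=> /GamP[hg /(values_in_int _ DG hg) gD]; split; first exact/dP.
by apply: near_subgroup hg sub0 _ => a /G0D; apply: gD.
Qed.

Lemma bohr_upper Gam n N g : (forall g, eps g Gam <-> ihom T g /\ values_in (hnear 4^-1) D g) ->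
  hcard m.+4 G g -> hcard m.+4 D n -> hcard m.+4 Gam N -> triple_in (star W (crel V (@dual_le R))) n N g.
Proof.
move=> GamP Gg Dn GN.
have : bohr_upper_stmt Circ mulG (hnear 4^-1) (star W (card_rel V m.+4)) (star W (crel V (@dual_le R)))
    G p D Gam n N g.
  apply: (@transferE _ _ _ W [:: circle_set V; graph2 V (fun u v => u * v); cset V (near 4^-1);
    card_rel V m.+4; crel V (@dual_le R)]
    (fun M e => bohr_upper_stmt (e 0%N) (e 1%N) (e 2%N) (e 3%N) (e 4%N) (e 5%N) (e 6%N) (e 7%N) (e 8%N)
      (e 9%N) (e 10%N) (e 11%N)) isT _ _ [:: G; p; D; Gam; n; N; g] [::]); first by definable_by.
  by move=> e; apply: bohr_upper_std.
by apply=> // c /GamP[/homE].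
Qed.

End Bohr.

(** * The lower bound *)

Section LowerBound.
Variables (R : realType) (V : superstructure R) (K : Type).
Variable W : nonstandard_universe V K.
Variable T : triplet W.
Hypothesis T_img : img_triplet T.
Hypothesis T_condensing : condensing T.

Local Notation hlev n := (star W (lev V n)).
Local Notation hcard m := (pair_in (star W (card_rel V m))).
Local Notation hcard_le m q := (pair_in (star W (card_le V m q))).
Local Notation G := (amb T).
Local Notation p := (plus T).
Local Notation G0 := (tri0 T).
Local Notation Gf := (trif T).
Local Notation Circ := (star W (circle_set V)).
Local Notation mulG := (star W (graph2 V (fun u v => u * v))).
Local Notation hnear r := (star W (cset V (near r))).
Local Notation "a +: b" := (gadd T a b) (at level 50, left associativity).

Variable m : nat.
Hypothesis Gm : eps G (hlev m).

Let grp := is_abgroup_T T_img.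
Let homE := ihomP T_img.
Let addE := triple_in_gadd T_img.

Let G0G : G0 `<=` elems G. Proof. by case: T_img => _ _ [[]]. Qed.
Let GfG : Gf `<=` elems G. Proof. by case: T_img => _ _ [_ []]. Qed.
Let G0D a b : G0 a -> G0 b -> G0 (a +: b).
Proof. by case: T_img => _ _ [[_ _ h _] _ _] _ _; apply: h. Qed.
Let G0N a : G0 a -> G0 (gopp T a).
Proof. by case: T_img => _ _ [[_ _ _ h] _ _] _ _; apply: h. Qed.
Let G00 : G0 (gzero T).
Proof. by case: T_img => _ _ [[_ h _ _] _ _] _ _; apply: h. Qed.
Let GfD a b : Gf a -> Gf b -> Gf (a +: b).
Proof. by case: T_img => _ _ [_ [_ _ h _] _] _ _; apply: h. Qed.
Let GfN a : Gf a -> Gf (gopp T a).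
Proof. by case: T_img => _ _ [_ [_ _ _ h] _] _ _; apply: h. Qed.

Lemma env_ts (M : eps_structure) (ws ts : seq M) :
  (fun i => env ws ts (40 + i)%N) = nth point ts.
Proof. by apply/funext => i; rewrite /env ltnNge leq_addr addKn. Qed.

(** Intersecting [B] with [- B]. *)
Lemma symmetric_part (B : W) : elems B `<=` elems G -> G0 `<=` elems B ->
  exists B', [/\ internal_set B', Defs.symmetric T B', G0 `<=` elems B' & elems B' `<=` elems B].
Proof.
move=> BG G0B.
have [B' iB' B'P] := subset_int B (P := fun M e => exists y, eps y (e 1%N) /\
  triple_in (e 2%N) (e 0%N) y (e 3%N)) [:: p; gzero T] [::] ltac:(definable_by).
have {}B'P x : eps x B' <-> eps x B /\ eps (gopp T x) B.
  rewrite B'P; split=> -[xB h]; split=> //; have xG := BG _ xB.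
    have [y [yB]] := h; have yG := BG _ yB; rewrite addE // => xy.
    by rewrite -(gopp_uniq T_img xG yG).
  exists (gopp T x); split=> //; apply/addE; rewrite ?gaddN //; exact: gopp_in.
exists B'; split=> //.
- by move=> b /B'P[bB nbB]; apply/B'P; rewrite goppK //; apply: BG.
- by move=> x G0x; apply/B'P; split; apply: G0B => //; apply: G0N.
- by move=> x /B'P[].
Qed.

(** A cover of [A] by translates of a symmetric part of [D] is also a cover by
    translates of [D]. *)
Lemma cover_le (A D : W) : between T D -> internal_set A -> elems A `<=` Gf ->
  eps (gzero T) A -> exists k, (0 < k)%N /\ hcard_le m.+4 k%:R A D.
Proof.
move=> [iD G0_D DGf] iA AGf zA; have DG : elems D `<=` elems G by move=> x /DGf/GfG.
have AG : elems A `<=` elems G by move=> x /AGf/GfG.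
have [B [iB sB G0B BD]] := symmetric_part DG G0_D.
have BG : elems B `<=` elems G by move=> x /BD/DG.
have [s [sG sP]] := T_condensing iA iB AGf sB G0B BG.
exists (size s); split.
  by have [t [b [ts _ _]]] := sP _ zA; case: (s) ts.
have [g Gg] := hcard_amb T_img Gm.
have : cover_stmt (size s) (star W (card_rel V m.+4)) (star W (card_le V m.+4 (size s)%:R))
    G p A D g (nth point s).
  rewrite -(env_ts [:: star W (card_rel V m.+4); star W (card_le V m.+4 (size s)%:R); G; p; A; D; g]).
  apply: (@transferE _ _ _ W [:: card_rel V m.+4; card_le V m.+4 (size s)%:R]
    (fun M e => cover_stmt (size s) (e 0%N) (e 1%N) (e 2%N) (e 3%N) (e 4%N) (e 5%N) (e 6%N)
      (fun i => e (40 + i)%N)) isT _ _ [:: G; p; A; D; g] s); first by definable_by.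
  by move=> e; apply: cover_std.
apply=> //.
- by exists (gzero T); split=> //; apply: gzero_in.
- by exists (gzero T); split; [apply: G0_D|apply: gzero_in].
move=> a aA; have [t [b [ts bB ->]]] := sP a aA; exists (index t s).
rewrite index_mem nth_index //; split=> //; split; first exact: sG.
exists b; split; first exact: BD.
by apply/addE => //; [apply: sG|apply: BG].
Qed.

(** Saturation at work: [G0 + G0] lies in [G0], so an internal neighbourhood of
    [D + G0] contains [D + B + B] for some internal neighbourhood [B] of [G0]. *)
Lemma small_neighbourhood (D A : W) : between T D ->
  (forall d x, eps d D -> G0 x -> eps (d +: x) A) ->
  exists B, [/\ internal_set B, Defs.symmetric T B, G0 `<=` elems B, elems B `<=` elems D &
    forall d x y, eps d D -> eps x B -> eps y B -> eps (d +: (x +: y)) A].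
Proof.
move=> [iD G0_D DGf] DA; have DG : elems D `<=` elems G by move=> x /DGf/GfG.
have inj := opair_inj (pairing_int W); have op := is_opairP (pairing_int W).
have pairs a b : eps a G -> eps b G -> eps (opair a b) (hlev m.+2).
  move=> aG bG.
  have : eps G (hlev m) -> eps a G -> eps b G -> exists q, eps q (hlev m.+2) /\ is_opair q a b.
    apply: (@transferE _ _ _ W [:: lev V m; lev V m.+2; indiv_set V] (fun M e => eps (e 3%N) (e 0%N) ->
      eps (e 4%N) (e 3%N) -> eps (e 5%N) (e 3%N) -> exists q, eps q (e 1%N) /\
      is_opair q (e 4%N) (e 5%N)) isT _ _ [:: G; a; b] [::]); first by definable_by.
    move=> e /mem_lev Gl ha hb; exists (opair (e 4%N) (e 5%N)).
    have nG : ~ indiv V (e 3%N) by apply: inhabited_not_indiv; exists (e 4%N).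
    have sub := rank_elems Gl nG; split; last exact/(is_opairP (pairing_std V)).
    apply/mem_lev; apply: rank_opair; apply: (@rank_le _ _ m.-1 m (leq_pred m)); exact: sub.
  by move=> /(_ Gm aG bG)[q [qm /op <-]].
have [X _ XP] := subset_int (hlev m.+2) (P := fun M e =>
  exists a, eps a (e 2%N) /\ exists b, eps b (e 2%N) /\ (is_opair (e 0%N) a b /\
  exists d, eps d (e 4%N) /\ exists u, eps u (e 2%N) /\ exists w, eps w (e 2%N) /\
  (triple_in (e 3%N) a b u /\ (triple_in (e 3%N) d u w /\ ~ eps w (e 5%N))))) [:: G; p; D; A] [::]
  ltac:(definable_by).
have {}XP a b : eps a G -> eps b G -> eps (opair a b) X <->
    exists2 d, eps d D & ~ eps (d +: (a +: b)) A.
  move=> aG bG; have abG := gadd_in T_img aG bG; rewrite XP; split.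
    move=> [_ [a' [_ [b' [_ [/op/inj[<- <-] [d [dD [u [_ [w [_ [abu [duw nw]]]]]]]]]]]]]].
    move/addE: abu => /(_ aG bG) uE; rewrite uE in duw.
    by move/addE: duw => /(_ (DG _ dD) abG) wE; exists d; rewrite // -wE.
  move=> [d dD dA]; have dG := DG _ dD; split; first exact: pairs.
  exists a; split=> //; exists b; split=> //; split; first exact/op.
  exists d; split=> //; exists (a +: b); split=> //; exists (d +: (a +: b)).
  split; first exact: (gadd_in T_img dG abG).
  by split; [apply/addE|split=> //; apply/addE].
have [_ _ _ mon _] := T_img.
have [|s [sG0 sP]] := monadic_pairs (X := X) mon.
  by move=> a b Ga Gb /(XP _ _ (G0G Ga) (G0G Gb))[d dD]; apply; apply: DA => //; apply: G0D.
have [B0 _ B0P] := internal_meet D s.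
have B0D : elems B0 `<=` elems D by move=> x /B0P[].
have B0G : elems B0 `<=` elems G by move=> x /B0D/DG.
have G0B0 : G0 `<=` elems B0.
  by move=> x G0x; apply/B0P; split; [apply: G0_D|move=> A' /sG0; apply].
have [B [iB sB G0B BB0]] := symmetric_part B0G G0B0.
exists B; split=> //; first by move=> x /BB0/B0D.
move=> d x y dD xB yB; apply: contrapT => nA.
have [xD xs] := iffLR (B0P x) (BB0 _ xB); have [yD ys] := iffLR (B0P y) (BB0 _ yB).
apply: (sP x y); first by move=> A' A's; split; [apply: xs|apply: ys].
by apply/XP; [apply: DG|apply: DG|exists d].
Qed.

Lemma internal_sumset (A B : W) : elems A `<=` elems G -> elems B `<=` elems G ->
  exists2 S, internal_set S & forall u, eps u S <-> exists a b, [/\ eps a A, eps b B & u = a +: b].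
Proof.
move=> AG BG; have [S iS SP] := subset_int G (P := fun M e => exists a, eps a (e 3%N) /\
  exists b, eps b (e 4%N) /\ triple_in (e 2%N) a b (e 0%N)) [:: p; A; B] [::] ltac:(definable_by).
exists S => // u; rewrite SP; split=> [[uG [a [aA [b [bB]]]]]|[a [b [aA bB ->]]]].
  by move/(addE _ (AG _ aA) (BG _ bB)); exists a, b.
have [aG bG] := (AG _ aA, BG _ bB); split; first exact: gadd_in.
by exists a; split=> //; exists b; split=> //; apply/addE.
Qed.

Lemma internal_diffset (A B : W) : elems A `<=` elems G -> elems B `<=` elems G ->
  exists2 S, internal_set S &
    forall u, eps u S <-> exists a b, [/\ eps a A, eps b B & u = a +: gopp T b].
Proof.
move=> AG BG; have [S iS SP] := subset_int G (P := fun M e => exists a, eps a (e 3%N) /\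
  exists b, eps b (e 4%N) /\ triple_in (e 2%N) (e 0%N) b a) [:: p; A; B] [::] ltac:(definable_by).
exists S => // u; rewrite SP; split=> [[uG [a [aA [b [bB]]]]]|[a [b [aA bB ->]]]].
  move/(addE _ uG (BG _ bB)) => ab; exists a, b; split=> //.
  by rewrite ab gaddK //; apply: BG.
have [aG bG] := (AG _ aA, BG _ bB); have uG := gadd_in T_img aG (gopp_in T_img bG).
split=> //; exists a; split=> //; exists b; split=> //; apply/addE => //.
by rewrite gsubK.
Qed.

Lemma hcard_le_ge1 q (A D : W) x : eps x D -> elems D `<=` elems A -> hcard_le m.+4 q A D -> 1 <= q.
Proof.
move=> xD DA AD; rewrite leNgt; apply/negP => q1.
suff : eps x D -> (forall x, eps x D -> eps x A) -> ~ hcard_le m.+4 q A D by apply.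
apply: (@transferE _ _ _ W [:: card_le V m.+4 q] (fun M e => eps (e 3%N) (e 2%N) ->
  (forall x, eps x (e 2%N) -> eps x (e 1%N)) -> ~ pair_in (e 0%N) (e 1%N) (e 2%N))
  isT _ _ [:: A; D; x] [::]); first by definable_by.
by move=> e xD' DA'; apply: card_le_ge1 q1 xD' DA'.
Qed.

Lemma bohr_lower (D Gam n N g : W) : between T D ->
  (forall c, eps c Gam <-> ihom T c /\ values_in (hnear 4^-1) D c) ->
  hcard m.+4 G g -> hcard m.+4 D n -> hcard m.+4 Gam N ->
  exists2 c : R, 0 < c & triple_in (star W (crel V (dual_ge c))) n N g.
Proof.
move=> DT GamP Gg Dn GN; have [iD G0_D DGf] := DT.
have DG : elems D `<=` elems G by move=> x /DGf/GfG.
have zD : eps (gzero T) D by apply: G0_D.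
have zG := gzero_in T_img; have z0 := gadd0 T_img zG.
have [DD iDD DDP] := internal_sumset DG DG.
have DDGf : elems DD `<=` Gf by move=> _ /DDP[x [y [xD yD ->]]]; apply: GfD; apply: DGf.
have DDG : elems DD `<=` elems G by move=> x /DDGf/GfG.
have zDD : eps (gzero T) DD by apply/DDP; exists (gzero T), (gzero T); rewrite z0.
have [E iE EP] := internal_diffset DDG DG.
have EGf : elems E `<=` Gf.
  by move=> _ /EP[x [y [/DDGf xf /DGf yf ->]]]; apply: GfD => //; apply: GfN.
have EG : elems E `<=` elems G by move=> x /EGf/GfG.
have zE : eps (gzero T) E.
  by apply/EP; exists (gzero T), (gzero T); split=> //; rewrite gaddN.
have [kE [kE_gt0 leE]] := cover_le DT iE EGf zE.
pose s : R := Num.sqrt kE%:R.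
have s2 : s ^+ 2 = kE%:R by rewrite sqr_sqrtr.
have s_gt0 : 0 < s by rewrite sqrtr_gt0 ltr0n.
(* [A] is a neighbourhood of [D + G0] whose size is minimal up to a factor
   [1 + (128 s)^-1], the growth allowed by [bohr_lower_std]. *)
pose Q (q : R) := exists A, [/\ internal_set A, elems A `<=` elems G,
  forall d x, eps d D -> G0 x -> eps (d +: x) A & hcard_le m.+4 q A D].
have [kD [kD_gt0 leDD]] := cover_le DT iDD DDGf zDD.
have [q [q_gt0 [A [iA AG DA leA]] nQ]] : exists q, [/\ 0 < q, Q q & ~ Q (q / (1 + (128 * s)^-1))].
  apply: (@last_ratio _ Q kD%:R); rewrite ?ltr0n ?ltrDl ?invr_gt0 ?mulr_gt0 //.
    exists DD; split=> // d x dD /G0_D xD; apply/DDP; by exists d, x.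
  move=> q [A [_ _ DA leA]]; apply: hcard_le_ge1 zD _ leA => x xD.
  by rewrite -(gadd0 T_img (DG _ xD)); apply: DA.
have [B [iB sB G0B BD BA]] := small_neighbourhood DT DA.
have BG : elems B `<=` elems G by move=> x /BD/DG.
have zB : eps (gzero T) B by apply: G0B.
have [X iX XP] := internal_sumset DG BG.
have XG : elems X `<=` elems G.
  by move=> _ /XP[x [y [/DG xG /BG yG ->]]]; apply: gadd_in.
have [t [tG tP]] := T_condensing iD iB DGf sB G0B BG.
exists (2 * s ^+ 2 * (1089 ^ size t)%:R).
  by rewrite !mulr_gt0 ?exprn_gt0 // ltr0n expn_gt0.
pose cs := [:: circle_set V; graph2 V (fun u v => u * v); cset V (near 4^-1);
  card_rel V m.+4; crel V (dual_ge (2 * s ^+ 2 * (1089 ^ size t)%:R)); lev V m.+3; lev V m;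
  card_le V m.+4 q; card_le V m.+4 (q / (1 + (128 * s)^-1)); card_le V m.+4 (s ^+ 2)].
pose ws := [:: G; p; D; B; X; A; E; Gam; n; N; g].
have : bohr_lower_stmt (size t) (star W (nth point cs 0)) (star W (nth point cs 1))
    (star W (nth point cs 2)) (star W (nth point cs 3)) (star W (nth point cs 4))
    (star W (nth point cs 5)) (star W (nth point cs 6)) (star W (nth point cs 7))
    (star W (nth point cs 8)) (star W (nth point cs 9)) G p D B X A E Gam n N g (nth point t).
  rewrite -(env_ts (map (star W) cs ++ ws)).
  apply: (@transferE _ _ _ W cs
    (fun M e => bohr_lower_stmt (size t) (e 0%N) (e 1%N) (e 2%N) (e 3%N) (e 4%N) (e 5%N) (e 6%N) (e 7%N)
      (e 8%N) (e 9%N) (e 10%N) (e 11%N) (e 12%N) (e 13%N) (e 14%N) (e 15%N) (e 16%N) (e 17%N)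
      (e 18%N) (e 19%N) (e 20%N) (fun i => e (40 + i)%N)) isT _ _ ws t).
    by definable_by.
  by move=> e; apply: bohr_lower_std.
apply=> //=.
- by exists (gzero T); split=> //; apply/XP; exists (gzero T), (gzero T); rewrite z0.
- by move=> x xD; rewrite -(gadd0 T_img (DG _ xD)); apply: DA.
- move=> _ /XP[d [b [dD bB ->]]]; rewrite -[b](gadd0 T_img (BG _ bB)); exact: BA.
- move=> _ /XP[d [x [dD xB ->]]] b bB; exists (d +: (x +: b)); split; first exact: BA.
  have [dG xG bG] := And3 (DG _ dD) (BG _ xB) (BG _ bB).
  by apply/addE; rewrite ?gaddA //; apply: gadd_in.
- move=> x xX d dD; exists (x +: gopp T d); have xG := XG _ xX; have dG := DG _ dD.
  split; last by apply/addE; rewrite ?gsubK //; apply: gadd_in => //; apply: gopp_in.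
  apply/EP; exists x, d; split=> //; apply/DDP; have /XP[d' [b [d'D /BD bD ->]]] := xX.
  by exists d', b.
- by move=> leX; apply: nQ; exists X; split=> // d x dD /G0B xB; apply/XP; exists d, x.
- by rewrite s2.
- move=> d dD; have [u [b [ut bB ->]]] := tP d dD; exists (index u t).
  rewrite index_mem nth_index //; split=> //; split; first exact: tG.
  exists b; split=> //; apply/addE => //; [exact: tG|exact: BG].
- by move=> c _ /homE hc vc; apply/GamP.
Qed.

End LowerBound.

(** * Normalizing multipliers *)

Section Multipliers.
Variables (R : realType) (V : superstructure R) (K : Type).
Variable W : nonstandard_universe V K.

Local Notation C := R[i].
Local Notation mulG := (graph2 V (fun u v => u * v)).
Local Notation divG := (graph2 V (fun u v => u / v)).
Local Notation invG := (graph1 V (fun z => z^-1)).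
Local Notation normG := (graph1 V (fun z => `|z|)).
Local Notation realc r := (cplx V r%:C).

Lemma pair_in_lt_real (a b : R) : pair_in (lt_graph V) (realc a) (realc b) <-> a < b.
Proof.
rewrite pair_in_lt; split=> [[x [y [xy /cplx_inj/complexI-> /cplx_inj/complexI->]]]|] //.
by exists a, b.
Qed.

Lemma norm_real (a : R) : `|a%:C| = `|a|%:C :> C.
Proof. by rewrite norm_normc normc_real. Qed.

Lemma hltE (x y : W) : hlt x y = pair_in (star W (lt_graph V)) x y.
Proof. exact/propext/hltP. Qed.

Lemma dual_le_real (x y z : C) : dual_le x y z -> exists n N g : R,
  [/\ x = n%:C, y = N%:C, z = g%:C & N * n <= 4 * g].
Proof.
move=> [n [N [g [[le_g _] -> -> ->]]]]; exists n%:R, N%:R, g%:R.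
by rewrite !rmorph_nat.
Qed.

Lemma dual_ge_pos c (x y z : C) : dual_ge c x y z -> exists n N g : R,
  [/\ x = n%:C, y = N%:C, z = g%:C & [/\ 1 <= n, 0 <= N, 1 <= g & g <= c * (n * N)]].
Proof.
move=> [n [N [g [[le_g g1] -> -> ->]]]]; exists n%:R, N%:R, g%:R.
rewrite !rmorph_nat; split=> //; split=> //; rewrite ler1n lt0n; apply/eqP => n0.
by move: le_g; rewrite n0 mul0r mulr0 leNgt (lt_le_trans ltr01).
Qed.

(** Arithmetic of hyperreals, transferred.  Every intermediate value is a variable
    tied to the others by the graphs of the operations; [n >= 1] comes from
    [dual_ge c n N g]. *)
Lemma reciprocal_multiplier (c : R) (n N g v w x : W) :
  triple_in (star W (crel V (dual_ge c))) n N g -> triple_in (star W divG) (hstd W 1) n v ->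
  triple_in (star W mulG) v n w -> pair_in (star W normG) w x ->
  [/\ hreal v, hlt (hstd W 0) v, hlt x (hstd W 2%:C) & ~ hlt x (hstd W 1%:C)].
Proof.
move=> h1 h2 h3 h4; rewrite !hltE.
suff [? [? [? ?]]] : eps v (star W (real_set V)) /\ (pair_in (star W (lt_graph V)) (star W (realc 0)) v /\
    (pair_in (star W (lt_graph V)) x (star W (realc 2)) /\
    ~ pair_in (star W (lt_graph V)) x (star W (realc 1)))) by split.
move: h1 h2 h3 h4.
apply: (@transferE _ _ _ W [:: crel V (dual_ge c); divG; mulG; normG; real_set V; lt_graph V;
    realc 0; realc 1; realc 2]
  (fun M e => triple_in (e 0%N) (e 9%N) (e 10%N) (e 11%N) -> triple_in (e 1%N) (e 7%N) (e 9%N) (e 12%N) ->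
    triple_in (e 2%N) (e 12%N) (e 9%N) (e 13%N) -> pair_in (e 3%N) (e 13%N) (e 14%N) ->
    eps (e 12%N) (e 4%N) /\ (pair_in (e 5%N) (e 6%N) (e 12%N) /\ (pair_in (e 5%N) (e 14%N) (e 8%N) /\
    ~ pair_in (e 5%N) (e 14%N) (e 7%N)))) isT _ _ [:: n; N; g; v; w; x] [::]); first by definable_by.
move=> e /triple_in_crel[n1 [N1 [g1 [/dual_ge_pos[a [b [k [-> -> -> [a1 b0 k1 _]]]]] En _ _]]]].
rewrite /fixenv /= in En *; rewrite {}En.
move=> /triple_in_graph2[o [? [/cplx_inj <- /cplx_inj <- ->]]].
move=> /triple_in_graph2[? [? [/cplx_inj <- /cplx_inj <- ->]]] /pair_in_graph1[? [/cplx_inj <- ->]].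
have a_gt0 : 0 < a by apply: lt_le_trans a1.
have av : (1%:C / a%:C) = (a^-1)%:C :> C by rewrite rmorphV ?unitfE ?gt_eqF //= div1r.
rewrite av -rmorphM /= mulVf ?gt_eqF // norm_real normr1 !pair_in_lt_real.
rewrite mem_real; split; first by exists a^-1.
by rewrite invr_gt0 a_gt0 ltr1n ltxx.
Qed.

(** From [r2 <= d n < r1], [n N <= 4 g] and [g <= c n N] it follows that
    [N / (d g)] is at most [4 / r2] and at least [1 / (c r1)]; the sum [r1 ^ 2 + 1]
    replaces [r1] to have a bound that is visibly positive. *)
Lemma dual_multiplier (c r1 r2 : R) (d n N g u1 v1 u v w x : W) : 0 < c -> 0 < r2 ->
  hreal d -> hlt (hstd W 0) d ->
  triple_in (star W mulG) d n u1 -> pair_in (star W normG) u1 v1 ->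
  hlt v1 (hstd W r1%:C) -> ~ hlt v1 (hstd W r2%:C) ->
  triple_in (star W (crel V (@dual_le R))) n N g -> triple_in (star W (crel V (dual_ge c))) n N g ->
  triple_in (star W mulG) d g u -> pair_in (star W invG) u v -> triple_in (star W mulG) v N w ->
  pair_in (star W normG) w x ->
  [/\ hreal v, hlt (hstd W 0) v, hlt x (hstd W (4 / r2 + 1)%:C) & ~ hlt x (hstd W (c * (r1 ^+ 2 + 1))^-1%:C)].
Proof.
move=> c0 r20; rewrite !hltE => h1 h2 h3 h4 h5 h6 h7 h8 h9 h10 h11 h12.
suff [? [? [? ?]]] : eps v (star W (real_set V)) /\ (pair_in (star W (lt_graph V)) (star W (realc 0)) v /\
    (pair_in (star W (lt_graph V)) x (star W (realc (4 / r2 + 1))) /\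
    ~ pair_in (star W (lt_graph V)) x (star W (realc (c * (r1 ^+ 2 + 1))^-1)))) by split.
move: h1 h2 h3 h4 h5 h6 h7 h8 h9 h10 h11 h12.
apply: (@transferE _ _ _ W [:: real_set V; lt_graph V; mulG; normG; invG; realc r1; realc r2;
    crel V (@dual_le R); crel V (dual_ge c); realc 0; realc (4 / r2 + 1); realc (c * (r1 ^+ 2 + 1))^-1]
  (fun M e => eps (e 12%N) (e 0%N) -> pair_in (e 1%N) (e 9%N) (e 12%N) ->
    triple_in (e 2%N) (e 12%N) (e 13%N) (e 16%N) -> pair_in (e 3%N) (e 16%N) (e 17%N) ->
    pair_in (e 1%N) (e 17%N) (e 5%N) -> ~ pair_in (e 1%N) (e 17%N) (e 6%N) ->
    triple_in (e 7%N) (e 13%N) (e 14%N) (e 15%N) -> triple_in (e 8%N) (e 13%N) (e 14%N) (e 15%N) ->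
    triple_in (e 2%N) (e 12%N) (e 15%N) (e 18%N) -> pair_in (e 4%N) (e 18%N) (e 19%N) ->
    triple_in (e 2%N) (e 19%N) (e 14%N) (e 20%N) -> pair_in (e 3%N) (e 20%N) (e 21%N) ->
    eps (e 19%N) (e 0%N) /\ (pair_in (e 1%N) (e 9%N) (e 19%N) /\ (pair_in (e 1%N) (e 21%N) (e 10%N) /\
    ~ pair_in (e 1%N) (e 21%N) (e 11%N))))
  isT _ _ [:: d; n; N; g; u1; v1; u; v; w; x] [::]).
  by definable_by.
move=> e; rewrite /fixenv /= => /mem_real[d1 ->].
rewrite pair_in_lt_real => d0 /triple_in_graph2[? [n1 [/cplx_inj <- -> ->]]].
move=> /pair_in_graph1[? [/cplx_inj <- ->]] lt1 lt2.
move=> /triple_in_crel[? [? [? [/dual_le_real[a [b [k [-> -> -> le_up]]]] /cplx_inj En -> ->]]]].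
move=> /triple_in_crel[? [? [? [/dual_ge_pos[a' [b' [k' [-> -> -> [a1 b0 k1 le_low]]]]]]]]].
rewrite En => /cplx_inj/complexI Ea /cplx_inj/complexI Eb /cplx_inj/complexI Ek.
move=> /triple_in_graph2[? [? [/cplx_inj <- /cplx_inj <- ->]]] /pair_in_graph1[? [/cplx_inj <- ->]].
move=> /triple_in_graph2[? [? [/cplx_inj <- /cplx_inj <- ->]]] /pair_in_graph1[? [/cplx_inj <- ->]].
move: le_low a1 b0 k1 lt1 lt2; rewrite En -{}Ea -{}Eb -{}Ek => le_low a1 b0 k1.
have a_gt0 : 0 < a by apply: lt_le_trans a1.
have k_gt0 : 0 < k by apply: lt_le_trans k1.
have dk_gt0 : 0 < d1 * k by rewrite mulr_gt0.
have vE : (d1%:C * k%:C)^-1 = (d1 * k)^-1%:C :> C.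
  by rewrite -rmorphM /= -rmorphV ?unitfE ?gt_eqF.
have -> : d1%:C * a%:C = (d1 * a)%:C :> C by rewrite rmorphM.
rewrite vE; have -> : (d1 * k)^-1%:C * b%:C = ((d1 * k)^-1 * b)%:C :> C by rewrite rmorphM.
rewrite !norm_real !pair_in_lt_real !ger0_norm ?mulr_ge0 ?invr_ge0 ?(ltW dk_gt0) ?(ltW d0) ?(ltW a_gt0) //.
move=> lt1 /negP; rewrite -leNgt => le2.
have da_gt0 : 0 < d1 * a by rewrite mulr_gt0.
have r1_gt0 : 0 < r1 ^+ 2 + 1 by rewrite ltr_wpDl // sqr_ge0.
have {}lt1 : d1 * a < r1 ^+ 2 + 1 by apply: lt_le_trans lt1 _; nra.
rewrite mem_real; split; first by exists (d1 * k)^-1.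
rewrite invr_gt0; split=> //; split.
  apply: (@le_lt_trans _ _ (4 / r2)); last by rewrite ltrDl.
  rewrite mulrC ler_pdivrMr // mulrAC ler_pdivlMr //.
  apply: le_trans (ler_wpM2l b0 le2) _; rewrite mulrCA [4 * _]mulrCA ler_wpM2l ?(ltW d0) //.
apply/negP; rewrite -leNgt [leRHS]mulrC ler_pdivlMr // [leLHS]mulrC.
rewrite ler_pdivrMr ?mulr_gt0 //.
have : d1 * k <= d1 * (c * (a * b)) by rewrite ler_wpM2l // ltW.
move=> /le_trans; apply; have -> : d1 * (c * (a * b)) = (c * b) * (d1 * a) by ring.
by rewrite (_ : b * (c * (r1 ^+ 2 + 1)) = c * b * (r1 ^+ 2 + 1)) ?ler_wpM2l ?mulr_ge0 ?(ltW c0) ?(ltW lt1) //; ring.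
Qed.

Lemma quotient_reciprocal (c : R) (n N g a v u b : W) :
  triple_in (star W (crel V (dual_ge c))) n N g -> triple_in (star W divG) n g a ->
  triple_in (star W divG) (hstd W 1) n v -> triple_in (star W mulG) v g u ->
  pair_in (star W invG) u b -> a = b.
Proof.
apply: (@transferE _ _ _ W [:: crel V (dual_ge c); divG; mulG; invG; cplx V 1]
  (fun M e => triple_in (e 0%N) (e 5%N) (e 6%N) (e 7%N) -> triple_in (e 1%N) (e 5%N) (e 7%N) (e 8%N) ->
    triple_in (e 1%N) (e 4%N) (e 5%N) (e 9%N) -> triple_in (e 2%N) (e 9%N) (e 7%N) (e 10%N) ->
    pair_in (e 3%N) (e 10%N) (e 11%N) -> e 8%N = e 11%N)
  isT _ _ [:: n; N; g; a; v; u; b] [::]); first by definable_by.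
move=> e; rewrite /fixenv /= => /triple_in_crel[? [? [? [/dual_ge_pos[n1 [N1 [g1 [-> -> -> [n_ge1 _ _ _]]]]] En _ Eg]]]].
rewrite {}En {}Eg => /triple_in_graph2[? [? [/cplx_inj <- /cplx_inj <- ->]]].
move=> /triple_in_graph2[? [? [/cplx_inj <- /cplx_inj <- ->]]].
move=> /triple_in_graph2[? [? [/cplx_inj <- /cplx_inj <- ->]]] /pair_in_graph1[? [/cplx_inj <- ->]].
by rewrite invfM div1r invrK.
Qed.

End Multipliers.

Section Main.
Variables (R : realType) (V : superstructure R) (K : Type).
Variable W : nonstandard_universe V K.
Variable T : triplet W.
Hypothesis T_img : img_triplet T.
Hypothesis T_condensing : condensing T.

Local Notation C := R[i].
Local Notation mulG := (graph2 V (fun u v => u * v)).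
Local Notation divG := (graph2 V (fun u v => u / v)).
Local Notation invG := (graph1 V (fun z => z^-1)).
Local Notation normG := (graph1 V (fun z => `|z|)).

(** The heart of the matter: up to standard factors the Bohr set of [D] has
    [|G| / |D|] elements. *)
Lemma bohr_bounds D : between T D -> exists Gam, between (dual_triplet T) Gam /\
  exists c : R, [/\ 0 < c, hcomplex (icard D), hcomplex (icard Gam), hcomplex (icard (amb T)) &
    triple_in (star W (crel V (@dual_le R))) (icard D) (icard Gam) (icard (amb T)) /\
    triple_in (star W (crel V (dual_ge c))) (icard D) (icard Gam) (icard (amb T))].
Proof.
move=> DT; have [m Gm] := hlev_cover (amb T).
have [g Gg] := hcard_amb T_img Gm.
have [iD _ DGf] := DT.
have DG : elems D `<=` elems (amb T).
  by move=> x /DGf; case: T_img => _ _ [_ [h _ _ _] _] _ _; apply: h.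
have [n Dn] := hcard_sub T_img Gm iD DG.
have [Gam iGam GamP] := exists_bohr T_img Gm D.
have [N GN] := hcard_homs T_img Gm iGam (fun c cG => (iffLR (GamP c) cG).1).
have [c c0 low] := bohr_lower T_img T_condensing Gm DT GamP Gg Dn GN.
exists Gam; split; first exact: (bohr_between T_img Gm DT iGam GamP).
have natC A k : pair_in (star W (card_rel V m.+4)) A k -> hcomplex k.
  by move=> /hcard_level[_ [_ kN]]; apply/hreal_hcomplex/hnat_hreal.
exists c; rewrite (icardE Gg) (icardE Dn) (icardE GN).
split; [by []|exact: natC Dn|exact: natC GN|exact: natC Gg|split=> //].
exact: (bohr_upper T_img DT GamP Gg Dn GN).
Qed.

Lemma primal_normalizing D : between T D ->
  normalizing_multiplier T (hdiv (hstd W 1) (icard D)).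
Proof.
move=> DT; have [Gam [_ [c [_ nC NC gC [_ low]]]]] := bohr_bounds DT.
have [vC vP] := hfun2P (fun u v => u / v) (hstd_hcomplex W 1) nC.
have [wC wP] := hfun2P (fun u v => u * v) vC nC.
have [xC xP] := hfun1P (fun z => `|z|) wC.
have [v1 v2 x1 x2] := reciprocal_multiplier low (iffRL (vP _) erefl) (iffRL (wP _) erefl)
  (iffRL (xP _) erefl).
split; [exact: v1|exact: v2|exists D; split; [exact: DT|by exists 2|]].
by move=> /(_ 1 ltr01).
Qed.

Lemma dual_normalizing d : normalizing_multiplier T d ->
  normalizing_multiplier (dual_triplet T) (hinv (hmul d (icard (amb T)))).
Proof.
move=> [dR d0 [D [DT [r1 fin] ninf]]].
have [r2 [r20 nlt]] : exists r2 : R, 0 < r2 /\ ~ hlt (hnorm (hmul d (icard D))) (hstd W r2%:C).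
  apply: contrapT => no; apply: ninf => r r0; apply: contrapT => h; apply: no.
  by exists r.
have [Gam [GT [c [c0 nC NC gC [up low]]]]] := bohr_bounds DT.
have dC := hreal_hcomplex dR.
have [u1C u1P] := hfun2P (fun u v => u * v) dC nC.
have [v1C v1P] := hfun1P (fun z => `|z|) u1C.
have [uC uP] := hfun2P (fun u v => u * v) dC gC.
have [vC vP] := hfun1P (fun z => z^-1) uC.
have [wC wP] := hfun2P (fun u v => u * v) vC NC.
have [xC xP] := hfun1P (fun z => `|z|) wC.
have [vR v0 x1 x2] := dual_multiplier c0 r20 dR d0 (iffRL (u1P _) erefl) (iffRL (v1P _) erefl)
  fin nlt up low (iffRL (uP _) erefl) (iffRL (vP _) erefl) (iffRL (wP _) erefl)
  (iffRL (xP _) erefl).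
have r1_gt0 : 0 < r1 ^+ 2 + 1 by rewrite ltr_wpDl // sqr_ge0.
split; [exact: vR|exact: v0|exists Gam; split; [exact: GT|by exists (4 / r2 + 1)|]].
have k_gt0 : 0 < (c * (r1 ^+ 2 + 1))^-1 by rewrite invr_gt0 mulr_gt0.
by move=> /(_ _ k_gt0).
Qed.

(** The multiplier [|D| / |G|] is the one that corresponds to [1 / |D|]. *)
Lemma quotient_is_dual D : between T D ->
  hdiv (icard D) (icard (amb T)) = hinv (hmul (hdiv (hstd W 1) (icard D)) (icard (amb T))).
Proof.
move=> DT; have [Gam [_ [c [_ nC NC gC [_ low]]]]] := bohr_bounds DT.
have [aC aP] := hfun2P (fun u v => u / v) nC gC.
have [vC vP] := hfun2P (fun u v => u / v) (hstd_hcomplex W 1) nC.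
have [uC uP] := hfun2P (fun u v => u * v) vC gC.
have [bC bP] := hfun1P (fun z => z^-1) uC.
exact: (quotient_reciprocal low (iffRL (aP _) erefl) (iffRL (vP _) erefl)
  (iffRL (uP _) erefl) (iffRL (bP _) erefl)).
Qed.

End Main.

Theorem theorem2p3p4 (R : realType) (V : superstructure R) (K : Type)
  (K_uncountable : ~ countable [set: K]%classic)
  (W : nonstandard_universe V K) (T : triplet W)
  (T_img : img_triplet T) (T_condensing : condensing T) :
  (forall D : W, between T D ->
     normalizing_multiplier T (hdiv (hstd W 1%R) (icard D)) /\
     normalizing_multiplier (dual_triplet T) (hdiv (icard D) (icard (amb T)))) /\
  (forall d : W, normalizing_multiplier T d ->
     normalizing_multiplier (dual_triplet T) (hinv (hmul d (icard (amb T))))).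
Proof.
split=> [D DT|d]; last exact: dual_normalizing.
have nD := primal_normalizing T_img T_condensing DT; split; first exact: nD.
by rewrite (quotient_is_dual T_img T_condensing DT); apply: dual_normalizing.
Qed.
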